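(* Consider the unconstrained linear time-varying (LTV) online control problem with prediction errors on costs and dynamics described in the context, under the assumptions listed there. There exist constants $H_2\ge1$ and $\lambda_2\in(0,1)$ that are perturbation constants for the problem in the sense of the context, and constants $c_0,c_1>0$, all depending only on the problem constants (and not on $T$, $k$ or the prediction errors), such that whenever the prediction horizon satisfies $k\ge c_0$ and the prediction errors satisfy $\sum_{\tau=0}^k\lambda_2^{2\tau}\rho_{t,\tau}\le c_1$ for all $t$, the dynamic regret of $\mathrm{MPC}_k$ with terminal cost $F_{t+k}(\cdot;\xi_{t+k\mid t})=\mathbb{I}(\cdot;\bar x_{t+k}(\xi_{t+k\mid t}))$ for $t<T-k$ is bounded by $$\mathrm{cost}(\mathrm{MPC}_k)-\mathrm{cost}(\mathrm{OPT})\le O\left(\sqrt{T\cdot\sum_{\tau=0}^{k-1}\lambda_2^\tau P(\tau)+\lambda_2^{2k}T^2}+\sum_{\tau=0}^{k-1}\lambda_2^\tau P(\tau)\right).$$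
   Context: Notation: $\|\cdot\|$ is the Euclidean norm for vectors and the spectral norm for matrices; $\mathcal{B}(x,r)$ is the closed ball; $\alpha_{t_1:t_2}=(\alpha_{t_1},\dots,\alpha_{t_2})$. The problem constants are $\mu,\ell,\sigma,a,b,D_w,D_{\bar x},D_{x^*},L_g$ and the Lipschitz constants $L_A,L_B,L_Q,L_R,L_P,L_{\bar x},L_w$ below. The constant hidden in $O(\cdot)$ depends only on the problem constants. Problem. Minimize $$\sum_{t=0}^{T-1}\left((x_t-\bar x_t(\xi_t^* ))^\top Q_t(\xi_t^* )(x_t-\bar x_t(\xi_t^* ))+u_t^\top R_t(\xi_t^* )u_t\right)+F_T(x_T;\xi_T^* )$$ over states $x_{0:T}$ in $\mathbb{R}^n$ and actions $u_{0:T-1}$ in $\mathbb{R}^m$ subject to $x_{t+1}=A_t(\xi_t^* )x_t+B_t(\xi_t^* )u_t+w_t(\xi_t^* )$ for $0\le t<T$ and $x_0=x(0)$, where $F_T(x;\xi_T)=(x-\bar x_T(\xi_T))^\top P_T(\xi_T)(x-\bar x_T(\xi_T))$. The true parameters $\xi_t^*\in\Xi_t$ are unknown to the controller; each $\Xi_t$ has diameter at most $1$. $\mathrm{OPT}$ is the optimal trajectory (full knowledge of $\xi^*_{0:T}$), with states $x_t^*$; $\mathrm{cost}(\cdot)$ is the total cost of a controller's trajectory under the true parameters. Standing assumptions: $\|x_t^*\|\le D_{x^*}$ for all $t$; the true dynamics are $L_g$-Lipschitz in $u_t$. Assumptions, for all $t$ and all $\xi_t\in\Xi_t$: (1) $\mu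 I\preceq Q_t(\xi_t)\preceq\ell I$, $\mu I\preceq R_t(\xi_t)\preceq\ell I$, $\mu I\preceq P_T(\xi_T)\preceq\ell I$ with $\mu>0$. (2) There is a universal $\sigma>0$ such that $\sigma_{\min}(N_t^{T-1}(\xi_{t:T-1}))\ge\sigma$ for all $t<T$ and $\sigma_{\min}(\hat N_t^{t+k-1}(\xi_{t:t+k-1}))\ge\sigma$ for all $t<T-k$, for all parameter values $\xi_\tau\in\Xi_\tau$ (true or predicted), where $$N_{t_1}^{t_2}(\xi_{t_1:t_2})=\begin{bmatrix}I&&&&\\-A_{t_1}(\xi_{t_1})&-B_{t_1}(\xi_{t_1})&I&&\\&&\ddots&&\\&&-A_{t_2}(\xi_{t_2})&-B_{t_2}(\xi_{t_2})&I\end{bmatrix},$$ the matrix of the linear map $(x_{t_1},u_{t_1},x_{t_1+1},\dots,u_{t_2},x_{t_2+1})\mapsto(x_{t_1},\,x_{t+1}-A_tx_t-B_tu_t\ (t_1\le t\le t_2))$, and $\hat N_{t_1}^{t_2}$ is obtained from $N_{t_1}^{t_2}$ by deleting its last block column (the one for $x_{t_2+1}$). Here $\sigma_{\min}$ is the smallest of the singular values counted by the number of rows, so positivity means full row rank. (3) $\|w_t(\xi_t)\|\le D_w$, $\|\bar x_t(\xi_t)\|\le D_{\bar x}$, $\|A_t(\xi_t)\|\le a$, $\|B_t(\xi_t)\|\le b$; and $A_t,B_t,Q_t,R_t,P_T,\bar x_t,w_t$ are Lipschitz in $\xi_t\in\Xi_t$ with uniform constants $L_A,L_B,L_Q,L_R,L_P,L_{\bar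 x},L_w$ respectively. Predictions. With prediction horizon $k$ ($1\le k\le T$), at time $t$ the controller receives $\xi_{\tau\mid t}\in\Xi_\tau$ for $t\le\tau\le\min\{t+k,T\}$. $\rho_{t,\tau}=\|\xi_{t+\tau\mid t}-\xi^*_{t+\tau}\|$ (and $0$ if $t+\tau>T$), $P(\tau)=\sum_{t=0}^{T-\tau}\rho_{t,\tau}^2$. FTOCP. $\psi_{t_1}^{t_2}(z,\xi_{t_1:t_2-1},\zeta_{t_2};F)$ denotes an optimal solution of: minimize $\sum_{t=t_1}^{t_2-1}\big((y_t-\bar x_t(\xi_t))^\top Q_t(\xi_t)(y_t-\bar x_t(\xi_t))+v_t^\top R_t(\xi_t)v_t\big)+F(y_{t_2};\zeta_{t_2})$ subject to $y_{t+1}=A_t(\xi_t)y_t+B_t(\xi_t)v_t+w_t(\xi_t)$ for $t_1\le t<t_2$, $y_{t_1}=z$; the terminal parameter is also written $\xi_{t_2}$; subscripts $y_t,v_t$ select entries. $\mathbb{I}(y;\zeta)=0$ if $y=\zeta$ and $+\infty$ otherwise. $\mathrm{MPC}_k$: at time $t$, with $t'=\min\{t+k,T\}$, apply $u_t=\psi_t^{t'}(x_t,\xi_{t:t'\mid t};F_{t'})_{v_t}$, with $F_{t'}$ the specified terminal cost if $t'<T$ and $F_T$ the true terminal cost family if $t'=T$. Perturbation constants: let $R=D_{x^*}+D_{\bar x}$. $H_2,\lambda_2$ are such that, with $q_1(t)=H_2\lambda_2^{2t}$, $q_2(t)=q_3(t)=H_2\lambda_2^t$ and $\delta_t=\|\xi_t-\xi_t'\|$: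 (a) $\|\psi_{t_1}^{t_2}(z,\xi_{t_1:t_2};F)_{v_{t_1}}-\psi_{t_1}^{t_2}(z,\xi'_{t_1:t_2};F)_{v_{t_1}}\|\le\big(\sum_{t=t_1}^{t_2}q_1(t-t_1)\delta_t\big)\|z\|+\sum_{t=t_1}^{t_2}q_2(t-t_1)\delta_t$ for $z\in\mathcal{B}(x_{t_1}^*,R)$, $\xi_t\in\Xi_t$, $\xi'_t=\xi^*_t$, both for $t_2=t_1+k$, $t_1<T-k$, $F=\mathbb{I}$ (with terminal parameters $\xi_{t_2},\xi_{t_2}'\in\mathcal{B}(x_{t_2}^*,R)\subseteq\mathbb{R}^n$) and for $t_2=T$, $t_1\ge T-k$, $F=F_T$; (b) $\|\psi_{t_1}^T(z,\xi^*_{t_1:T};F_T)_{y_t/v_t}-\psi_{t_1}^T(z',\xi^*_{t_1:T};F_T)_{y_t/v_t}\|\le q_3(t-t_1)\|z-z'\|$ for all $t_1<T$, $t\in[t_1,T]$ and $z,z'\in\mathcal{B}(x_{t_1}^*,R)$ (for both $y_t$ and, when $t<T$, $v_t$ entries). *)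

(* Defs.v *)
From HB Require Import structures.
From mathcomp Require Import all_boot all_order all_algebra.
From mathcomp Require Import all_classical all_reals.

Set Implicit Arguments.
Unset Strict Implicit.
Unset Printing Implicit Defensive.

Import Order.TTheory GRing.Theory Num.Theory.

Local Open Scope classical_set_scope.
Local Open Scope ring_scope.

Section LinearAlgebra.
Context {R : realType}.

(* The norm that MathComp-Analysis puts on matrices is the sup norm of the
   entries, hence the separate definitions of the Euclidean and spectral norms. *)
Definition norm2 {n : nat} (v : 'cV[R]_n) : R :=
  Num.sqrt (\sum_(i < n) v i 0 ^+ 2).

Definition opnorm {n m : nat} (A : 'M[R]_(n, m)) : R :=
  sup [set norm2 (A *m v) | v in [set v : 'cV[R]_m | norm2 v <= 1]].

Definition cball {n : nat} (c : 'cV[R]_n) (r : R) : set 'cV[R]_n :=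
  [set v | norm2 (v - c) <= r].

Definition quad {n : nat} (Q : 'M[R]_n) (v : 'cV[R]_n) : R :=
  (v^T *m Q *m v) 0 0.

Definition psd {n : nat} (A : 'M[R]_n) : Prop :=
  A^T = A /\ forall v : 'cV[R]_n, 0 <= quad A v.

Definition loewner_le {n : nat} (A B : 'M[R]_n) : Prop := psd (B - A).

(* Using [M *m M^T] rather than [M^T *m M] counts the singular values by the
   number of rows: 0 occurs as soon as M fails to have full row rank. *)
Definition singular_values {r c : nat} (M : 'M[R]_(r, c)) : set R :=
  [set s | 0 <= s /\ eigenvalue (M *m M^T) (s ^+ 2)].

Definition sigma_min {r c : nat} (M : 'M[R]_(r, c)) : R :=
  inf (singular_values M).

Definition lipschitz_on {p : nat} {V : zmodType} (N : V -> R)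
    (X : set 'cV[R]_p) (L : R) (f : 'cV[R]_p -> V) : Prop :=
  forall xi xi', X xi -> X xi' -> N (f xi - f xi') <= L * norm2 (xi - xi').

Definition indicator_cost {n : nat} (zeta y : 'cV[R]_n) : \bar R :=
  if y == zeta then 0%E else +oo%E.

End LinearAlgebra.

Record problem_constants (R : realType) := ProblemConstants {
  c_mu : R; c_ell : R; c_sigma : R; c_a : R; c_b : R;
  c_Dw : R; c_Dxbar : R; c_Dxstar : R; c_Lg : R;
  c_LA : R; c_LB : R; c_LQ : R; c_LR : R; c_LP : R; c_Lxbar : R; c_Lw : R }.

(* The uncertainty parameter at time t lives in R^(p t). The fields are total in
   t, but only the values for t < T (t <= T for [unc] and [xbar]) are used. *)
Record ltv (R : realType) (n m : nat) (p : nat -> nat) (T : nat) := LTV {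
  unc : forall t, set 'cV[R]_(p t);
  dynA : forall t, 'cV[R]_(p t) -> 'M[R]_n;
  dynB : forall t, 'cV[R]_(p t) -> 'M[R]_(n, m);
  dynw : forall t, 'cV[R]_(p t) -> 'cV[R]_n;
  costQ : forall t, 'cV[R]_(p t) -> 'M[R]_n;
  costR : forall t, 'cV[R]_(p t) -> 'M[R]_m;
  xbar : forall t, 'cV[R]_(p t) -> 'cV[R]_n;
  costP : 'cV[R]_(p T) -> 'M[R]_n;
  init : 'cV[R]_n }.

Arguments unc {R n m p T} _ t.

Section Problem.
Context {R : realType} {n m : nat} {p : nat -> nat} {T : nat}.
Variable pb : ltv R n m p T.

Definition params := forall t, 'cV[R]_(p t).

Implicit Types (xi xis : params) (x y : nat -> 'cV[R]_n) (u v : nat -> 'cV[R]_m).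

Definition dyn t (xi : 'cV[R]_(p t)) (x : 'cV[R]_n) (u : 'cV[R]_m) : 'cV[R]_n :=
  dynA pb xi *m x + dynB pb xi *m u + dynw pb xi.

Definition stage_cost t (xi : 'cV[R]_(p t)) (x : 'cV[R]_n) (u : 'cV[R]_m) : R :=
  quad (costQ pb xi) (x - xbar pb xi) + quad (costR pb xi) u.

Definition terminal_cost (xi : 'cV[R]_(p T)) (x : 'cV[R]_n) : R :=
  quad (costP pb xi) (x - xbar pb xi).

Definition total_cost xis x u : R :=
  \sum_(0 <= t < T) stage_cost (xis t) (x t) (u t) + terminal_cost (xis T) (x T).

Definition ftocp_feasible (t1 t2 : nat) (z : 'cV[R]_n) xi y v : Prop :=
  y t1 = z /\
  forall t, (t1 <= t < t2)%N -> y t.+1 = dyn (xi t) (y t) (v t).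

(* F is the terminal cost with its parameter already plugged in. *)
Definition ftocp_cost (t1 t2 : nat) xi (F : 'cV[R]_n -> \bar R) y v : \bar R :=
  ((\sum_(t1 <= t < t2) stage_cost (xi t) (y t) (v t))%:E + F (y t2))%E.

(* (y, v) is an optimal solution psi_{t1}^{t2}(z, xi; F); finiteness of the cost
   rules out the case where no trajectory satisfies an indicator terminal cost. *)
Definition ftocp_opt (t1 t2 : nat) (z : 'cV[R]_n) xi (F : 'cV[R]_n -> \bar R)
    y v : Prop :=
  [/\ ftocp_feasible t1 t2 z xi y v,
      (ftocp_cost t1 t2 xi F y v < +oo)%E &
      forall y' v', ftocp_feasible t1 t2 z xi y' v' ->
        (ftocp_cost t1 t2 xi F y v <= ftocp_cost t1 t2 xi F y' v')%E].

Definition FT (xi : 'cV[R]_(p T)) (x : 'cV[R]_n) : \bar R :=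
  (terminal_cost xi x)%:E.

Definition is_OPT xis x u : Prop := ftocp_opt 0 T (init pb) xis (FT (xis T)) x u.

(* Below, L is the number of time steps t1, ..., t1 + L - 1, so that [Nhatmx t1 L]
   and [Nmx t1 L] are the matrices of index (t1, t2) with t2 = t1 + L - 1. Block
   row 0 is the initial condition and block row s.+1 the dynamics at time t1 + s;
   block column j gathers the variables (x_{t1+j}, u_{t1+j}). *)
Definition Nhatmx (t1 L : nat) xi
    : 'M[R]_(\sum_(i < L.+1) n, \sum_(j < L) (n + m)) :=
  \mxblock_(i < L.+1, j < L)
    (row_mx
      (if i == j :> nat then 1%:M
       else if i == j.+1 :> nat then - dynA pb (xi (t1 + j)%N) else 0)
      (if i == j.+1 :> nat then - dynB pb (xi (t1 + j)%N) else 0)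
     : 'M[R]_(n, n + m)).

Definition Nmx (t1 L : nat) xi
    : 'M[R]_(\sum_(i < L.+1) n, \sum_(j < L) (n + m) + n) :=
  row_mx (Nhatmx t1 L xi)
    (\mxcol_(i < L.+1) (if i == L :> nat then 1%:M else 0 : 'M[R]_n)).

Definition in_unc (t1 t2 : nat) xi : Prop :=
  forall t, (t1 <= t <= t2)%N -> unc pb t (xi t).

Variable c : problem_constants R.

Definition costs_well_conditioned : Prop :=
  (forall t (xi : 'cV[R]_(p t)), (t < T)%N -> unc pb t xi ->
     [/\ loewner_le (c_mu c)%:M (costQ pb xi),
         loewner_le (costQ pb xi) (c_ell c)%:M,
         loewner_le (c_mu c)%:M (costR pb xi) &
         loewner_le (costR pb xi) (c_ell c)%:M]) /\
  (forall xi : 'cV[R]_(p T), unc pb T xi ->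
     loewner_le (c_mu c)%:M (costP pb xi) /\
     loewner_le (costP pb xi) (c_ell c)%:M).

Definition uniformly_full_row_rank (k : nat) : Prop :=
  (forall t xi, (t < T)%N -> in_unc t T.-1 xi ->
     c_sigma c <= sigma_min (Nmx t (T - t) xi)) /\
  (forall t xi, (t < T - k)%N -> in_unc t (t + k).-1 xi ->
     c_sigma c <= sigma_min (Nhatmx t k xi)).

Definition uniformly_bounded : Prop :=
  (forall t (xi : 'cV[R]_(p t)), (t < T)%N -> unc pb t xi ->
     [/\ norm2 (dynw pb xi) <= c_Dw c, opnorm (dynA pb xi) <= c_a c &
         opnorm (dynB pb xi) <= c_b c]) /\
  (forall t (xi : 'cV[R]_(p t)), (t <= T)%N -> unc pb t xi ->
     norm2 (xbar pb xi) <= c_Dxbar c).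

Definition uniformly_lipschitz : Prop :=
  [/\ forall t, (t < T)%N ->
        [/\ lipschitz_on opnorm (unc pb t) (c_LA c) (fun xi : 'cV_(p t) => dynA pb xi),
            lipschitz_on opnorm (unc pb t) (c_LB c) (fun xi : 'cV_(p t) => dynB pb xi) &
            lipschitz_on norm2 (unc pb t) (c_Lw c) (fun xi : 'cV_(p t) => dynw pb xi)],
      forall t, (t < T)%N ->
        lipschitz_on opnorm (unc pb t) (c_LQ c) (fun xi : 'cV_(p t) => costQ pb xi) /\
        lipschitz_on opnorm (unc pb t) (c_LR c) (fun xi : 'cV_(p t) => costR pb xi),
      lipschitz_on opnorm (unc pb T) (c_LP c) (costP pb) &
      forall t, (t <= T)%N ->
        lipschitz_on norm2 (unc pb t) (c_Lxbar c) (fun xi : 'cV_(p t) => xbar pb xi)].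

Definition unc_diameter_le1 : Prop :=
  forall t (xi xi' : 'cV[R]_(p t)), (t <= T)%N -> unc pb t xi -> unc pb t xi' ->
    norm2 (xi - xi') <= 1.

Definition ltv_assumptions (k : nat) : Prop :=
  [/\ unc_diameter_le1, costs_well_conditioned, uniformly_full_row_rank k,
      uniformly_bounded & uniformly_lipschitz].

Definition dynamics_lipschitz_in_u xis : Prop :=
  forall t (x : 'cV[R]_n) (u u' : 'cV[R]_m), (t < T)%N ->
    norm2 (dyn (xis t) x u - dyn (xis t) x u') <= c_Lg c * norm2 (u - u').

Definition radius : R := c_Dxstar c + c_Dxbar c.

Definition pert_bound (H2 lambda2 : R) (t1 t2 : nat) (delta : nat -> R)
    (z : 'cV[R]_n) : R :=
  (\sum_(t1 <= t < t2.+1) H2 * lambda2 ^+ (2 * (t - t1))%N * delta t) * norm2 z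
  + \sum_(t1 <= t < t2.+1) H2 * lambda2 ^+ (t - t1)%N * delta t.

(* xs is the state sequence of the optimal trajectory. *)
Definition pert_indicator (H2 lambda2 : R) (k : nat) xis xs : Prop :=
  forall t1 z xi zeta zeta' y v y' v',
    (t1 < T - k)%N ->
    cball (xs t1) radius z ->
    in_unc t1 (t1 + k).-1 xi ->
    cball (xs (t1 + k)%N) radius zeta ->
    cball (xs (t1 + k)%N) radius zeta' ->
    ftocp_opt t1 (t1 + k) z xi (indicator_cost zeta) y v ->
    ftocp_opt t1 (t1 + k) z xis (indicator_cost zeta') y' v' ->
    norm2 (v t1 - v' t1) <=
      pert_bound H2 lambda2 t1 (t1 + k)
        (fun t => if t == (t1 + k)%N then norm2 (zeta - zeta')
                  else norm2 (xi t - xis t)) z.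

Definition pert_final (H2 lambda2 : R) (k : nat) xis xs : Prop :=
  forall t1 z xi y v y' v',
    (T - k <= t1 < T)%N ->
    cball (xs t1) radius z ->
    in_unc t1 T xi ->
    ftocp_opt t1 T z xi (FT (xi T)) y v ->
    ftocp_opt t1 T z xis (FT (xis T)) y' v' ->
    norm2 (v t1 - v' t1) <=
      pert_bound H2 lambda2 t1 T (fun t => norm2 (xi t - xis t)) z.

Definition pert_init (H2 lambda2 : R) xis xs : Prop :=
  forall t1 z z' y v y' v',
    (t1 < T)%N ->
    cball (xs t1) radius z ->
    cball (xs t1) radius z' ->
    ftocp_opt t1 T z xis (FT (xis T)) y v ->
    ftocp_opt t1 T z' xis (FT (xis T)) y' v' ->
    (forall t, (t1 <= t <= T)%N ->
       norm2 (y t - y' t) <= H2 * lambda2 ^+ (t - t1)%N * norm2 (z - z')) /\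
    (forall t, (t1 <= t < T)%N ->
       norm2 (v t - v' t) <= H2 * lambda2 ^+ (t - t1)%N * norm2 (z - z')).

Definition perturbation_constants (H2 lambda2 : R) (k : nat) xis xs : Prop :=
  [/\ pert_indicator H2 lambda2 k xis xs, pert_final H2 lambda2 k xis xs &
      pert_init H2 lambda2 xis xs].

(* [pred t tau] is the prediction xi_{tau | t} of the parameter of time tau
   received at time t. *)
Implicit Type pred : nat -> params.

Definition valid_predictions (k : nat) pred : Prop :=
  forall t, (t <= T)%N -> in_unc t (minn (t + k) T) (pred t).

Definition pred_err xis pred (t tau : nat) : R :=
  if (t + tau <= T)%N then norm2 (pred t (t + tau)%N - xis (t + tau)%N) else 0.

Definition pred_power xis pred (tau : nat) : R :=
  \sum_(0 <= t < (T - tau).+1) pred_err xis pred t tau ^+ 2.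

Definition mpc_terminal (k t : nat) xi : 'cV[R]_n -> \bar R :=
  if (t < T - k)%N then indicator_cost (xbar pb (xi (t + k)%N)) else FT (xi T).

Definition is_MPC (k : nat) xis pred x u : Prop :=
  x 0%N = init pb /\
  forall t, (t < T)%N ->
    (exists y v,
       ftocp_opt t (minn (t + k) T) (x t) (pred t)
         (mpc_terminal k t (pred t)) y v /\ u t = v t) /\
    x t.+1 = dyn (xis t) (x t) (u t).

End Problem.

Arguments pred_err {R p} T xis pred t tau.
Arguments pred_power {R p} T xis pred tau.

(* Main.v *)
Require Import Defs.
From mathcomp Require Import all_boot all_order all_algebra.
From mathcomp Require Import all_classical all_reals.
From mathcomp Require Import ring lra zify.

Set Implicit Arguments.
Unset Strict Implicit.
Unset Printing Implicit Defensive.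

Import Order.TTheory GRing.Theory Num.Theory.

Local Open Scope ring_scope.

(** The optimality conditions of every problem in sight, of any length, form the
    same KKT system: with a multiplier [eta t] for the state at time t,
      y (t+1) = A y t + B v t + w,
      Q (y t - xbar) + eta t = A^T eta (t+1),
      R v t = B^T eta (t+1),
    closed by [P (y T - xbar) + eta T = 0] for a terminal cost, or by a prescribed
    last state.

    Decay of sensitivities.  The system is a saddle point: strong convexity
    controls the primal variables and the lower bound on the singular values of N
    controls the multipliers, so the whole solution is bounded in l2 by the
    residuals, with a constant that knows neither the length nor the dimensions
    ([kkt_stable]).  Now multiply a solution by weights lam^|t - j|.  As the system
    couples neighbouring times only, this changes the residuals by terms
    proportional to 1/lam - 1, which are absorbed when lam is close enough to 1.
    So [kkt_stable] holds with weights, and reading it at time j says that a residual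
    at time t reaches time j damped by lam^|t - j| ([kkt_decay]).  Both kinds of
    perturbation bounds follow: [kkt_contraction] for two initial states, where the
    only residual sits at the initial time, and [kkt_perturbation] for two parameter
    sequences, where the residual at t is the parameter difference times the
    solution at t, itself of size lam^(t - t1) |z| + 1 by [kkt_bound].

    Regret.  From each state visited by MPC, consider the optimal continuation under
    the true parameters, and let e_t be the distance between the action of MPC and
    the first action of that continuation.  Passing from one continuation to the
    next moves the plan by at most a multiple of e_i at time i+1, and this is damped
    by lam^(t - i - 1) at time t; hence the distance to OPT is bounded by a
    geometric convolution of the e_i ([tail_drift]).  MPC and OPT obey the same true
    dynamics, so their difference is a feasible direction, along which the cost has
    zero derivative at OPT: the regret is exactly a quadratic form in the difference,
    hence at most a multiple of the sum of the e_t^2 ([regret_le_deviations]).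
    Finally, the piece on [t, t+k] of the true continuation solves the KKT system with
    its own last state prescribed, so e_t is a perturbation in the sense above: it is
    bounded by the discounted prediction errors plus lam^k for the wrong last state
    ([mpc_deviation]).  This bound grows with the norm of the current state; the
    smallness of the errors and of lam^k keeps the states of MPC bounded, by induction
    on time ([mpc_regret]). *)

(** * Euclidean norms and operator bounds *)

Section Euclid.
Context {R : realType}.

Definition dot {n : nat} (u v : 'cV[R]_n) : R := (u^T *m v) 0 0.

Definition nsq {n : nat} (v : 'cV[R]_n) : R := dot v v.

Definition bounded_mx (K : R) {n m : nat} (M : 'M[R]_(n, m)) : Prop :=
  forall v : 'cV[R]_m, nsq (M *m v) <= K ^+ 2 * nsq v.

Definition coercive (mu : R) {n : nat} (M : 'M[R]_n) : Prop :=
  forall v : 'cV[R]_n, mu * nsq v <= dot v (M *m v).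

Section Dot.
Context {n : nat}.
Implicit Types (u v w : 'cV[R]_n) (a : R).

Lemma dotE u v : dot u v = \sum_(i < n) u i 0 * v i 0.
Proof. by rewrite /dot mxE; apply: eq_bigr => i _; rewrite mxE. Qed.

Lemma dotC u v : dot u v = dot v u.
Proof. by rewrite !dotE; apply: eq_bigr => i _; rewrite mulrC. Qed.

Lemma dotDl u v w : dot (u + v) w = dot u w + dot v w.
Proof. by rewrite /dot linearD mulmxDl mxE. Qed.

Lemma dotDr u v w : dot u (v + w) = dot u v + dot u w.
Proof. by rewrite /dot mulmxDr mxE. Qed.

Lemma dotZl a u v : dot (a *: u) v = a * dot u v.
Proof. by rewrite /dot linearZ /= -scalemxAl mxE. Qed.

Lemma dotZr a u v : dot u (a *: v) = a * dot u v.
Proof. by rewrite dotC dotZl dotC. Qed.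

Lemma dotNl u v : dot (- u) v = - dot u v.
Proof. by rewrite -scaleN1r dotZl mulN1r. Qed.

Lemma dotNr u v : dot u (- v) = - dot u v.
Proof. by rewrite dotC dotNl dotC. Qed.

Lemma dotBl u v w : dot (u - v) w = dot u w - dot v w.
Proof. by rewrite dotDl dotNl. Qed.

Lemma dotBr u v w : dot u (v - w) = dot u v - dot u w.
Proof. by rewrite dotDr dotNr. Qed.

Lemma dot0l v : dot 0 v = 0.
Proof. by rewrite -(scale0r v) dotZl mul0r. Qed.

Lemma dot0r v : dot v 0 = 0.
Proof. by rewrite dotC dot0l. Qed.

Lemma quadE (Q : 'M[R]_n) v : quad Q v = dot v (Q *m v).
Proof. by rewrite /quad /dot mulmxA. Qed.

Lemma nsqE v : nsq v = \sum_(i < n) v i 0 ^+ 2.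
Proof. by rewrite /nsq dotE; apply: eq_bigr => i _; rewrite expr2. Qed.

Lemma nsq_ge0 v : 0 <= nsq v.
Proof. by rewrite nsqE; apply: sumr_ge0 => i _; rewrite sqr_ge0. Qed.

Lemma nsq0 : nsq (0 : 'cV[R]_n) = 0.
Proof. exact: dot0l. Qed.

Lemma nsq_eq0 v : nsq v = 0 -> v = 0.
Proof.
rewrite nsqE => /eqP; rewrite psumr_eq0 => [/allP v0|i _]; last exact: sqr_ge0.
apply/matrixP => i j; rewrite ord1 mxE; apply/eqP.
by have := v0 i (mem_index_enum i); rewrite sqrf_eq0.
Qed.

Lemma nsqZ a v : nsq (a *: v) = a ^+ 2 * nsq v.
Proof. by rewrite /nsq dotZl dotZr mulrA expr2. Qed.

Lemma nsqN v : nsq (- v) = nsq v.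
Proof. by rewrite /nsq dotNl dotNr opprK. Qed.

Lemma nsqD u v : nsq (u + v) = nsq u + 2 * dot u v + nsq v.
Proof. rewrite /nsq dotDl !dotDr (dotC v u); ring. Qed.

Lemma nsqB u v : nsq (u - v) = nsq u - 2 * dot u v + nsq v.
Proof. by rewrite nsqD nsqN dotNr mulrN. Qed.

Lemma nsqD_le u v : nsq (u + v) <= 2 * (nsq u + nsq v).
Proof. by have := nsq_ge0 (u - v); rewrite nsqB nsqD; lra. Qed.

Lemma nsqB_le u v : nsq (u - v) <= 2 * (nsq u + nsq v).
Proof. by rewrite -(nsqN v) nsqD_le. Qed.

Lemma young a u v : 0 < a -> 2 * dot u v <= a * nsq u + a^-1 * nsq v.
Proof.
move=> a0; have := nsq_ge0 (a *: u - v); rewrite nsqB nsqZ dotZl => h.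
rewrite -(ler_pM2l a0) mulrDr [a * (a^-1 * _)]mulrA divff ?gt_eqF //; lra.
Qed.

Lemma cauchy_schwarz u v : dot u v ^+ 2 <= nsq u * nsq v.
Proof.
have [u0|u0] := eqVneq (nsq u) 0.
  by rewrite (nsq_eq0 u0) dot0l nsq0 mul0r expr0n.
have up : 0 < nsq u by rewrite lt_def u0 nsq_ge0.
have := nsq_ge0 (dot u v *: u - nsq u *: v).
rewrite nsqB !nsqZ dotZl dotZr => h.
have : 0 <= nsq u * (nsq u * nsq v - dot u v ^+ 2) by lra.
by rewrite pmulr_rge0 // subr_ge0.
Qed.

Lemma norm2E v : norm2 v = Num.sqrt (nsq v).
Proof. by rewrite /norm2 nsqE. Qed.

Lemma norm2_ge0 v : 0 <= norm2 v.
Proof. exact: sqrtr_ge0. Qed.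

Lemma sqr_norm2 v : norm2 v ^+ 2 = nsq v.
Proof. by rewrite norm2E sqr_sqrtr ?nsq_ge0. Qed.

Lemma norm2_le v a : 0 <= a -> (norm2 v <= a) = (nsq v <= a ^+ 2).
Proof. by move=> a0; rewrite -sqr_norm2 ler_pXn2r ?nnegrE ?norm2_ge0. Qed.

Lemma norm2N v : norm2 (- v) = norm2 v.
Proof. by rewrite !norm2E nsqN. Qed.

Lemma norm2_sub u v : norm2 (u - v) = norm2 (v - u).
Proof. by rewrite -norm2N opprB. Qed.

Lemma norm2Z a v : norm2 (a *: v) = `|a| * norm2 v.
Proof. by rewrite !norm2E nsqZ sqrtrM ?sqr_ge0// sqrtr_sqr. Qed.

Lemma norm2_0 : norm2 (0 : 'cV[R]_n) = 0.
Proof. by rewrite norm2E nsq0 sqrtr0. Qed.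

Lemma norm2_eq0 v : norm2 v <= 0 -> v = 0.
Proof.
move=> v0; apply: nsq_eq0; rewrite -sqr_norm2.
by have -> : norm2 v = 0; rewrite ?expr0n //; apply/eqP; rewrite eq_le v0 norm2_ge0.
Qed.

Lemma norm2D u v : norm2 (u + v) <= norm2 u + norm2 v.
Proof.
have h : dot u v <= norm2 u * norm2 v.
  apply: le_trans (ler_norm _) _.
  rewrite -[leLHS]sqrtr_sqr !norm2E -sqrtrM ?nsq_ge0 //.
  by rewrite ler_wsqrtr// cauchy_schwarz.
rewrite norm2_le ?addr_ge0 ?norm2_ge0 // nsqD sqrrD !sqr_norm2; lra.
Qed.

Lemma norm2B u v : norm2 (u - v) <= norm2 u + norm2 v.
Proof. by rewrite -(norm2N v) norm2D. Qed.

Lemma norm2_le_dist u v : norm2 u <= norm2 (u - v) + norm2 v.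
Proof. by rewrite -{1}(subrK v u) norm2D. Qed.

End Dot.

Lemma dot_mulmx {n m} (M : 'M[R]_(n, m)) (u : 'cV[R]_m) (v : 'cV[R]_n) :
  dot (M *m u) v = dot u (M^T *m v).
Proof. by rewrite /dot trmx_mul mulmxA. Qed.

Lemma dot_col_mx {n m} (u u' : 'cV[R]_n) (v v' : 'cV[R]_m) :
  dot (col_mx u v) (col_mx u' v') = dot u u' + dot v v'.
Proof. by rewrite /dot tr_col_mx mul_row_col mxE. Qed.

(** Cauchy-Schwarz for [M (M^T v)] and [v], whose inner product is [nsq (M^T v)]. *)
Lemma bounded_mx_tr {n m} K (M : 'M[R]_(n, m)) :
  bounded_mx K M -> bounded_mx K M^T.
Proof.
move=> bM v; set w := M^T *m v.
have [->|w0] := eqVneq (nsq w) 0; first by rewrite mulr_ge0 ?sqr_ge0 ?nsq_ge0.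
have wp : 0 < nsq w by rewrite lt_def w0 nsq_ge0.
have e : dot (M *m w) v = nsq w by rewrite dot_mulmx.
have cs := cauchy_schwarz (M *m w) v; rewrite e in cs.
have h := le_trans cs (ler_wpM2r (nsq_ge0 v) (bM w)).
by rewrite -(ler_pM2l wp); lra.
Qed.

(** The Frobenius norm is such a bound, by Cauchy-Schwarz on each row. *)
Lemma bounded_mx_exists {n m} (M : 'M[R]_(n, m)) :
  exists2 K : R, 0 <= K & bounded_mx K M.
Proof.
pose r i : 'cV[R]_m := (row i M)^T.
have s0 : 0 <= \sum_i nsq (r i) by apply: sumr_ge0 => i _; exact: nsq_ge0.
exists (Num.sqrt (\sum_i nsq (r i))); first exact: sqrtr_ge0.
move=> v; rewrite sqr_sqrtr// nsqE mulr_suml; apply: ler_sum => i _.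
have -> : (M *m v) i 0 = dot (r i) v.
  by rewrite dotE mxE; apply: eq_bigr => j _; rewrite !mxE.
exact: cauchy_schwarz.
Qed.

Lemma norm2_mulmx_le {n m} (M : 'M[R]_(n, m)) (v : 'cV[R]_m) :
  norm2 (M *m v) <= opnorm M * norm2 v.
Proof.
have [v0|v0] := eqVneq (norm2 v) 0.
  have -> : v = 0 by apply: norm2_eq0; rewrite v0.
  by rewrite mulmx0 !norm2_0 mulr0.
have vp : 0 < norm2 v by rewrite lt_def v0 norm2_ge0.
rewrite -ler_pdivrMr //.
have -> : norm2 (M *m v) / norm2 v = norm2 (M *m ((norm2 v)^-1 *: v)).
  by rewrite -scalemxAr norm2Z ger0_norm ?invr_ge0 ?norm2_ge0// mulrC.
have [K K0 bK] := bounded_mx_exists M.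
apply: ub_le_sup; last first.
  exists ((norm2 v)^-1 *: v) => //=.
  by rewrite norm2Z ger0_norm ?invr_ge0 ?norm2_ge0// mulVf.
exists K => _ [w /= w1 <-]; rewrite norm2_le//.
apply: le_trans (bK w) _; rewrite -[leRHS]mulr1 ler_wpM2l ?sqr_ge0//.
by move: w1; rewrite norm2_le// expr1n.
Qed.

Lemma bounded_mx_opnorm {n m} K (M : 'M[R]_(n, m)) :
  opnorm M <= K -> bounded_mx K M.
Proof.
move=> MK v; have h := norm2_mulmx_le M v.
have h' : norm2 (M *m v) <= K * norm2 v.
  by apply: le_trans h _; rewrite ler_wpM2r ?norm2_ge0.
by rewrite -!sqr_norm2 -exprMn ler_pXn2r ?nnegrE ?norm2_ge0// (le_trans _ h')// norm2_ge0.
Qed.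

(** Evaluate the nonnegative form of [M] at [K v - M v]. *)
Lemma psd_bounded {n} (K : R) (M : 'M[R]_n) : 0 < K -> M^T = M ->
  (forall v, 0 <= dot v (M *m v)) -> (forall v, dot v (M *m v) <= K * nsq v) ->
  forall v, nsq (M *m v) <= K * dot v (M *m v).
Proof.
move=> K0 sM M0 MK v; set w := M *m v.
have := M0 (K *: v - w); rewrite mulmxBr -scalemxAr -/w.
rewrite dotBl !dotBr !dotZl !dotZr.
have -> : dot v (M *m w) = nsq w by rewrite -[in M *m w]sM -dot_mulmx.
have wK := MK w.
have -> : dot w w = nsq w by [].
move=> h; rewrite -(ler_pM2l K0); lra.
Qed.

Lemma loewner_coercive {n} mu (Q : 'M[R]_n) : loewner_le mu%:M Q ->
  Q^T = Q /\ coercive mu Q.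
Proof.
move=> [sQ pQ]; split.
  by move: sQ; rewrite linearB/= tr_scalar_mx => /addIr.
move=> v; have := pQ v; rewrite quadE mulmxBl mul_scalar_mx dotBr dotZr subr_ge0.
by rewrite dotC.
Qed.

Lemma loewner_upper {n} ell (Q : 'M[R]_n) (v : 'cV[R]_n) : loewner_le Q ell%:M ->
  dot v (Q *m v) <= ell * nsq v.
Proof.
by move=> [_ /(_ v)]; rewrite quadE mulmxBl mul_scalar_mx dotBr dotZr subr_ge0.
Qed.

Lemma loewner_bounded {n} (mu ell K : R) (Q : 'M[R]_n) : 0 < mu -> 0 < K -> ell <= K ->
  loewner_le mu%:M Q -> loewner_le Q ell%:M -> bounded_mx K Q.
Proof.
move=> mu0 K0 eK /loewner_coercive[sQ cQ] Qe v.
have Qu w : dot w (Q *m w) <= K * nsq w.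
  by apply: le_trans (loewner_upper w Qe) _; rewrite ler_wpM2r ?nsq_ge0.
have Q0 w : 0 <= dot w (Q *m w).
  by apply: le_trans (cQ w); rewrite mulr_ge0 ?nsq_ge0// ltW.
apply: le_trans (psd_bounded K0 sQ Q0 Qu v) _.
by rewrite expr2 -mulrA ler_pM2l.
Qed.

Lemma coercive_unitmx {n} mu (M : 'M[R]_n) : 0 < mu -> coercive mu M ->
  M \in unitmx.
Proof.
move=> mu0 cM; rewrite -unitmx_tr -row_free_unit -kermx_eq0; apply/eqP.
apply/row_matrixP => i; rewrite row0; set r := row i _.
have rM : r *m M^T = 0 by apply/sub_kermxP; exact: row_sub.
have Mr : M *m r^T = 0 by rewrite -[M *m _]trmxK trmx_mul trmxK rM trmx0.
apply: trmx_inj; rewrite trmx0; apply: nsq_eq0.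
have := cM r^T; rewrite Mr dot0r pmulr_rle0// => h.
by apply/eqP; rewrite eq_le h nsq_ge0.
Qed.

End Euclid.

(** * Smallest singular value and orthogonality to a kernel *)

Section SigmaMin.
Context {R : realType}.

(** The infimum [lam] of the Rayleigh quotient of [M M^T] is an eigenvalue, and
    no compactness is needed to see it: [M M^T - lam I] is positive semidefinite,
    so if it were invertible it would be coercive, and [lam] could be raised. *)
Lemma sigma_min_coercive {r c} (M : 'M[R]_(r, c)) (sigma : R) :
  0 < sigma -> sigma <= sigma_min M ->
  forall eta : 'cV[R]_r, sigma ^+ 2 * nsq eta <= nsq (M^T *m eta).
Proof.
move=> sigma0 sM eta.
have [e0|e0] := eqVneq (nsq eta) 0; first by rewrite e0 mulr0 nsq_ge0.
have ep : 0 < nsq eta by rewrite lt_def e0 nsq_ge0.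
pose E := [set nsq (M^T *m v) | v in [set v : 'cV[R]_r | nsq v = 1]]%classic.
have unitE (v : 'cV[R]_r) : 0 < nsq v -> E (nsq (M^T *m v) / nsq v).
  move=> vp; exists ((norm2 v)^-1 *: v) => /=.
    by rewrite nsqZ exprVn sqr_norm2 mulVf ?gt_eqF.
  by rewrite -scalemxAr nsqZ exprVn sqr_norm2 mulrC.
have lbE : has_lbound E by exists 0 => _ [v _ <-]; exact: nsq_ge0.
pose lam := inf E.
have lamE (v : 'cV[R]_r) : lam * nsq v <= nsq (M^T *m v).
  have [v0|v0] := eqVneq (nsq v) 0; first by rewrite v0 mulr0 nsq_ge0.
  have vp : 0 < nsq v by rewrite lt_def v0 nsq_ge0.
  by rewrite -ler_pdivlMr//; apply: ge_inf lbE _ (unitE _ vp).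
have neE : (E !=set0)%classic by exists (nsq (M^T *m eta) / nsq eta); exact: unitE.
have lam0 : 0 <= lam by apply: lb_le_inf neE _ => _ [v _ <-]; exact: nsq_ge0.
pose T := M *m M^T - lam%:M.
have sT : T^T = T by rewrite /T linearB/= trmx_mul trmxK tr_scalar_mx.
have dT (v : 'cV[R]_r) : dot v (T *m v) = nsq (M^T *m v) - lam * nsq v.
  rewrite /T mulmxBl mul_scalar_mx dotBr dotZr /nsq; congr (_ - _).
  by rewrite -mulmxA [RHS]dot_mulmx trmxK.
have T0 (v : 'cV[R]_r) : 0 <= dot v (T *m v) by rewrite dT subr_ge0.
have [K K0 bK] := bounded_mx_exists M^T.
have K1 : 0 < K ^+ 2 + 1 by rewrite ltr_pwDr// sqr_ge0.
have TK (v : 'cV[R]_r) : dot v (T *m v) <= (K ^+ 2 + 1) * nsq v.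
  rewrite dT; have h := bK v; have h' := mulr_ge0 lam0 (nsq_ge0 v).
  have h'' := nsq_ge0 v; lra.
have TN : T \notin unitmx.
  apply/negP => uT.
  have [K' K'0 bK'] := bounded_mx_exists (invmx T).
  pose D := (K' ^+ 2 + 1) * (K ^+ 2 + 1).
  have D0 : 0 < D by rewrite mulr_gt0// ltr_pwDr// sqr_ge0.
  have coT (v : 'cV[R]_r) : nsq v <= D * dot v (T *m v).
    have h1 := bK' (T *m v); rewrite mulKmx// in h1.
    have h2 := psd_bounded K1 sT T0 TK v.
    have h3 := ler_wpM2l (sqr_ge0 K') h2.
    have h4 : 0 <= (K ^+ 2 + 1) * dot v (T *m v) by rewrite mulr_ge0// ltW.
    rewrite /D; lra.
  have : lam + D^-1 <= inf E.
    apply: lb_le_inf neE _ => _ [v /= v1 <-].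
    have := coT v; rewrite dT v1 mulr1 -ler_pdivrMl// mulr1; lra.
  by rewrite -/lam gerDl leNgt invr_gt0 D0.
have eig : eigenvalue (M *m M^T) (Num.sqrt lam ^+ 2).
  rewrite sqr_sqrtr// /eigenvalue /eigenspace -/T kermx_eq0.
  by rewrite row_free_unit.
have : sigma <= Num.sqrt lam.
  apply: le_trans sM _; apply: ge_inf; last by split=> //; exact: sqrtr_ge0.
  by exists 0 => s [].
move=> h; apply: le_trans (lamE eta); rewrite ler_wpM2r ?nsq_ge0//.
rewrite -(sqr_sqrtr lam0) ler_pXn2r ?nnegrE ?sqrtr_ge0//; exact: ltW.
Qed.

(** The source of Lagrange multipliers: a cost gradient that annihilates all
    feasible directions of the constraints [N d = h] is a combination of the rows of
    [N]. *)
Lemma orth_kernel_range {r c} (N : 'M[R]_(r, c)) (g : 'cV[R]_c) :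
  (forall d, N *m d = 0 -> dot g d = 0) -> exists eta, g = N^T *m eta.
Proof.
move=> gN; have : (g^T <= N)%MS.
  rewrite submxE; apply/eqP/matrixP => i j; rewrite ord1.
  have : N *m col j (cokermx N) = 0 by rewrite colE mulmxA mulmx_coker mul0mx.
  move=> /gN h; rewrite [RHS]mxE -[RHS]h dotE mxE.
  by apply: eq_bigr => l _; rewrite !mxE.
by move=> /submxP[D gD]; exists D^T; rewrite -trmx_mul -gD trmxK.
Qed.

End SigmaMin.

(** * Stability of the KKT system *)

(** Plain matrices in place of functions of an uncertain parameter. *)
Record lq_stage (R : realType) (n m : nat) := LQStage {
  stA : 'M[R]_n; stB : 'M[R]_(n, m); stw : 'cV[R]_n;
  stQ : 'M[R]_n; stR : 'M[R]_m; stx : 'cV[R]_n }.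

Section KKT.
Context {R : realType}.

Section Residuals.
Context {n m : nat}.
Variable st : nat -> lq_stage R n m.

Record regular_stage (mu K : R) (s : lq_stage R n m) : Prop := RegularStage {
  reg_A : bounded_mx K (stA s);
  reg_B : bounded_mx K (stB s);
  reg_Q : bounded_mx K (stQ s);
  reg_R : bounded_mx K (stR s);
  reg_Qmu : coercive mu (stQ s);
  reg_Rmu : coercive mu (stR s);
  reg_w : nsq (stw s) <= K ^+ 2;
  reg_x : nsq (stx s) <= K ^+ 2 }.

Variables (y : nat -> 'cV[R]_n) (v : nat -> 'cV[R]_m) (eta : nat -> 'cV[R]_n).

(** Residuals of the homogeneous KKT system; the affine data [stw] and [stx] count as
    residuals of their solutions. *)
Definition dyn_res t := y t.+1 - (stA (st t) *m y t + stB (st t) *m v t).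
Definition x_res t := stQ (st t) *m y t + eta t - (stA (st t))^T *m eta t.+1.
Definition u_res t := stR (st t) *m v t - (stB (st t))^T *m eta t.+1.
Definition stage_res t := nsq (dyn_res t) + nsq (x_res t) + nsq (u_res t).

End Residuals.

(** The inequality |N^T eta| >= sigma |eta|, written block by block. [terminal] tells a
    problem with a terminal cost from one whose last state is prescribed; in the second
    case [y t2] is not a variable and N has no column for it. *)
Definition dual_coercive {n m} (sigma : R) (st : nat -> lq_stage R n m)
    (t1 t2 : nat) (terminal : bool) : Prop :=
  forall eta : nat -> 'cV[R]_n,
    sigma ^+ 2 * \sum_(t1 <= t < t2.+1) nsq (eta t) <=
    \sum_(t1 <= t < t2) (nsq (eta t - (stA (st t))^T *m eta t.+1)
                         + nsq ((stB (st t))^T *m eta t.+1))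
    + (if terminal then nsq (eta t2) else 0).

(** A prescribed last state is a known vector that moves to the right-hand side of the
    system, so it is itself the residual at the end. *)
Definition end_res {n} (terminal : bool) (P : 'M[R]_n) (y eta : 'cV[R]_n) :=
  if terminal then P *m y + eta else y.

Definition regular_end {n} (mu K : R) (terminal : bool) (P : 'M[R]_n) : Prop :=
  terminal -> bounded_mx K P /\ coercive mu P.

(** The coupling terms of the KKT system are skew, so pairing it with its own solution
    leaves the convex part and a telescoping sum. *)
Lemma kkt_energy {n m} (st : nat -> lq_stage R n m) (t1 t2 : nat) y v eta :
  (t1 <= t2)%N ->
  \sum_(t1 <= t < t2) (dot (y t) (stQ (st t) *m y t) + dot (v t) (stR (st t) *m v t))
  + dot (y t1) (eta t1) =
  \sum_(t1 <= t < t2) (dot (y t) (x_res st y eta t) + dot (v t) (u_res st v eta t)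
                       - dot (dyn_res st y v t) (eta t.+1))
  + dot (y t2) (eta t2).
Proof.
move=> t12; apply/eqP; rewrite -subr_eq0 opprD addrACA -sumrB.
rewrite (eq_bigr (fun t => dot (y t.+1) (eta t.+1) - dot (y t) (eta t))); last first.
  move=> t _; rewrite /x_res /u_res /dyn_res !(dotBr, dotDr, dotBl, dotDl, dotNl).
  rewrite !dot_mulmx; ring.
by rewrite (telescope_sumr (fun t => dot (y t) (eta t)) t12) subrKA subrr.
Qed.

Lemma sum_nat_recl (f : nat -> R) (t1 t2 : nat) : (t1 <= t2)%N ->
  \sum_(t1 <= t < t2.+1) f t = f t1 + \sum_(t1 <= t < t2) f t.+1.
Proof. by move=> h; rewrite big_nat_recl. Qed.

Lemma sum_nat_recr (f : nat -> R) (t1 t2 : nat) : (t1 <= t2)%N ->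
  \sum_(t1 <= t < t2.+1) f t = \sum_(t1 <= t < t2) f t + f t2.
Proof. by move=> h; rewrite big_nat_recr. Qed.

(** Saddle-point estimate. By [kkt_energy] the primal part is bounded by the residuals and
    by residual times multiplier; the multipliers are bounded through [dual_coercive],
    because [N^T eta] is the x- and u-residual minus the convex part applied to the
    primal variables. Young's inequality closes the loop. *)
Lemma kkt_stable (mu sigma K : R) : 0 < mu -> 0 < sigma -> 0 < K ->
  exists2 C : R, 0 < C &
  forall n m (st : nat -> lq_stage R n m) (t1 t2 : nat) terminal (P : 'M[R]_n) y v eta,
    (t1 <= t2)%N ->
    (forall t, (t1 <= t < t2)%N -> regular_stage mu K (st t)) ->
    regular_end mu K terminal P ->
    dual_coercive sigma st t1 t2 terminal ->
    (~~ terminal -> y t2 = 0) ->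
    \sum_(t1 <= t < t2.+1) (nsq (y t) + nsq (eta t)) + \sum_(t1 <= t < t2) nsq (v t)
    <= C * (nsq (y t1) + \sum_(t1 <= t < t2) stage_res st y v eta t
            + nsq (end_res terminal P (y t2) (eta t2))).
Proof.
move=> mu0 sigma0 K0.
have K20 : 0 < K ^+ 2 by rewrite exprn_gt0.
have s20 : 0 < sigma ^+ 2 by rewrite exprn_gt0.
(* the part theta / 2 |eta|^2 of Young's inequality then costs mu / 4 of the primal part *)
pose theta := mu * sigma ^+ 2 / (4 * K ^+ 2).
have th0 : 0 < theta by rewrite !mulr_gt0// invr_gt0 mulr_gt0.
pose C1 := 2 / mu * (1 / mu + mu / (4 * K ^+ 2) + theta^-1).
have p1 : 0 < mu^-1 by rewrite invr_gt0.
have p2 : 0 < mu / (4 * K ^+ 2) by rewrite divr_gt0// mulr_gt0.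
have p3 : 0 < theta^-1 by rewrite invr_gt0.
have C10 : 0 < C1 by rewrite mulr_gt0 ?divr_gt0// div1r; lra.
pose C := C1 + (2 + 2 * K ^+ 2 * C1) / sigma ^+ 2.
have C0 : 0 < C.
  by rewrite addr_gt0// divr_gt0// addr_gt0// mulr_gt0// mulr_gt0.
exists C => // n m st t1 t2 terminal P y v eta t12 reg regP dual yend.
set G := \sum_(t1 <= t < t2) (nsq (x_res st y eta t) + nsq (u_res st v eta t)).
set E := \sum_(t1 <= t < t2) nsq (dyn_res st y v t).
set X := \sum_(t1 <= t < t2) (nsq (y t) + nsq (v t)).
set Y := \sum_(t1 <= t < t2.+1) nsq (eta t).
set Y' := \sum_(t1 <= t < t2) nsq (eta t.+1).
have Y'E : Y = nsq (eta t1) + Y' by rewrite /Y sum_nat_recl.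
set ye := nsq (y t2); set r0 := nsq (y t1).
set ge := nsq (end_res terminal P (y t2) (eta t2)).
have ge0 : 0 <= ge by exact: nsq_ge0.
have ye0 : 0 <= ye by exact: nsq_ge0.
have r00 : 0 <= r0 by exact: nsq_ge0.
have X0 : 0 <= X by apply: sumr_ge0 => t _; rewrite addr_ge0 ?nsq_ge0.
have G0 : 0 <= G by apply: sumr_ge0 => t _; rewrite addr_ge0 ?nsq_ge0.
have E0 : 0 <= E by apply: sumr_ge0 => t _; rewrite ?nsq_ge0.
have -> : \sum_(t1 <= t < t2.+1) (nsq (y t) + nsq (eta t)) + \sum_(t1 <= t < t2) nsq (v t)
   = X + ye + Y.
  by rewrite big_split /= sum_nat_recr// /X big_split /= -/Y -/ye; ring.
have -> : \sum_(t1 <= t < t2) stage_res st y v eta t = G + E.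
  by rewrite /G /E -big_split; apply: eq_bigr => t _ /=; rewrite /stage_res; ring.
(* strong convexity, and Young's inequality on every product with a residual *)
have primal : mu * (X + ye) <= mu / 4 * (X + ye) + mu^-1 * (G + ge)
     + theta / 2 * Y + theta^-1 / 2 * (E + r0).
  have yg n' (a b : 'cV[R]_n') : dot a b <= mu / 4 * nsq a + mu^-1 * nsq b.
    have := @young _ _ (mu / 2) a b; rewrite divr_gt0// => /(_ isT).
    by rewrite invf_div; lra.
  have en (a b : 'cV[R]_n) : - dot a b <= theta / 2 * nsq b + theta^-1 / 2 * nsq a.
    by have := young (- b) a th0; rewrite dotNl nsqN dotC; lra.
  have sums : mu * X - mu / 4 * X - mu^-1 * G - theta / 2 * Y' - theta^-1 / 2 * E
     <= \sum_(t1 <= t < t2) (dot (y t) (stQ (st t) *m y t) + dot (v t) (stR (st t) *m v t))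
      - \sum_(t1 <= t < t2) (dot (y t) (x_res st y eta t) + dot (v t) (u_res st v eta t)
                       - dot (dyn_res st y v t) (eta t.+1)).
    rewrite /X /G /Y' /E !mulr_sumr -!sumrB; apply: ler_sum_nat => t /reg rt.
    have := reg_Qmu rt (y t); have := reg_Rmu rt (v t).
    have := yg _ (y t) (x_res st y eta t); have := yg _ (v t) (u_res st v eta t).
    have := en (dyn_res st y v t) (eta t.+1); lra.
  have := kkt_energy st y v eta t12.
  have := en (y t1) (eta t1); rewrite -/r0.
  have : mu * ye - mu / 4 * ye - mu^-1 * ge <= - dot (y t2) (eta t2).
    rewrite /ge /ye /end_res; case: (terminal) regP yend => [regP _|_ -> //].
      have [_ /(_ (y t2)) h] := regP isT.
      have := yg _ (y t2) (P *m y t2 + eta t2); rewrite dotDr; lra.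
    by rewrite dot0l nsq0; lra.
  rewrite Y'E; lra.
(* N^T eta expressed by the residuals and the primal variables *)
have dualY : sigma ^+ 2 * Y <= 2 * (G + ge) + 2 * K ^+ 2 * (X + ye).
  apply: le_trans (dual eta) _.
  have h : \sum_(t1 <= t < t2) (nsq (eta t - (stA (st t))^T *m eta t.+1)
             + nsq ((stB (st t))^T *m eta t.+1)) <= 2 * G + 2 * K ^+ 2 * X.
    rewrite /G /X !mulr_sumr -big_split; apply: ler_sum_nat => t /reg rt /=.
    have -> : eta t - (stA (st t))^T *m eta t.+1 = x_res st y eta t - stQ (st t) *m y t.
      by rewrite /x_res -(addrA (_ *m y t)) [RHS]addrC addKr.
    have -> : (stB (st t))^T *m eta t.+1 = stR (st t) *m v t - u_res st v eta t.
      by rewrite /u_res subKr.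
    have := nsqB_le (x_res st y eta t) (stQ (st t) *m y t).
    have := nsqB_le (stR (st t) *m v t) (u_res st v eta t).
    have := reg_Q rt (y t); have := reg_R rt (v t); lra.
  have : (if terminal then nsq (eta t2) else 0) <= 2 * ge + 2 * K ^+ 2 * ye.
    rewrite /ge /ye /end_res; case: (terminal) regP => [regP|_].
      have [bP _] := regP isT.
      have := nsqB_le (P *m y t2 + eta t2) (P *m y t2); have := bP (y t2).
      rewrite [P *m y t2 + eta t2 - _]addrC addKr; lra.
    have := nsq_ge0 (y t2); have := mulr_ge0 (ltW K20) (nsq_ge0 (y t2)); lra.
  lra.
have thE : theta * (2 * K ^+ 2) = mu / 2 * sigma ^+ 2.
  by rewrite /theta; field; rewrite gt_eqF.
have thY : theta / 2 * Y <= mu / (4 * K ^+ 2) * (G + ge) + mu / 4 * (X + ye).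
  have -> : mu / (4 * K ^+ 2) = theta / sigma ^+ 2.
    by rewrite /theta; field; rewrite !gt_eqF.
  rewrite -(ler_pM2r s20).
  have -> : (theta / sigma ^+ 2 * (G + ge) + mu / 4 * (X + ye)) * sigma ^+ 2 =
     theta * (G + ge) + mu / 4 * sigma ^+ 2 * (X + ye).
    by field; rewrite gt_eqF.
  have := ler_wpM2l (ltW th0) dualY; nra.
set W := r0 + (G + E) + ge.
have XW : X + ye <= C1 * W.
  have : mu / 2 * (X + ye) <= (1 / mu + mu / (4 * K ^+ 2) + theta^-1) * W.
    rewrite div1r /W.
    have := mulr_ge0 (ltW p1) E0; have := mulr_ge0 (ltW p1) r00.
    have := mulr_ge0 (ltW p2) E0; have := mulr_ge0 (ltW p2) r00.
    have := mulr_ge0 (ltW p3) E0; have := mulr_ge0 (ltW p3) r00.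
    have := mulr_ge0 (ltW p3) G0; have := mulr_ge0 (ltW p3) ge0.
    nra.
  move=> h; have m20 : 0 < mu / 2 by rewrite divr_gt0.
  rewrite -(ler_pM2l m20) (_ : _ * (C1 * W) =
    (1 / mu + mu / (4 * K ^+ 2) + theta^-1) * W)//.
  by rewrite /C1; field; rewrite !gt_eqF.
have YW : Y <= (2 + 2 * K ^+ 2 * C1) / sigma ^+ 2 * W.
  rewrite mulrAC ler_pdivlMr// mulrC; apply: le_trans dualY _.
  have K2X : 0 <= 2 * K ^+ 2 by rewrite mulr_ge0// ltW.
  have := ler_wpM2l K2X XW; rewrite /W; lra.
rewrite /C; lra.
Qed.
End KKT.

(** * Exponential weights *)

Section Weights.
Context {R : realType}.
Variable lam : R.
Hypothesis lam01 : 0 < lam < 1.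

Definition ndist (i j : nat) : nat := (i - j) + (j - i).

Definition weight (j t : nat) : R := lam ^+ ndist t j.

Let lam0 : 0 < lam. Proof. by case/andP: lam01. Qed.
Let lam1 : lam < 1. Proof. by case/andP: lam01. Qed.

Lemma weight_gt0 j t : 0 < weight j t.
Proof. exact: exprn_gt0. Qed.

Lemma weight_diag j : weight j j = 1.
Proof. by rewrite /weight /ndist subnn expr0. Qed.

Lemma weight_step j t :
  weight j t.+1 = lam * weight j t \/ weight j t = lam * weight j t.+1.
Proof.
rewrite /weight /ndist; have [jt|tj] := leqP j t; [left|right]; rewrite -exprS; congr (_ ^+ _); lia.
Qed.

(** Consecutive weights differ by the factor [lam] one way or the other. *)
Lemma weight_lip j t (eps := lam^-1 - 1) :
  [/\ (weight j t.+1 - weight j t) ^+ 2 <= eps ^+ 2 * weight j t ^+ 2,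
      (weight j t.+1 - weight j t) ^+ 2 <= eps ^+ 2 * weight j t.+1 ^+ 2 &
      weight j t.+1 ^+ 2 <= lam^-1 ^+ 2 * weight j t ^+ 2].
Proof.
have e0 : 0 < eps by rewrite /eps subr_gt0 invf_gt1.
have le : (1 - lam) ^+ 2 <= eps ^+ 2.
  rewrite ler_pXn2r ?nnegrE ?(ltW e0)// ?subr_ge0 ?(ltW lam1)//.
  rewrite (_ : 1 - lam = lam * eps); last by rewrite /eps; field; rewrite gt_eqF.
  by rewrite ger_pMl// ltW.
have lame : lam * (1 + eps) = 1 by rewrite /eps; field; rewrite gt_eqF.
have l1 : 1 <= lam^-1 ^+ 2 by rewrite exprn_ege1// invf_ge1// ltW.
have lV : lam^-1 ^+ 2 * lam ^+ 2 = 1 by rewrite -exprMn mulVf ?gt_eqF// expr1n.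
have [->|->] := weight_step j t.
  set w := weight j t; have w0 : 0 <= w ^+ 2 by exact: sqr_ge0.
  split.
  - rewrite (_ : _ ^+ 2 = (1 - lam) ^+ 2 * w ^+ 2); last by ring.
    by rewrite ler_wpM2r.
  - rewrite -exprMn (_ : eps * _ = (1 - lam) * w); last by rewrite /eps; field; rewrite gt_eqF.
    by rewrite -sqrrN (_ : - _ = (1 - lam) * w)//; ring.
  - rewrite exprMn ler_wpM2r//; apply: le_trans l1.
    by rewrite exprn_ile1// ltW.
set w := weight j t.+1; have w0 : 0 <= w ^+ 2 by exact: sqr_ge0.
split.
- by rewrite -exprMn (_ : eps * _ = w - lam * w)//; rewrite /eps; field; rewrite gt_eqF.
- rewrite (_ : _ ^+ 2 = (1 - lam) ^+ 2 * w ^+ 2); last by ring.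
  by rewrite ler_wpM2r.
- by rewrite exprMn mulrA lV mul1r.
Qed.

Lemma geometric_sum_le n : \sum_(0 <= i < n) lam ^+ i <= (1 - lam)^-1.
Proof.
have l : 0 < 1 - lam by rewrite subr_gt0.
rewrite -[leRHS]mul1r ler_pdivlMr//.
have -> : (\sum_(0 <= i < n) lam ^+ i) * (1 - lam) = 1 - lam ^+ n.
  elim: n => [|n IH]; first by rewrite big_nil mul0r expr0 subrr.
  by rewrite big_nat_recr//= mulrDl IH exprS; ring.
by rewrite gerBl exprn_ge0// ltW.
Qed.

(** Split at [j]: each side is a geometric series. *)
Lemma weight_sum_le j t1 t2 : \sum_(t1 <= t < t2) weight j t <= 2 * (1 - lam)^-1.
Proof.
have l : 0 < 1 - lam by rewrite subr_gt0.
set g := (1 - lam)^-1; have gE : lam * g = g - 1 by rewrite /g; field; rewrite gt_eqF.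
have g0 : 0 < g by rewrite invr_gt0.
have before b : (b <= j)%N -> \sum_(t1 <= t < b) weight j t <= lam ^+ (j - b) * (g - 1).
  elim: b => [|b IH] bj.
    by rewrite big_geq// mulr_ge0 ?exprn_ge0 ?(ltW lam0)// -gE mulr_ge0// ltW.
  have [bt|tb] := leqP b.+1 t1.
    by rewrite big_geq// mulr_ge0 ?exprn_ge0 ?(ltW lam0)// -gE mulr_ge0// ltW.
  rewrite big_nat_recr//=; have := IH (ltnW bj).
  rewrite /weight /ndist (_ : (b - j = 0)%N) ?add0n; last lia.
  rewrite (_ : (j - b = (j - b.+1).+1)%N); last lia.
  rewrite exprS; set q := lam ^+ _ => h; have -> : q * (g - 1) = lam * q * (g - 1) + lam * q.
    by transitivity (q * (lam * g)); [rewrite gE | ring].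
  by rewrite lerD2r.
have [t2j|jt2] := leqP t2 j.
  apply: le_trans (before _ t2j) _.
  have : lam ^+ (j - t2) * (g - 1) <= g - 1.
    by rewrite ler_piMl ?exprn_ile1 ?(ltW lam0) ?(ltW lam1)// -gE mulr_ge0// ltW.
  lra.
have after a : (j <= a)%N -> \sum_(a <= t < t2) weight j t <= g.
  move=> ja; apply: le_trans (geometric_sum_le (t2 - a)).
  rewrite -{1}[a]add0n big_addn; apply: ler_sum_nat => i _.
  rewrite /weight /ndist (_ : (j - (i + a) = 0)%N) ?addn0; last lia.
  by apply: ler_wiXn2l; rewrite ?ltW//; lia.
have [t1j|jt1] := leqP t1 j; last by have := after _ (ltnW jt1); lra.
rewrite (big_cat_nat t1j (ltnW jt2))/=.
have := before j (leqnn j); rewrite subnn expr0 mul1r; have := after j (leqnn j); lra.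
Qed.
End Weights.

(** * Exponential decay of the KKT system *)

Section Decay.
Context {R : realType}.

Lemma ler_sum_nat_term (f : nat -> R) (t1 t2 j : nat) :
  (forall t, 0 <= f t) -> (t1 <= j < t2)%N -> f j <= \sum_(t1 <= t < t2) f t.
Proof.
move=> f0 /andP[t1j jt2].
rewrite (big_cat_nat t1j (ltnW jt2)) /= [X in _ <= _ + X]big_ltn//.
by rewrite [leRHS]addrCA lerDl addr_ge0 ?sumr_ge0.
Qed.

Lemma sum_nat_last (f : nat -> R) (t1 t2 : nat) : (t1 < t2)%N ->
  (forall t, (t.+1 < t2)%N -> f t = 0) -> \sum_(t1 <= t < t2) f t = f t2.-1.
Proof.
case: t2 => // t2 t12 f0; rewrite big_nat_recr//= big_nat big1 ?add0r//.
by move=> t /andP[_ tt]; apply: f0.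
Qed.

(** The weighted counterpart of the conclusion of [kkt_stable], read at time [j] where the
    weight is 1. *)
Definition kkt_decays (mu sigma K lam C : R) : Prop :=
  forall n m (st : nat -> lq_stage R n m) (t1 t2 : nat) terminal (P : 'M[R]_n) y v eta j,
    (t1 < t2)%N ->
    (forall t, (t1 <= t < t2)%N -> regular_stage mu K (st t)) ->
    regular_end mu K terminal P ->
    dual_coercive sigma st t1 t2 terminal ->
    (t1 <= j <= t2)%N ->
    let bound := C * (weight lam j t1 ^+ 2 * nsq (y t1)
       + \sum_(t1 <= t < t2) weight lam j t ^+ 2 * stage_res st y v eta t
       + weight lam j t2 ^+ 2 * nsq (end_res terminal P (y t2) (eta t2))) in
    nsq (y j) + nsq (eta j) <= bound /\ ((j < t2)%N -> nsq (v j) <= bound).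

Section Twist.
Context {n m : nat}.
Variables (st : nat -> lq_stage R n m) (mu K lam : R).
Variables (y : nat -> 'cV[R]_n) (v : nat -> 'cV[R]_m) (eta : nat -> 'cV[R]_n).
Variables (yh : nat -> 'cV[R]_n) (j : nat).
Hypothesis lam01 : 0 < lam < 1.
Let w t := weight lam j t.
Let eps := lam^-1 - 1.

(** Multiplication by the weights commutes with the KKT operator up to the factor
    [w t.+1 - w t], which is at most [eps] times either weight. The last term accounts for
    replacing [y] by [yh], which will differ from it at a prescribed last state only. *)
Lemma twisted_stage_res t : regular_stage mu K (st t) -> yh t = y t -> eps <= 1 ->
  stage_res st (fun t => w t *: yh t) (fun t => w t *: v t) (fun t => w t *: eta t) t
  <= 18 * (w t ^+ 2 * stage_res st y v eta t)
     + 8 * eps ^+ 2 * K ^+ 2 * (w t ^+ 2 * (nsq (y t) + nsq (v t))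
                                + w t.+1 ^+ 2 * nsq (eta t.+1))
     + 2 * (w t.+1 ^+ 2 * nsq (y t.+1 - yh t.+1)).
Proof.
move=> rt yht eps1.
have [D1 D2 D3] := weight_lip lam01 j t; rewrite -/eps -/(w t) -/(w t.+1) in D1 D2 D3.
have e0 : 0 < eps by case/andP: lam01 => ? ?; rewrite /eps subr_gt0 invf_gt1.
set D := w t.+1 - w t in D1 D2.
have xE : x_res st (fun t => w t *: yh t) (fun t => w t *: eta t) t
  = w t *: x_res st y eta t - D *: ((stA (st t))^T *m eta t.+1).
  rewrite /x_res yht -!scalemxAr /D scalerBl !scalerBr scalerDr opprB.
  by rewrite addrA subrK.
have uE : u_res st (fun t => w t *: v t) (fun t => w t *: eta t) t
  = w t *: u_res st v eta t - D *: ((stB (st t))^T *m eta t.+1).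
  by rewrite /u_res -!scalemxAr /D scalerBl !scalerBr opprB addrA subrK.
have dE : dyn_res st (fun t => w t *: yh t) (fun t => w t *: v t) t
  = w t.+1 *: dyn_res st y v t + D *: (stA (st t) *m y t + stB (st t) *m v t)
    - w t.+1 *: (y t.+1 - yh t.+1).
  rewrite /dyn_res yht -!scalemxAr -!scalerDr; set a := _ + _.
  rewrite /D scalerBl !scalerBr addrA subrK opprB.
  by rewrite addrAC addrA [_ + w _ *: yh _]addrC addrK.
have hx : nsq (x_res st (fun t => w t *: yh t) (fun t => w t *: eta t) t)
   <= 2 * (w t ^+ 2 * nsq (x_res st y eta t)) + 2 * D ^+ 2 * K ^+ 2 * nsq (eta t.+1).
  rewrite xE; apply: le_trans (nsqB_le _ _) _; rewrite !nsqZ.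
  have := ler_wpM2l (sqr_ge0 D) (bounded_mx_tr (reg_A rt) (eta t.+1)); lra.
have hu : nsq (u_res st (fun t => w t *: v t) (fun t => w t *: eta t) t)
   <= 2 * (w t ^+ 2 * nsq (u_res st v eta t)) + 2 * D ^+ 2 * K ^+ 2 * nsq (eta t.+1).
  rewrite uE; apply: le_trans (nsqB_le _ _) _; rewrite !nsqZ.
  have := ler_wpM2l (sqr_ge0 D) (bounded_mx_tr (reg_B rt) (eta t.+1)); lra.
have hd : nsq (dyn_res st (fun t => w t *: yh t) (fun t => w t *: v t) t)
   <= 4 * (w t.+1 ^+ 2 * nsq (dyn_res st y v t))
      + 8 * D ^+ 2 * K ^+ 2 * (nsq (y t) + nsq (v t))
      + 2 * (w t.+1 ^+ 2 * nsq (y t.+1 - yh t.+1)).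
  rewrite dE; apply: le_trans (nsqB_le _ _) _; rewrite [nsq (w _ *: (_ - _))]nsqZ.
  have := nsqD_le (w t.+1 *: dyn_res st y v t) (D *: (stA (st t) *m y t + stB (st t) *m v t)).
  rewrite !nsqZ.
  have AB : nsq (stA (st t) *m y t + stB (st t) *m v t)
     <= 2 * (K ^+ 2 * nsq (y t) + K ^+ 2 * nsq (v t)).
    apply: le_trans (nsqD_le _ _) _; rewrite ler_pM2l// lerD//.
      exact: (reg_A rt). exact: (reg_B rt).
  have := ler_wpM2l (sqr_ge0 D) AB; lra.
rewrite /stage_res.
have lV : lam^-1 ^+ 2 <= 4.
  have -> : lam^-1 = 1 + eps by rewrite /eps addrC subrK.
  have : eps ^+ 2 <= 1 by rewrite expr_le1// ltW.
  lra.
have W4 : w t.+1 ^+ 2 <= 4 * w t ^+ 2.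
  by apply: le_trans D3 _; rewrite ler_wpM2r// sqr_ge0.
have q1 := ler_wpM2r (nsq_ge0 (dyn_res st y v t)) W4.
have KN (a : R) : 0 <= a -> 0 <= K ^+ 2 * a by move=> a0; rewrite mulr_ge0// sqr_ge0.
have q2 := ler_wpM2r (KN _ (nsq_ge0 (y t))) D1.
have q3 := ler_wpM2r (KN _ (nsq_ge0 (v t))) D1.
have q4 := ler_wpM2r (KN _ (nsq_ge0 (eta t.+1))) D2.
have q5 := mulr_ge0 (sqr_ge0 (w t)) (nsq_ge0 (x_res st y eta t)).
have q6 := mulr_ge0 (sqr_ge0 (w t)) (nsq_ge0 (u_res st v eta t)).
have q7 := mulr_ge0 (sqr_ge0 (w t)) (nsq_ge0 (dyn_res st y v t)).
have q8 := mulr_ge0 (sqr_ge0 (eps * w t.+1)) (KN _ (nsq_ge0 (eta t.+1))).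
rewrite exprMn in q8.
lra.
Qed.

End Twist.

(** Apply [kkt_stable] to the weighted trajectory. Its residuals exceed the weighted
    residuals by [8 eps^2 K^2] times the quantity being estimated, and [eps] is chosen so
    that half of that quantity can be subtracted on both sides. *)
Lemma kkt_decay (mu sigma K : R) : 0 < mu -> 0 < sigma -> 0 < K ->
  exists lam C : R, [/\ 0 < lam < 1, 1 <= C & kkt_decays mu sigma K lam C].
Proof.
move=> mu0 sigma0 K0; have [C0 C00 stable] := kkt_stable mu0 sigma0 K0.
pose c := 16 * C0 * K ^+ 2.
have c0 : 0 < c by rewrite !mulr_gt0// exprn_gt0.
pose eps := (1 + c)^-1.
have eps0 : 0 < eps by rewrite invr_gt0; lra.
have ceps : c * eps = 1 - eps by rewrite /eps; field; apply/eqP; lra.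
have eps1 : eps <= 1 by have := mulr_gt0 c0 eps0; lra.
pose lam := (1 + eps)^-1.
have lam01 : 0 < lam < 1.
  by apply/andP; split; rewrite /lam ?invr_gt0 ?invf_lt1; lra.
have epsE : lam^-1 - 1 = eps by rewrite /lam invrK addrC addKr.
exists lam, (36 * C0 + 1); split=> //; first by lra.
move=> n m st t1 t2 terminal P y v eta j t12 reg regP dual jt.
pose w t := weight lam j t.
(* a prescribed last state is moved to the residual of the last dynamics *)
pose yh t := if ~~ terminal && (t == t2) then 0 else y t.
have yhE t : (t < t2)%N -> yh t = y t by move=> tt; rewrite /yh ltn_eqF// andbF.
set S := \sum_(t1 <= t < t2) weight lam j t ^+ 2 * stage_res st y v eta t.
set r1 := _ * nsq (y t1); set r2 := _ * nsq (end_res _ _ _ _) => bound.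
have r10 : 0 <= r1 by rewrite mulr_ge0 ?sqr_ge0 ?nsq_ge0.
have r20 : 0 <= r2 by rewrite mulr_ge0 ?sqr_ge0 ?nsq_ge0.
have S0 : 0 <= S.
  by apply: sumr_ge0 => t _; rewrite mulr_ge0 ?sqr_ge0// /stage_res !addr_ge0 ?nsq_ge0.
have := stable _ _ st t1 t2 terminal P (fun t => w t *: yh t) (fun t => w t *: v t)
  (fun t => w t *: eta t) (ltnW t12) reg regP dual.
set Z := _ + _ => hZ0.
have /hZ0 {hZ0} : ~~ terminal -> w t2 *: yh t2 = 0.
  by rewrite /yh eqxx => ->; rewrite scaler0.
set Sw := \sum_(_ <= _ < _) _; set e := nsq (end_res _ _ _ _) => hZ.
have hZ1 : \sum_(t1 <= t < t2) (w t ^+ 2 * (nsq (y t) + nsq (v t))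
             + w t.+1 ^+ 2 * nsq (eta t.+1)) <= Z.
  have -> : Z = \sum_(t1 <= t < t2) nsq (w t *: yh t) + nsq (w t2 *: yh t2)
     + (nsq (w t1 *: eta t1) + \sum_(t1 <= t < t2) nsq (w t.+1 *: eta t.+1))
     + \sum_(t1 <= t < t2) nsq (w t *: v t).
    have e1 := sum_nat_recr (fun t => nsq (w t *: yh t)) (ltnW t12).
    have e2 := sum_nat_recl (fun t => nsq (w t *: eta t)) (ltnW t12).
    by rewrite /= in e1 e2; rewrite -e1 -e2 -big_split.
  have -> : \sum_(t1 <= t < t2) (w t ^+ 2 * (nsq (y t) + nsq (v t))
             + w t.+1 ^+ 2 * nsq (eta t.+1))
    = \sum_(t1 <= t < t2) nsq (w t *: yh t) + \sum_(t1 <= t < t2) nsq (w t *: v t)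
      + \sum_(t1 <= t < t2) nsq (w t.+1 *: eta t.+1).
    rewrite -!big_split /=; apply: eq_big_nat => t /andP[_ tt].
    by rewrite !nsqZ yhE// mulrDr.
  have := nsq_ge0 (w t2 *: yh t2); have := nsq_ge0 (w t1 *: eta t1); lra.
have hsplit : \sum_(t1 <= t < t2) (w t.+1 ^+ 2 * nsq (y t.+1 - yh t.+1)) <= r2.
  rewrite sum_nat_last//; last by move=> t tt; rewrite yhE// subrr nsq0 mulr0.
  rewrite (ltn_predK t12); rewrite /r2 /w ler_wpM2l ?sqr_ge0// /yh eqxx andbT /end_res.
  by case: (terminal) => /=; rewrite ?subr0// subrr nsq0 nsq_ge0.
have hSw : Sw <= 18 * S + 8 * eps ^+ 2 * K ^+ 2 * Z + 2 * r2.
  have k0 : 0 <= 8 * eps ^+ 2 * K ^+ 2 by have := mulr_ge0 (sqr_ge0 eps) (sqr_ge0 K); lra.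
  apply: (@le_trans _ _ (\sum_(t1 <= t < t2) (18 * (w t ^+ 2 * stage_res st y v eta t)
     + 8 * eps ^+ 2 * K ^+ 2 * (w t ^+ 2 * (nsq (y t) + nsq (v t))
                                + w t.+1 ^+ 2 * nsq (eta t.+1))
     + 2 * (w t.+1 ^+ 2 * nsq (y t.+1 - yh t.+1))))).
    apply: ler_sum_nat => t /[dup] /reg rt /andP[_ tt]; rewrite -epsE.
    by apply: twisted_stage_res rt _ _ => //; [exact: yhE | rewrite epsE].
  rewrite 2!big_split /= -!mulr_sumr.
  have := ler_wpM2l k0 hZ1; rewrite -/S; lra.
have hr1 : nsq (w t1 *: yh t1) = r1 by rewrite yhE// nsqZ.
have he : e <= r2.
  rewrite /e /r2 /end_res /= /yh eqxx andbT; case: (terminal) => /=.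
    by rewrite -scalemxAr -scalerDr nsqZ.
  by rewrite scaler0 nsq0 mulr_ge0 ?sqr_ge0 ?nsq_ge0.
have ZE : Z <= 36 * C0 * (r1 + S + r2).
  have k1 : C0 * (8 * eps ^+ 2 * K ^+ 2) <= 1 / 2.
    have -> : C0 * (8 * eps ^+ 2 * K ^+ 2) = (c * eps) * eps / 2 by rewrite /c; field.
    have := mulr_ge0 (ltW eps0) (ltW eps0); rewrite ceps; nra.
  have Z0 : 0 <= Z.
    apply: addr_ge0; apply: sumr_ge0 => t _; first by rewrite addr_ge0 ?nsq_ge0.
    exact: nsq_ge0.
  rewrite hr1 in hZ.
  have := ler_wpM2r Z0 k1.
  have : C0 * (r1 + Sw + e) <= C0 * (r1 + (18 * S + 8 * eps ^+ 2 * K ^+ 2 * Z + 2 * r2) + r2).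
    by rewrite ler_pM2l// !lerD.
  have := mulr_ge0 (ltW C00) r10; have := mulr_ge0 (ltW C00) r20; lra.
have bE : bound = 36 * C0 * (r1 + S + r2) + (r1 + S + r2) by rewrite /bound; ring.
have wj : w j = 1 by rewrite /w weight_diag.
have vZ : (j < t2)%N -> nsq (v j) <= Z.
  move=> jt2; rewrite -[v j]scale1r -wj.
  have jj : (t1 <= j < t2)%N by case/andP: jt => -> _.
  have := @ler_sum_nat_term (fun t => nsq (w t *: v t)) t1 t2 j (fun t => nsq_ge0 _) jj.
  rewrite /Z => h; apply: le_trans h _; rewrite lerDr sumr_ge0// => t _.
  by rewrite addr_ge0 ?nsq_ge0.
have yZ : nsq (yh j) + nsq (eta j) <= Z.
  rewrite -[yh j]scale1r -[eta j]scale1r -wj.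
  have jj : (t1 <= j < t2.+1)%N by [].
  have h0 t : 0 <= nsq (w t *: yh t) + nsq (w t *: eta t) by rewrite addr_ge0 ?nsq_ge0.
  have h := ler_sum_nat_term h0 jj; apply: le_trans h _.
  by rewrite /Z lerDl sumr_ge0// => t _; exact: nsq_ge0.
split; last by move=> /vZ; lra.
have [jt2|] := boolP (~~ terminal && (j == t2)); last first.
  by move=> /negbTE hj; move: yZ; rewrite /yh hj; lra.
have r2E : r2 = nsq (y j).
  case/andP: jt2 => /negbTE ft /eqP jE.
  by rewrite /r2 /end_res ft -jE weight_diag expr1n mul1r.
have := nsq_ge0 (yh j); lra.
Qed.

End Decay.

(** * Perturbation of KKT trajectories *)

Section Perturbation.
Context {R : realType}.

Definition kkt {n m} (st : nat -> lq_stage R n m) (t1 t2 : nat)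
    (y : nat -> 'cV[R]_n) (v : nat -> 'cV[R]_m) (eta : nat -> 'cV[R]_n) : Prop :=
  forall t, (t1 <= t < t2)%N ->
    [/\ y t.+1 = stA (st t) *m y t + stB (st t) *m v t + stw (st t),
        stQ (st t) *m (y t - stx (st t)) + eta t = (stA (st t))^T *m eta t.+1 &
        stR (st t) *m v t = (stB (st t))^T *m eta t.+1].

Definition kkt_end {n} (terminal : bool) (P : 'M[R]_n) (x y eta : 'cV[R]_n) : Prop :=
  terminal -> P *m (y - x) + eta = 0.

Variables (mu sigma K lam C : R).
Hypotheses (K1 : 1 <= K) (lam01 : 0 < lam < 1) (C1 : 1 <= C).
Hypothesis decay : kkt_decays mu sigma K lam C.

Let lam0 : 0 < lam. Proof. by case/andP: lam01. Qed.
Let lam1 : lam < 1. Proof. by case/andP: lam01. Qed.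
Let lam0' : 0 <= lam. Proof. exact: ltW. Qed.
Let lam1' : lam <= 1. Proof. exact: ltW. Qed.
Let K0 : 0 <= K. Proof. exact: le_trans K1. Qed.

Lemma weight_left (j t : nat) : (t <= j)%N -> weight lam j t = lam ^+ (j - t).
Proof. by move=> tj; rewrite /weight /ndist (eqP tj : (t - j)%N = 0%N) add0n. Qed.

Lemma weight_right (j t : nat) : (j <= t)%N -> weight lam j t = lam ^+ (t - j).
Proof. by move=> tj; rewrite /weight /ndist (eqP tj : (j - t)%N = 0%N) addn0. Qed.

Lemma weight_le1 (j t : nat) : weight lam j t <= 1.
Proof. by rewrite exprn_ile1. Qed.

Definition sol_const (D : R) : R := C * (1 + (K ^+ 2 + K ^+ 4) * (2 * (1 - lam)^-1) + D).

Lemma sol_const_ge (D : R) : 0 <= D -> C * (1 + D) <= sol_const D.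
Proof.
move=> D0; rewrite /sol_const ler_pM2l; last exact: lt_le_trans C1.
have : 0 <= (K ^+ 2 + K ^+ 4) * (2 * (1 - lam)^-1).
  by rewrite !mulr_ge0 ?addr_ge0 ?exprn_ge0// invr_ge0 subr_ge0.
lra.
Qed.

(** The data [stw] and [stx] are residuals of size at most [K^2] at every time. Seen from
    time [j] they sum to a geometric series, so their effect does not grow with the
    length, while the initial state is damped. *)
Lemma kkt_bound (D : R) n m (st : nat -> lq_stage R n m) (t1 t2 : nat) terminal
    (P : 'M[R]_n) y v eta j :
  0 <= D -> (t1 < t2)%N ->
  (forall t, (t1 <= t < t2)%N -> regular_stage mu K (st t)) ->
  regular_end mu K terminal P ->
  dual_coercive sigma st t1 t2 terminal ->
  kkt st t1 t2 y v eta ->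
  nsq (end_res terminal P (y t2) (eta t2)) <= D ->
  (t1 <= j <= t2)%N ->
  let bound := sol_const D * ((lam ^+ (j - t1)) ^+ 2 * nsq (y t1) + 1) in
  nsq (y j) + nsq (eta j) <= bound /\ ((j < t2)%N -> nsq (v j) <= bound).
Proof.
move=> D0 t12 reg regP dual sol endD jt bound.
have /andP[t1j jt2] := jt.
have C0 : 0 < C by exact: lt_le_trans C1.
set g := 2 * (1 - lam)^-1.
have res t : (t1 <= t < t2)%N -> stage_res st y v eta t <= K ^+ 2 + K ^+ 4.
  move=> tt; have rt := reg t tt; have [e1 e2 e3] := sol t tt.
  rewrite /stage_res /dyn_res /x_res /u_res e1 e3 subrr nsq0 addr0.
  rewrite addrAC subrr add0r -e2 mulmxBr opprD addrACA subrr addr0 subKr.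
  have := reg_Q rt (stx (st t)); have := reg_w rt.
  have := ler_wpM2l (sqr_ge0 K) (reg_x rt); lra.
have S : \sum_(t1 <= t < t2) weight lam j t ^+ 2 * stage_res st y v eta t
   <= (K ^+ 2 + K ^+ 4) * g.
  apply: (@le_trans _ _ (\sum_(t1 <= t < t2) (K ^+ 2 + K ^+ 4) * weight lam j t)).
    apply: ler_sum_nat => t /res h; rewrite mulrC ler_pM ?sqr_ge0//.
      by rewrite /stage_res !addr_ge0 ?nsq_ge0.
    by rewrite expr2 ger_pMl ?weight_gt0// weight_le1.
  rewrite -mulr_sumr ler_wpM2l ?addr_ge0 ?exprn_ge0//; exact: weight_sum_le.
have B : C * (weight lam j t1 ^+ 2 * nsq (y t1)
       + \sum_(t1 <= t < t2) weight lam j t ^+ 2 * stage_res st y v eta t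
       + weight lam j t2 ^+ 2 * nsq (end_res terminal P (y t2) (eta t2))) <= bound.
  have g0 : 0 <= (K ^+ 2 + K ^+ 4) * g.
    by rewrite mulr_ge0 ?addr_ge0 ?exprn_ge0 ?mulr_ge0// invr_ge0 subr_ge0.
  rewrite /bound /sol_const -/g -mulrA ler_pM2l// weight_left//.
  have w1 : weight lam j t2 ^+ 2 <= 1 by rewrite exprn_ile1 ?weight_le1// ltW ?weight_gt0.
  have e1 : weight lam j t2 ^+ 2 * nsq (end_res terminal P (y t2) (eta t2)) <= D.
    by apply: le_trans endD; rewrite ler_piMl ?nsq_ge0.
  have := mulr_ge0 (addr_ge0 g0 D0) (mulr_ge0 (sqr_ge0 (lam ^+ (j - t1))) (nsq_ge0 (y t1))).
  lra.
have [h1 h2] := decay y v eta t12 reg regP dual jt.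
by split=> [|/h2 h]; [apply: le_trans h1 B | apply: le_trans h B].
Qed.

(** [d] stands for the distance between the parameters of the two stages, and [K] for a
    common Lipschitz constant. *)
Record close_stage {n m} (d : R) (s s' : lq_stage R n m) : Prop := CloseStage {
  close_A : bounded_mx (K * d) (stA s - stA s');
  close_B : bounded_mx (K * d) (stB s - stB s');
  close_Q : bounded_mx (K * d) (stQ s - stQ s');
  close_R : bounded_mx (K * d) (stR s - stR s');
  close_w : nsq (stw s - stw s') <= (K * d) ^+ 2;
  close_x : nsq (stx s - stx s') <= (K * d) ^+ 2 }.

(** The difference of two KKT trajectories satisfies the KKT system of the first one, with
    residuals given by the differences of the data applied to the second one. *)
Lemma perturbed_stage_res {n m} (st st' : nat -> lq_stage R n m) (t : nat) d
    y v eta y' v' eta' :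
  regular_stage mu K (st t) -> regular_stage mu K (st' t) ->
  close_stage d (st t) (st' t) ->
  kkt st t t.+1 y v eta -> kkt st' t t.+1 y' v' eta' ->
  stage_res st (fun t => y t - y' t) (fun t => v t - v' t) (fun t => eta t - eta' t) t
  <= 8 * (1 + K ^+ 2) * K ^+ 2 * d ^+ 2 * (1 + nsq (y' t) + nsq (v' t) + nsq (eta' t.+1)).
Proof.
move=> rt rt' cl sol sol'.
have tt : (t <= t < t.+1)%N by rewrite leqnn ltnS leqnn.
have [e1 e2 e3] := sol t tt; have [e1' e2' e3'] := sol' t tt.
have dE : dyn_res st (fun t => y t - y' t) (fun t => v t - v' t) t
  = (stA (st t) - stA (st' t)) *m y' t + (stB (st t) - stB (st' t)) *m v' t
    + (stw (st t) - stw (st' t)).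
  rewrite /dyn_res e1 e1' !mulmxBr !mulmxBl.
  by do 6![move: (_ *m _) => ?]; apply/matrixP => i j; rewrite !mxE; ring.
have xE : x_res st (fun t => y t - y' t) (fun t => eta t - eta' t) t
  = stQ (st t) *m (stx (st t) - stx (st' t)) + (stQ (st t) - stQ (st' t)) *m stx (st' t)
    - (stQ (st t) - stQ (st' t)) *m y' t
    + (stA (st t) - stA (st' t))^T *m eta' t.+1.
  rewrite /x_res [(_ - _)^T]linearB /= !(mulmxBl, mulmxBr) -e2 -e2' !mulmxBr.
  by do 6![move: (_ *m _) => ?]; apply/matrixP => i j; rewrite !mxE; ring.
have uE : u_res st (fun t => v t - v' t) (fun t => eta t - eta' t) t
  = (stB (st t) - stB (st' t))^T *m eta' t.+1 - (stR (st t) - stR (st' t)) *m v' t.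
  rewrite /u_res [(_ - _)^T]linearB /= !(mulmxBl, mulmxBr) e3 -e3'.
  by do 4![move: (_ *m _) => ?]; apply/matrixP => i j; rewrite !mxE; ring.
set a := (K * d) ^+ 2.
have a0 : 0 <= a by exact: sqr_ge0.
have dL : nsq (dyn_res st (fun t => y t - y' t) (fun t => v t - v' t) t)
    <= 4 * a * (1 + nsq (y' t) + nsq (v' t)).
  rewrite dE; have := nsqD_le ((stA (st t) - stA (st' t)) *m y' t + (stB (st t) - stB (st' t)) *m v' t) (stw (st t) - stw (st' t)).
  have := nsqD_le ((stA (st t) - stA (st' t)) *m y' t) ((stB (st t) - stB (st' t)) *m v' t).
  have := close_A cl (y' t); have := close_B cl (v' t); have := close_w cl.
  rewrite -/a; lra.
have xL : nsq (x_res st (fun t => y t - y' t) (fun t => eta t - eta' t) t)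
    <= 4 * a * (2 * K ^+ 2 + nsq (y' t) + nsq (eta' t.+1)).
  rewrite xE -addrA; apply: le_trans (nsqD_le _ _) _.
  have := nsqD_le (stQ (st t) *m (stx (st t) - stx (st' t))) ((stQ (st t) - stQ (st' t)) *m stx (st' t)).
  have := nsqD_le (- ((stQ (st t) - stQ (st' t)) *m y' t)) ((stA (st t) - stA (st' t))^T *m eta' t.+1).
  rewrite nsqN; have := close_Q cl (y' t); have := bounded_mx_tr (close_A cl) (eta' t.+1).
  have := le_trans (close_Q cl (stx (st' t))) (ler_wpM2l a0 (reg_x rt')).
  have := le_trans (reg_Q rt (stx (st t) - stx (st' t))) (ler_wpM2l (sqr_ge0 K) (close_x cl)).
  rewrite -/a; lra.
have uL : nsq (u_res st (fun t => v t - v' t) (fun t => eta t - eta' t) t)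
    <= 2 * a * (nsq (v' t) + nsq (eta' t.+1)).
  rewrite uE; apply: le_trans (nsqB_le _ _) _.
  have := close_R cl (v' t); have := bounded_mx_tr (close_B cl) (eta' t.+1).
  rewrite -/a; lra.
rewrite /stage_res (_ : _ * d ^+ 2 = 8 * (1 + K ^+ 2) * a); last by rewrite /a; ring.
have p1 := mulr_ge0 a0 (nsq_ge0 (y' t)); have p2 := mulr_ge0 a0 (nsq_ge0 (v' t)).
have p3 := mulr_ge0 a0 (nsq_ge0 (eta' t.+1)).
have Ka : 0 <= K ^+ 2 * a by rewrite mulr_ge0 ?sqr_ge0.
have q1 := mulr_ge0 Ka (nsq_ge0 (y' t)); have q2 := mulr_ge0 Ka (nsq_ge0 (v' t)).
have q3 := mulr_ge0 Ka (nsq_ge0 (eta' t.+1)).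
lra.
Qed.
End Perturbation.

Section Perturbation.
Context {R : realType}.

Lemma sum_sqr_le (f : nat -> R) (t1 t2 : nat) : (forall t, 0 <= f t) ->
  \sum_(t1 <= t < t2) f t ^+ 2 <= (\sum_(t1 <= t < t2) f t) ^+ 2.
Proof.
move=> f0; elim: t2 => [|t2 IH]; first by rewrite !big_geq// expr0n.
have [h|h] := leqP t1 t2; last by rewrite !big_geq// expr0n.
rewrite !big_nat_recr//= sqrrD.
have : 0 <= (\sum_(t1 <= t < t2) f t) * f t2 by rewrite mulr_ge0 ?sumr_ge0.
rewrite mulr2n; lra.
Qed.

Variables (mu sigma K lam C : R).
Hypotheses (K1 : 1 <= K) (lam01 : 0 < lam < 1) (C1 : 1 <= C).
Hypothesis decay : kkt_decays mu sigma K lam C.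

Let lam0 : 0 < lam. Proof. by case/andP: lam01. Qed.
Let lam1 : lam < 1. Proof. by case/andP: lam01. Qed.
Let lam0' : 0 <= lam. Proof. exact: ltW. Qed.
Let lam1' : lam <= 1. Proof. exact: ltW. Qed.
Let K0 : 0 <= K. Proof. exact: le_trans K1. Qed.

Definition close_end {n} (d : R) (P P' : 'M[R]_n) (x x' : 'cV[R]_n) : Prop :=
  [/\ bounded_mx (K * d) (P - P'), nsq (x - x') <= (K * d) ^+ 2 & nsq x' <= K ^+ 2].

(** [D] bounds the squared norm of a prescribed last state. *)
Definition res_const (D : R) : R :=
  32 * (1 + K ^+ 2) * K ^+ 2 * sol_const K lam C (D + K ^+ 4).

Definition pert_const (D : R) : R := C * res_const D.

Lemma sol_const_ge1 (D : R) : 0 <= D -> 1 <= sol_const K lam C D.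
Proof.
move=> D0; apply: le_trans (sol_const_ge K1 lam01 C1 D0).
by have := mulr_ge0 (le_trans ler01 C1) D0; have := C1; lra.
Qed.

Lemma res_const_ge1 (D : R) : 0 <= D -> 1 <= res_const D.
Proof.
move=> D0; have S1 : 1 <= sol_const K lam C (D + K ^+ 4).
  by rewrite sol_const_ge1// addr_ge0// exprn_ge0.
have K21 : 1 <= K ^+ 2 by rewrite exprn_ege1.
rewrite /res_const; have : 1 <= 32 * (1 + K ^+ 2) * K ^+ 2 by nra.
nra.
Qed.

Lemma pert_const_ge1 (D : R) : 0 <= D -> 1 <= pert_const D.
Proof. by move=> D0; have := C1; have := res_const_ge1 D0; rewrite /pert_const; nra. Qed.

(** Two dampings multiply: by [kkt_bound] the residual at [t] has size
    [d t * (lam^(t - t1) |z| + 1)], and by [kkt_decay] its effect on the first action is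
    damped by another [lam^(t - t1)]. *)
Lemma kkt_perturbation (D : R) n m (st st' : nat -> lq_stage R n m) (t1 t2 : nat)
    terminal (P P' : 'M[R]_n) x x' y v eta y' v' eta' (d : nat -> R) :
  0 <= D -> (t1 < t2)%N -> (forall t, 0 <= d t) ->
  (forall t, (t1 <= t < t2)%N -> regular_stage mu K (st t)) ->
  (forall t, (t1 <= t < t2)%N -> regular_stage mu K (st' t)) ->
  (forall t, (t1 <= t < t2)%N -> close_stage K (d t) (st t) (st' t)) ->
  regular_end mu K terminal P -> regular_end mu K terminal P' ->
  (terminal -> close_end (d t2) P P' x x') ->
  (~~ terminal -> nsq (y t2 - y' t2) <= d t2 ^+ 2 /\ nsq (y' t2) <= D) ->
  dual_coercive sigma st t1 t2 terminal -> dual_coercive sigma st' t1 t2 terminal ->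
  kkt st t1 t2 y v eta -> kkt st' t1 t2 y' v' eta' ->
  kkt_end terminal P x (y t2) (eta t2) -> kkt_end terminal P' x' (y' t2) (eta' t2) ->
  y t1 = y' t1 ->
  norm2 (v t1 - v' t1) <= pert_const D *
    \sum_(t1 <= t < t2.+1) lam ^+ (t - t1) * d t * (lam ^+ (t - t1) * norm2 (y' t1) + 1).
Proof.
move=> D0 t12 d0 reg reg' cl regP regP' clP notP dual dual' sol sol' fin fin' y1.
set S := sol_const K lam C (D + K ^+ 4).
have D'0 : 0 <= D + K ^+ 4 by rewrite addr_ge0 ?exprn_ge0.
have S1 : 1 <= S by exact: sol_const_ge1.
set Z := nsq (y' t1); have Z0 : 0 <= Z by exact: nsq_ge0.
pose q t := lam ^+ (t - t1).
have q0 t : 0 <= q t by exact: exprn_ge0.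
have K20 : 0 <= K ^+ 2 by exact: sqr_ge0.
have endD : nsq (end_res terminal P' (y' t2) (eta' t2)) <= D + K ^+ 4.
  rewrite /end_res; case: (terminal) regP' clP notP fin fin' => [regP' clP _ _ fin'|_ _ notP _ _].
    have -> : P' *m y' t2 + eta' t2 = P' *m x'.
      have := fin' isT; rewrite mulmxBr => /eqP.
      by rewrite addrAC subr_eq0 => /eqP.
    have [[bP _] [_ _ xK]] := (regP' isT, clP isT).
    have := le_trans (bP x') (ler_wpM2l K20 xK); lra.
  have [_] := notP isT; have : 0 <= K ^+ 4 by exact: exprn_ge0.
  lra.
have base t := kkt_bound K1 lam01 C1 decay D'0 t12 reg' regP' dual' sol' endD (j := t).
have bound t : (t1 <= t < t2)%N ->
    1 + nsq (y' t) + nsq (v' t) + nsq (eta' t.+1) <= 4 * S * (q t ^+ 2 * Z + 1).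
  move=> /andP[t1t tt2].
  have [|h1 /(_ tt2) h2] := base t; first by rewrite t1t ltnW.
  have [|h3 _] := base t.+1; first by rewrite ltnW ?ltnS.
  move: h1 h2 h3; rewrite /= -/S -/Z -/(q t) -/(q t.+1) => h1 h2 h3.
  have qq : q t.+1 ^+ 2 <= q t ^+ 2.
    by rewrite ler_pXn2r ?nnegrE ?q0// /q subSn// exprS ger_pMl ?exprn_gt0.
  have := ler_wpM2l (le_trans ler01 S1) (ler_wpM2r Z0 qq).
  have := nsq_ge0 (eta' t); have := nsq_ge0 (y' t.+1).
  have := mulr_ge0 (le_trans ler01 S1) (mulr_ge0 (sqr_ge0 (q t)) Z0).
  have := nsq_ge0 (y' t); lra.
have c0 : 0 <= res_const D by exact: le_trans (res_const_ge1 D0).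
have res t : (t1 <= t < t2)%N ->
    stage_res st (fun t => y t - y' t) (fun t => v t - v' t) (fun t => eta t - eta' t) t
    <= res_const D * (d t ^+ 2 * (q t ^+ 2 * Z + 1)).
  move=> tt; have sub (Q : nat -> Prop) : (forall t, (t1 <= t < t2)%N -> Q t) ->
      forall s, (t <= s < t.+1)%N -> Q s.
    move=> h s /andP[ts st1]; have -> : s = t by apply/eqP; rewrite eqn_leq -ltnS st1.
    exact: h.
  apply: le_trans (perturbed_stage_res (reg t tt) (reg' t tt) (cl t tt) _ _) _.
  - exact: (sub _ sol).
  - exact: (sub _ sol').
  have k0 : 0 <= 8 * (1 + K ^+ 2) * K ^+ 2 * d t ^+ 2.
    by have := mulr_ge0 K20 (sqr_ge0 (d t)); nra.
  have := ler_wpM2l k0 (bound t tt); rewrite /res_const -/S; lra.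
have resend : nsq (end_res terminal P (y t2 - y' t2) (eta t2 - eta' t2))
    <= res_const D * (d t2 ^+ 2 * (q t2 ^+ 2 * Z + 1)).
  rewrite /end_res; case: (terminal) regP regP' clP notP fin fin' base {dual dual' endD bound res}
    => [regP regP' clP _ fin fin' base|_ _ _ notP _ _ _]; last first.
    have [h _] := notP isT; apply: le_trans h _.
    have r1 := res_const_ge1 D0.
    have := mulr_ge0 (sqr_ge0 (d t2)) (mulr_ge0 (sqr_ge0 (q t2)) Z0).
    have := sqr_ge0 (d t2); nra.
  have [[bP _] [cP cx xK]] := (regP isT, clP isT).
  have -> : P *m (y t2 - y' t2) + (eta t2 - eta' t2)
     = P *m (x - x') + (P - P') *m x' - (P - P') *m y' t2.
    have := fin isT; have := fin' isT.
    rewrite !(mulmxBl, mulmxBr) => /eqP; rewrite addrC addr_eq0 => /eqP -> /eqP.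
    rewrite addrC addr_eq0 => /eqP ->.
    by do 6![move: (_ *m _) => ?]; apply/matrixP => i j; rewrite !mxE; ring.
  apply: le_trans (nsqB_le _ _) _.
  have := nsqD_le (P *m (x - x')) ((P - P') *m x').
  have [|h1 _] := base t2; first by rewrite leqnn ltnW.
  move: h1; rewrite /= -/S -/Z -/(q t2) => h1.
  set a := (K * d t2) ^+ 2; have a0 : 0 <= a by exact: sqr_ge0.
  have := le_trans (bP (x - x')) (ler_wpM2l K20 cx).
  have := le_trans (cP x') (ler_wpM2l a0 xK); have := cP (y' t2); rewrite -/a.
  have := ler_wpM2l a0 h1; have := mulr_ge0 a0 (nsq_ge0 (eta' t2)).
  have -> : res_const D * (d t2 ^+ 2 * (q t2 ^+ 2 * Z + 1))
    = 32 * (1 + K ^+ 2) * (a * (S * (q t2 ^+ 2 * Z + 1))).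
    by rewrite /res_const -/S /a; ring.
  set B := S * _.
  have B1 : 1 <= B by rewrite /B; have := mulr_ge0 (sqr_ge0 (q t2)) Z0; nra.
  have := mulr_ge0 (mulr_ge0 K20 a0) (le_trans ler01 B1).
  have := ler_wpM2l (mulr_ge0 K20 a0) B1.
  have := ler_wpM2l a0 B1; lra.
have jt : (t1 <= t1 <= t2)%N by rewrite leqnn ltnW.
have [_ /(_ t12)] := decay (fun t => y t - y' t) (fun t => v t - v' t)
  (fun t => eta t - eta' t) t12 reg regP dual jt.
rewrite y1 subrr nsq0 mulr0 add0r => dv.
pose f t := q t * d t * (q t * norm2 (y' t1) + 1).
have f0 t : 0 <= f t by rewrite !mulr_ge0 ?addr_ge0 ?mulr_ge0 ?norm2_ge0.
have fE t : (t1 <= t)%N ->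
    weight lam t1 t ^+ 2 * (res_const D * (d t ^+ 2 * (q t ^+ 2 * Z + 1))) <= res_const D * f t ^+ 2.
  move=> t1t; rewrite weight_right// -/(q t) mulrCA ler_wpM2l// /f [leRHS]exprMn exprMn.
  rewrite -mulrA ler_wpM2l ?sqr_ge0// ler_wpM2l ?sqr_ge0// sqrrD expr1n exprMn sqr_norm2 -/Z.
  by rewrite mulr1 lerD2r lerDl mulrn_wge0// mulr_ge0 ?norm2_ge0.
have dv2 : nsq (v t1 - v' t1) <= pert_const D * \sum_(t1 <= t < t2.+1) f t ^+ 2.
  have e := sum_nat_recr (fun t => f t ^+ 2) (ltnW t12); rewrite /= in e.
  apply: le_trans dv _; rewrite /pert_const -mulrA ler_pM2l ?(lt_le_trans ltr01 C1)//.
  rewrite e mulrDr lerD//; last first.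
    apply: le_trans (fE _ (ltnW t12)); rewrite ler_wpM2l ?sqr_ge0//.
  rewrite mulr_sumr; apply: ler_sum_nat => t tt; have /andP[t1t _] := tt.
  by apply: le_trans (fE _ t1t); rewrite ler_wpM2l ?sqr_ge0// res.
have H1 := pert_const_ge1 D0; have s0 : 0 <= \sum_(t1 <= t < t2.+1) f t by rewrite sumr_ge0.
rewrite norm2_le; last by rewrite mulr_ge0// (le_trans ler01).
apply: le_trans dv2 _; rewrite exprMn ler_pM ?sum_sqr_le//.
- exact: le_trans H1.
- by rewrite sumr_ge0// => t _; rewrite sqr_ge0.
- by rewrite expr2 ler_peMl// (le_trans ler01).
Qed.
End Perturbation.

(** * The block matrices of the dynamics *)

Section Blocks.
Context {R : realType} {n m : nat} {p : nat -> nat} {T : nat}.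
Variable pb : ltv R n m p T.
Implicit Type xi : forall t, 'cV[R]_(p t).

Definition stages xi (t : nat) : lq_stage R n m :=
  LQStage (dynA pb (xi t)) (dynB pb (xi t)) (dynw pb (xi t))
          (costQ pb (xi t)) (costR pb (xi t)) (xbar pb (xi t)).

Lemma dot_mxcol k (q : 'I_k -> nat) (a b : forall i, 'cV[R]_(q i)) :
  dot (\mxcol_i a i) (\mxcol_i b i) = \sum_i dot (a i) (b i).
Proof. by rewrite /dot tr_mxcol mul_mxrow_mxcol summxE. Qed.

Lemma sum_ord_eq (V : zmodType) (L i : nat) (F : nat -> V) :
  \sum_(j < L) (if i == j :> nat then F j else 0) = if (i < L)%N then F i else 0.
Proof.
rewrite -big_mkcond /= -(big_ord1_eq +%R); apply: eq_bigl => j; exact: eq_sym.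
Qed.

Lemma Nhatmx_tr_mul (t1 L : nat) xi (E : nat -> 'cV[R]_n) :
  (Nhatmx pb t1 L xi)^T *m \mxcol_(i < L.+1) E i =
  \mxcol_(j < L) col_mx (E j - (stA (stages xi (t1 + j)))^T *m E j.+1)
                        (- ((stB (stages xi (t1 + j)))^T *m E j.+1)).
Proof.
rewrite /Nhatmx tr_mxblock mxblockEv mxcol_mul; apply: eq_mxcol => j.
rewrite mul_mxrow_mxcol.
transitivity (\sum_(i < L.+1) ((if (j : nat) == i :> nat then col_mx (E i) 0 else 0)
   + (if j.+1 == i :> nat then col_mx (- ((stA (stages xi (t1 + j)))^T *m E i))
         (- ((stB (stages xi (t1 + j)))^T *m E i)) else 0))).
  apply: eq_bigr => i _; rewrite tr_row_mx mul_col_mx [(j : nat) == _]eq_sym [j.+1 == _]eq_sym.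
  have [ij|ij] := eqVneq (i : nat) j.
    by rewrite ij ltn_eqF// trmx1 mul1mx trmx0 mul0mx addr0.
  have [ij'|ij'] := eqVneq (i : nat) j.+1; first by rewrite !linearN /= !mulNmx add0r.
  by rewrite !trmx0 !mul0mx col_mx0 addr0.
rewrite big_split /= (sum_ord_eq _ _ (fun i => col_mx (E i) 0)).
rewrite (sum_ord_eq _ _ (fun i => col_mx (- ((stA (stages xi (t1 + j)))^T *m E i))
         (- ((stB (stages xi (t1 + j)))^T *m E i)))).
by rewrite ltnS ltnW ?ltn_ord// ltnS ltn_ord add_col_mx add0r.
Qed.

Lemma Nhatmx_mul (t1 L : nat) xi (dy : nat -> 'cV[R]_n) (dv : nat -> 'cV[R]_m) :
  Nhatmx pb t1 L xi *m \mxcol_(j < L) col_mx (dy j) (dv j) =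
  \mxcol_(i < L.+1) ((if (i < L)%N then dy i else 0)
    - (if (0 < i)%N then stA (stages xi (t1 + i.-1)) *m dy i.-1
                         + stB (stages xi (t1 + i.-1)) *m dv i.-1 else 0)).
Proof.
rewrite /Nhatmx mxblockEv mxcol_mul; apply: eq_mxcol => i.
rewrite mul_mxrow_mxcol.
pose G j := - (stA (stages xi (t1 + j)) *m dy j + stB (stages xi (t1 + j)) *m dv j).
transitivity (\sum_(j < L) ((if (i : nat) == j :> nat then dy j else 0)
   + (if (i : nat) == j.+1 :> nat then G j else 0))).
  apply: eq_bigr => j _; rewrite mul_row_col.
  have [ij|ij] := eqVneq (i : nat) j.
    by rewrite ij ltn_eqF// mul1mx mul0mx.
  have [ij'|ij'] := eqVneq (i : nat) j.+1; first by rewrite !mulNmx add0r /G opprD.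
  by rewrite !mul0mx.
rewrite big_split /= (sum_ord_eq _ _ dy); congr (_ + _).
case: i => [[|i] /= iL]; first by rewrite oppr0 big1.
under eq_bigr do rewrite eqSS.
by rewrite (sum_ord_eq _ _ G) -ltnS iL.
Qed.

Definition last_col (L : nat) : 'M[R]_(\sum_(i < L.+1) n, n) :=
  \mxcol_(i < L.+1) (if i == L :> nat then 1%:M else 0 : 'M[R]_n).

Lemma last_col_tr_mul (L : nat) (E : nat -> 'cV[R]_n) :
  (last_col L)^T *m \mxcol_(i < L.+1) E i = E L.
Proof.
rewrite /last_col tr_mxcol mul_mxrow_mxcol.
transitivity (\sum_(i < L.+1) (if L == i :> nat then E i else 0)).
  by apply: eq_bigr => i _; rewrite eq_sym; case: ifP; rewrite ?trmx1 ?mul1mx// trmx0 mul0mx.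
by rewrite (sum_ord_eq _ _ E) ltnSn.
Qed.

Lemma last_col_mul (L : nat) (d : 'cV[R]_n) :
  last_col L *m d = \mxcol_(i < L.+1) (if i == L :> nat then d else 0).
Proof.
by rewrite /last_col mxcol_mul; apply: eq_mxcol => i; case: ifP; rewrite ?mul1mx ?mul0mx.
Qed.

Lemma NmxE (t1 L : nat) xi : Nmx pb t1 L xi = row_mx (Nhatmx pb t1 L xi) (last_col L).
Proof. by []. Qed.

Lemma sum_shift (f : nat -> R) (t1 L : nat) :
  \sum_(t1 <= t < t1 + L) f t = \sum_(j < L) f (t1 + j)%N.
Proof.
rewrite -{1}[t1]add0n big_addn addKn big_mkord; by apply: eq_bigr => j _; rewrite addnC.
Qed.

Lemma dual_coercive_Nhat (sigma : R) (t1 L : nat) xi : 0 < sigma ->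
  sigma <= sigma_min (Nhatmx pb t1 L xi) ->
  dual_coercive sigma (stages xi) t1 (t1 + L) false.
Proof.
move=> s0 sN eta.
have := sigma_min_coercive s0 sN (\mxcol_(i < L.+1) eta (t1 + i)%N).
rewrite (Nhatmx_tr_mul _ _ _ (fun i => eta (t1 + i)%N)) /nsq !dot_mxcol.
rewrite addr0 -addnS !sum_shift => h; apply: le_trans h _.
by apply: ler_sum => j _; rewrite dot_col_mx dotNl dotNr opprK !addnS.
Qed.

Lemma dual_coercive_N (sigma : R) (t1 t2 : nat) xi : 0 < sigma -> (t1 <= t2)%N ->
  sigma <= sigma_min (Nmx pb t1 (t2 - t1) xi) ->
  dual_coercive sigma (stages xi) t1 t2 true.
Proof.
move=> s0 /subnKC; move: (t2 - t1)%N => L <- {t2} sN eta.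
have := sigma_min_coercive s0 sN (\mxcol_(i < L.+1) eta (t1 + i)%N).
rewrite NmxE tr_row_mx mul_col_mx.
rewrite (Nhatmx_tr_mul _ _ _ (fun i => eta (t1 + i)%N)).
rewrite (last_col_tr_mul _ (fun i => eta (t1 + i)%N)) /nsq dot_col_mx !dot_mxcol.
rewrite -[X in sigma ^+ 2 * \sum_(_ <= _ < X) _]addnS !sum_shift.
move=> h; apply: le_trans h _; rewrite lerD2r.
by apply: ler_sum => j _; rewrite dot_col_mx dotNl dotNr opprK !addnS.
Qed.

End Blocks.

(** * First-order optimality and multipliers *)

Section Multipliers.
Context {R : realType} {n m : nat} {p : nat -> nat} {T : nat}.
Variable pb : ltv R n m p T.
Implicit Type xi : forall t, 'cV[R]_(p t).

(** The free value at [k] will hold the last state, which is not among the blocks of [d]. *)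
Lemma mxcol_nat k q (d : 'cV[R]_(\sum_(j < k) q)) (e : 'cV[R]_q) :
  exists f : nat -> 'cV[R]_q, d = \mxcol_(j < k) f j /\ f k = e.
Proof.
exists (fun i => if @insub _ _ 'I_k i is Some j then submxcol d j else e); split.
  by rewrite -[LHS]submxcolK; apply: eq_mxcol => j; rewrite valK.
by rewrite insubF// ltnn.
Qed.

Lemma variation_of_kernel (t1 L : nat) xi d (e : 'cV[R]_n) :
  Nhatmx pb t1 L xi *m d + last_col L *m e = 0 ->
  exists dy dv,
    [/\ d = \mxcol_(j < L) col_mx (dy (t1 + j)%N) (dv (t1 + j)%N),
        dy (t1 + L)%N = e, dy t1 = 0 &
        forall t, (t1 <= t < t1 + L)%N ->
          dy t.+1 = stA (stages pb xi t) *m dy t + stB (stages pb xi t) *m dv t].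
Proof.
have [f [-> fL]] := mxcol_nat d (col_mx e 0) => Nd.
pose dy j := usubmx (f j); pose dv j := dsubmx (f j).
have fE : \mxcol_(j < L) f j = \mxcol_(j < L) col_mx (dy j) (dv j).
  by apply: eq_mxcol => j; rewrite vsubmxK.
have dyL : dy L = e by rewrite /dy fL col_mxKu.
move: Nd; rewrite fE Nhatmx_mul last_col_mul -mxcolD -(mxcol0 (p_ := fun=> n)).
move=> /eq_mxcolP rows.
have row (i : nat) : (i < L.+1)%N -> dy i = if (0 < i)%N then
    stA (stages pb xi (t1 + i.-1)) *m dy i.-1 + stB (stages pb xi (t1 + i.-1)) *m dv i.-1
    else 0.
  move=> iL; have := rows (Ordinal iL) => /= /eqP.
  have [->|iL'] := eqVneq i L.
    by rewrite ltnn -dyL sub0r addrC subr_eq0 => /eqP.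
  have -> : (i < L)%N by rewrite ltn_neqAle iL'.
  by rewrite addr0 subr_eq0 => /eqP.
exists (fun t => dy (t - t1)%N), (fun t => dv (t - t1)%N); split.
- by apply: eq_mxcol => j; rewrite addKn.
- by rewrite addKn.
- by rewrite subnn row.
- move=> t /andP[t1t tL]; rewrite subSn// row /=; last by rewrite ltnS ltn_subLR.
  by rewrite subnKC.
Qed.

(** Half the derivative of the cost at (y, v) in the direction (dy, dv). *)
Definition first_variation (st : nat -> lq_stage R n m) (t1 t2 : nat) (terminal : bool)
    (P : 'M[R]_n) (x : 'cV[R]_n) y v dy dv : R :=
  \sum_(t1 <= t < t2) (dot (stQ (st t) *m (y t - stx (st t))) (dy t)
                       + dot (stR (st t) *m v t) (dv t))
  + (if terminal then dot (P *m (y t2 - x)) (dy t2) else 0).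

Definition variation (st : nat -> lq_stage R n m) (t1 t2 : nat) (terminal : bool)
    (dy : nat -> 'cV[R]_n) (dv : nat -> 'cV[R]_m) : Prop :=
  [/\ dy t1 = 0,
      forall t, (t1 <= t < t2)%N -> dy t.+1 = stA (st t) *m dy t + stB (st t) *m dv t &
      ~~ terminal -> dy t2 = 0].

(** Feasible directions are the kernel of N, so [orth_kernel_range] applies to the gradient
    of the cost; the blocks of [N^T E] give the stationarity conditions for [eta = - E]. *)
Lemma multipliers_exist (t1 t2 : nat) xi terminal P x y v (st := stages pb xi) :
  (t1 <= t2)%N ->
  (forall t, (t1 <= t < t2)%N ->
     y t.+1 = stA (st t) *m y t + stB (st t) *m v t + stw (st t)) ->
  (forall dy dv, variation st t1 t2 terminal dy dv ->
     first_variation st t1 t2 terminal P x y v dy dv = 0) ->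
  exists eta, kkt st t1 t2 y v eta /\ kkt_end terminal P x (y t2) (eta t2).
Proof.
move=> /subnKC; move: (t2 - t1)%N => L <- {t2}; set t2 := (t1 + L)%N => dyn fv.
pose g := \mxcol_(j < L) col_mx (stQ (st (t1 + j)%N) *m (y (t1 + j)%N - stx (st (t1 + j)%N)))
                                (stR (st (t1 + j)%N) *m v (t1 + j)%N).
pose ge := if terminal then P *m (y t2 - x) else 0.
have orth d e : Nhatmx pb t1 L xi *m d + last_col L *m e = 0 ->
    (~~ terminal -> e = 0) -> dot g d + dot ge e = 0.
  move=> /variation_of_kernel[dy [dv [-> dyL dy0 dyS]]] e0.
  rewrite -[RHS](fv dy dv); last by split=> // /e0 <-.
  rewrite /first_variation sum_shift /g dot_mxcol.
  congr (_ + _); first by apply: eq_bigr => j _; rewrite dot_col_mx.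
  by rewrite /ge /t2 dyL; case: (terminal); rewrite ?dot0l.
have [E [gE geE]] : exists E : nat -> 'cV[R]_n,
    g = (Nhatmx pb t1 L xi)^T *m \mxcol_(i < L.+1) E i /\ (terminal -> ge = E L).
  case: (boolP terminal) => term.
    have [|eta] := @orth_kernel_range _ _ _ (Nmx pb t1 L xi) (col_mx g ge).
      move=> d; rewrite -[d]vsubmxK NmxE mul_row_col dot_col_mx => /orth; apply.
      by rewrite term.
    rewrite NmxE tr_row_mx mul_col_mx; have [E [-> _]] := mxcol_nat eta 0.
    by rewrite last_col_tr_mul => /eq_col_mx[-> ->]; exists E.
  have [|eta ->] := @orth_kernel_range _ _ _ (Nhatmx pb t1 L xi) g.
    move=> d Nd; have := orth d 0; rewrite mulmx0 addr0 dot0r addr0.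
    by apply.
  by have [E [-> _]] := mxcol_nat eta 0; exists E.
move: gE; rewrite Nhatmx_tr_mul /g => /eq_mxcolP gE.
exists (fun t => - E (t - t1)%N); split; last first.
  by move=> term; rewrite /t2 addKn -(geE term) /ge term subrr.
move=> t tt; have /andP[t1t tL] := tt.
have jL : (t - t1 < L)%N by rewrite ltn_subLR.
have := gE (Ordinal jL); rewrite /= subnKC// => /eq_col_mx[e1 e2].
split; first exact: dyn.
  by rewrite subSn// mulmxN e1 addrAC subrr add0r.
by rewrite subSn// mulmxN e2.
Qed.

(** At [e = - l / (q + 1)] the value is [- (l / (q + 1))^2]. *)
Lemma linear_term_eq0 (l q : R) : (forall e, 0 <= e * l + e ^+ 2 * q) -> l = 0.
Proof.
move=> h; have q0 : 0 <= q by have := h 1; have := h (-1); lra.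
have q1 : 0 < q + 1 by lra.
have := h (- l / (q + 1)).
have -> : - l / (q + 1) * l + (- l / (q + 1)) ^+ 2 * q = - (l / (q + 1)) ^+ 2.
  by field; rewrite gt_eqF.
rewrite oppr_ge0 => h'.
have /eqP : (l / (q + 1)) ^+ 2 = 0 by apply/eqP; rewrite eq_le h' sqr_ge0.
by rewrite sqrf_eq0 mulf_eq0 invr_eq0 (gt_eqF q1) orbF => /eqP.
Qed.

Lemma quad_expand {k} (Q : 'M[R]_k) (a b : 'cV[R]_k) e : Q^T = Q ->
  quad Q (a + e *: b) = quad Q a + 2 * e * dot (Q *m a) b + e ^+ 2 * quad Q b.
Proof.
move=> sQ; rewrite !quadE mulmxDr -scalemxAr !dotDl !dotDr !dotZl !dotZr.
have -> : dot a (Q *m b) = dot (Q *m a) b by rewrite dot_mulmx sQ.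
rewrite (dotC b); ring.
Qed.

(** The cost of a trajectory that meets the terminal constraint, if there is one. *)
Definition real_cost (st : nat -> lq_stage R n m) (t1 t2 : nat) (terminal : bool)
    (P : 'M[R]_n) (x : 'cV[R]_n) (y : nat -> 'cV[R]_n) (v : nat -> 'cV[R]_m) : R :=
  \sum_(t1 <= t < t2) (quad (stQ (st t)) (y t - stx (st t)) + quad (stR (st t)) (v t))
  + (if terminal then quad P (y t2 - x) else 0).

Lemma real_cost_expand (st : nat -> lq_stage R n m) (t1 t2 : nat) (terminal : bool)
    (P : 'M[R]_n) x y v dy dv e :
  (forall t, (t1 <= t < t2)%N -> (stQ (st t))^T = stQ (st t) /\ (stR (st t))^T = stR (st t)) ->
  (terminal -> P^T = P) ->
  real_cost st t1 t2 terminal P x (fun t => y t + e *: dy t) (fun t => v t + e *: dv t)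
  = real_cost st t1 t2 terminal P x y v
    + 2 * e * first_variation st t1 t2 terminal P x y v dy dv
    + e ^+ 2 * (\sum_(t1 <= t < t2) (quad (stQ (st t)) (dy t) + quad (stR (st t)) (dv t))
                + (if terminal then quad P (dy t2) else 0)).
Proof.
move=> sym symP; rewrite /real_cost /first_variation !mulrDr !mulr_sumr.
have -> : (if terminal then quad P (y t2 + e *: dy t2 - x) else 0)
  = (if terminal then quad P (y t2 - x) else 0)
    + 2 * e * (if terminal then dot (P *m (y t2 - x)) (dy t2) else 0)
    + e ^+ 2 * (if terminal then quad P (dy t2) else 0).
  case: (terminal) symP => [/(_ isT) sP|_]; last by rewrite !mulr0 !addr0.
  by rewrite addrAC quad_expand.
have -> : \sum_(t1 <= t < t2) (quad (stQ (st t)) (y t + e *: dy t - stx (st t))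
              + quad (stR (st t)) (v t + e *: dv t))
  = \sum_(t1 <= t < t2) (quad (stQ (st t)) (y t - stx (st t)) + quad (stR (st t)) (v t))
    + \sum_(t1 <= t < t2) (2 * e * (dot (stQ (st t) *m (y t - stx (st t))) (dy t)
                       + dot (stR (st t) *m v t) (dv t)))
    + \sum_(t1 <= t < t2) (e ^+ 2 * (quad (stQ (st t)) (dy t) + quad (stR (st t)) (dv t))).
  rewrite -!big_split /=; apply: eq_big_nat => t /sym[sQ sR].
  by rewrite (addrAC (y t)) !quad_expand//; ring.
by rewrite addrACA; congr (_ + _); exact: addrACA.
Qed.

Lemma opt_first_variation (st : nat -> lq_stage R n m) (t1 t2 : nat) (terminal : bool)
    (P : 'M[R]_n) x y v :
  (forall t, (t1 <= t < t2)%N -> (stQ (st t))^T = stQ (st t) /\ (stR (st t))^T = stR (st t)) ->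
  (terminal -> P^T = P) ->
  (forall dy dv e, variation st t1 t2 terminal dy dv ->
     real_cost st t1 t2 terminal P x y v <=
     real_cost st t1 t2 terminal P x (fun t => y t + e *: dy t) (fun t => v t + e *: dv t)) ->
  forall dy dv, variation st t1 t2 terminal dy dv ->
    first_variation st t1 t2 terminal P x y v dy dv = 0.
Proof.
move=> sym symP opt dy dv var.
set l := first_variation _ _ _ _ _ _ _ _ _ _.
have : 2 * l = 0; last by move/eqP; rewrite mulf_eq0 pnatr_eq0 /= => /eqP.
apply: linear_term_eq0 => e; have := opt dy dv e var.
rewrite real_cost_expand// -/l -addrA lerDl => h.
by rewrite mulrA (mulrC e); exact: h.
Qed.

End Multipliers.

(** * Existence of optimal continuations *)

Section Riccati.
Context {R : realType} {n m : nat}.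
Variable st : nat -> lq_stage R n m.
Variables (mu K : R).

Lemma kkt_sub (t1 t2 s1 s2 : nat) y v eta : (t1 <= s1)%N -> (s2 <= t2)%N ->
  kkt st t1 t2 y v eta -> kkt st s1 s2 y v eta.
Proof.
move=> ts st2 sol t /andP[s1t ts2]; apply: sol.
by rewrite (leq_trans ts s1t) (leq_trans ts2 st2).
Qed.

(** Backward dynamic programming: the multiplier at [t1] is minus half the gradient of the
    optimal cost-to-go, an affine function [S z + s] of the state. As [S] has a nonnegative
    quadratic form, [R + B^T S B] is invertible, which determines the action one step
    earlier. *)
Lemma kkt_exists (t2 : nat) (P : 'M[R]_n) x : 0 < mu -> coercive mu P ->
  forall L t1, (t1 + L = t2)%N ->
  (forall t, (t1 <= t < t2)%N -> regular_stage mu K (st t)) ->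
  exists S s, (forall w, 0 <= dot w (S *m w)) /\
    forall z, exists y v eta,
      [/\ y t1 = z, kkt st t1 t2 y v eta, kkt_end true P x (y t2) (eta t2) &
          eta t1 = - (S *m z + s)].
Proof.
move=> mu0 cP; elim=> [|L IH] t1 t1L reg.
  exists P, (- (P *m x)); split.
    by move=> w; apply: le_trans (cP w); rewrite mulr_ge0 ?nsq_ge0 ?ltW.
  move=> z; exists (fun=> z), (fun=> 0), (fun=> - (P *m z - P *m x)); split=> //.
    by move=> t; rewrite -t1L addn0 ltnNge andbN.
  by move=> _; rewrite mulmxBr subrr.
have t1t2 : (t1 < t2)%N by rewrite -t1L -addSnnS leq_addr.
have [|t /andP[t1t tt2]|S' [s' [S'0 traj]]] := IH t1.+1; first by rewrite addSnnS.
  by apply: reg; rewrite (ltnW t1t).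
have rt : regular_stage mu K (st t1) by apply: reg; rewrite leqnn.
case stE: (st t1) rt => [A B w Q Rm xb] rt.
have cQ := reg_Qmu rt; have cR := reg_Rmu rt; rewrite /= in cQ cR.
pose M := Rm + B^T *m S' *m B.
have cM : coercive mu M.
  move=> u; apply: le_trans (cR u) _; rewrite /M mulmxDl dotDr lerDl -!mulmxA.
  by rewrite -dot_mulmx.
have uM := coercive_unitmx mu0 cM.
have Meq (a k : 'cV[R]_n) (u : 'cV[R]_m) : u = - (invmx M *m (B^T *m (S' *m a + k))) ->
    Rm *m u = - (B^T *m (S' *m (a + B *m u) + k)).
  move=> uE; have : M *m u = - (B^T *m (S' *m a + k)) by rewrite uE mulmxN mulKVmx.
  rewrite /M mulmxDl -!mulmxA => /eqP; rewrite -subr_eq0 opprK => /eqP h.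
  apply/eqP; rewrite -subr_eq0 opprK -[X in _ == X]h; apply/eqP.
  by rewrite !mulmxDr !addrA; congr (_ + _); rewrite addrAC.
(* the optimal action is F z + k0 *)
pose F := - (invmx M *m (B^T *m (S' *m A))).
pose k0 := - (invmx M *m (B^T *m (S' *m w + s'))).
exists (A^T *m (S' *m (A + B *m F)) + Q), (A^T *m (S' *m (w + B *m k0) + s') - Q *m xb).
split.
  move=> u; set k := F *m u; set a := A *m u.
  have kE : k = - (invmx M *m (B^T *m (S' *m a + 0))).
    by rewrite /k /F /a addr0 mulNmx -!mulmxA.
  have := Meq a 0 k kE; rewrite addr0 => RkE.
  have -> : dot u ((A^T *m (S' *m (A + B *m F)) + Q) *m u)
      = dot (a + B *m k) (S' *m (a + B *m k)) + dot k (Rm *m k) + dot u (Q *m u).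
    rewrite RkE dotNr -dot_mulmx mulmxDl dotDr -!mulmxA -dot_mulmx mulmxDl -mulmxA.
    by rewrite -/k -/a dotDl addrK.
  rewrite !addr_ge0 ?S'0//.
    by apply: le_trans (cR k); rewrite mulr_ge0 ?nsq_ge0 ?ltW.
  by apply: le_trans (cQ u); rewrite mulr_ge0 ?nsq_ge0 ?ltW.
move=> z; pose u := F *m z + k0; pose z' := A *m z + B *m u + w.
have uE : u = - (invmx M *m (B^T *m (S' *m (A *m z + w) + s'))).
  rewrite /u /F /k0 mulNmx -opprD -!mulmxA -mulmxDr -mulmxDr.
  by rewrite (mulmxDr S') addrA.
have z'E : z' = A *m z + w + B *m u by rewrite /z' addrAC.
have RuE := Meq _ _ _ uE; rewrite -z'E in RuE.
have [y [v [eta [y0 sol fin eta0]]]] := traj z'.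
pose e0 := A^T *m eta t1.+1 - Q *m (z - xb).
have sel X (a : X) (f : nat -> X) t : (t1 < t)%N -> (if t == t1 then a else f t) = f t.
  by move=> h; rewrite gtn_eqF.
exists (fun t => if t == t1 then z else y t), (fun t => if t == t1 then u else v t),
  (fun t => if t == t1 then e0 else eta t); rewrite !eqxx !(sel _ _ _ _ t1t2).
split=> //.
  move=> t /andP[t1t tt2]; rewrite !(sel _ _ _ t.+1)//.
  have [->|tne] := eqVneq t t1.
    rewrite stE /=; split=> //; first by rewrite /e0 addrC subrK.
    by rewrite RuE eta0 mulmxN.
  by apply: sol; rewrite ltn_neqAle eq_sym tne t1t.
rewrite /e0 eta0 mulmxN -opprD; congr (- _).
rewrite z'E /u (mulmxBr Q) !(mulmxDl, mulmxDr) -!mulmxA.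
by do 7![move: (_ *m _) => ?]; apply/matrixP => i j; rewrite !mxE; ring.
Qed.

End Riccati.

(** * From the control problem to KKT systems *)

Section Bridge.
Context {R : realType}.

(** One number above 1 and all the upper bounds among the problem constants, which keeps
    the later constants readable; absolute values because the constants may have any sign. *)
Definition constants_bound (c : problem_constants R) : R :=
  1 + \sum_(a <- [:: c_ell c; c_a c; c_b c; c_Dw c; c_Dxbar c; c_Dxstar c; c_LA c;
                     c_LB c; c_LQ c; c_LR c; c_LP c; c_Lxbar c; c_Lw c]) `|a|.

Lemma constants_boundP (c : problem_constants R) (K := constants_bound c) :
  1 <= K /\ [/\ c_ell c <= K, c_a c <= K, c_b c <= K, c_Dw c <= K & c_Dxbar c <= K] /\
  [/\ c_Dxstar c <= K, c_LA c <= K, c_LB c <= K & c_LQ c <= K] /\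
  [/\ c_LR c <= K, c_LP c <= K, c_Lxbar c <= K & c_Lw c <= K].
Proof.
have le_sum (s : seq R) a : a \in s -> a <= 1 + \sum_(b <- s) `|b|.
  move=> sa; rewrite (big_rem a)//= addrCA; apply: le_trans (ler_norm a) _.
  by rewrite lerDl addr_ge0// sumr_ge0.
split; first by rewrite lerDl sumr_ge0.
by do !split; apply: le_sum; rewrite !inE eqxx ?orbT.
Qed.

Lemma nsq_le_sqr {q} (v : 'cV[R]_q) (a b : R) : a <= b -> norm2 v <= a -> nsq v <= b ^+ 2.
Proof.
move=> ab va; rewrite -norm2_le; first exact: le_trans va ab.
exact: le_trans (norm2_ge0 v) (le_trans va ab).
Qed.

Context {n m : nat} {p : nat -> nat} {T k : nat}.
Variables (pb : ltv R n m p T) (c : problem_constants R).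
Hypotheses (mu_gt0 : 0 < c_mu c) (sigma_gt0 : 0 < c_sigma c).
Hypothesis assm : ltv_assumptions pb c k.
Let K := constants_bound c.
Implicit Type xi : forall t, 'cV[R]_(p t).

Let K0 : 0 < K. Proof. by have [/(lt_le_trans ltr01)] := constants_boundP c. Qed.

Lemma stages_regular xi t : (t < T)%N -> unc pb t (xi t) ->
  regular_stage (c_mu c) K (stages pb xi t).
Proof.
move=> tT xit; have [_ [[He Ha Hb Hw Hx] _]] := constants_boundP c.
have [_ [costs _] _ [bnd bndx] _] := assm.
have [muQ Qell muR Rell] := costs t (xi t) tT xit.
have [dw dA dB] := bnd t (xi t) tT xit.
split=> /=.
- exact/bounded_mx_opnorm/(le_trans dA).
- exact/bounded_mx_opnorm/(le_trans dB).
- exact: loewner_bounded mu_gt0 K0 He muQ Qell.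
- exact: loewner_bounded mu_gt0 K0 He muR Rell.
- by have [] := loewner_coercive muQ.
- by have [] := loewner_coercive muR.
- exact: nsq_le_sqr Hw dw.
- exact: nsq_le_sqr Hx (bndx t (xi t) (ltnW tT) xit).
Qed.

Lemma stages_sym xi t : (t < T)%N -> unc pb t (xi t) ->
  (stQ (stages pb xi t))^T = stQ (stages pb xi t)
  /\ (stR (stages pb xi t))^T = stR (stages pb xi t).
Proof.
move=> tT xit; have [_ [costs _] _ _ _] := assm.
have [muQ _ muR _] := costs t (xi t) tT xit.
by have [[? _] [? _]] := (loewner_coercive muQ, loewner_coercive muR).
Qed.

Lemma final_regular (xiT : 'cV[R]_(p T)) : unc pb T xiT ->
  [/\ (costP pb xiT)^T = costP pb xiT, bounded_mx K (costP pb xiT),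
      coercive (c_mu c) (costP pb xiT) & nsq (xbar pb xiT) <= K ^+ 2].
Proof.
move=> xit; have [_ [[He _ _ _ Hx] _]] := constants_boundP c.
have [_ [_ costs] _ [_ bndx] _] := assm.
have [muP Pell] := costs xiT xit.
have [sP cP] := loewner_coercive muP.
by split=> //; [exact: loewner_bounded mu_gt0 K0 He muP Pell | exact: nsq_le_sqr Hx (bndx T xiT _ xit)].
Qed.

Lemma xbar_le t (xit : 'cV[R]_(p t)) : (t <= T)%N -> unc pb t xit ->
  norm2 (xbar pb xit) <= K.
Proof.
move=> tT h; have [_ [[_ _ _ _ Hx] _]] := constants_boundP c.
have [_ _ _ [_ bndx] _] := assm; exact: le_trans (bndx t xit tT h) Hx.
Qed.

Lemma stages_close xi xi' t : (t < T)%N -> unc pb t (xi t) -> unc pb t (xi' t) ->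
  close_stage K (norm2 (xi t - xi' t)) (stages pb xi t) (stages pb xi' t).
Proof.
move=> tT xit xit'; have [_ [_ [[_ HA HB HQ] [HR HP Hx Hw]]]] := constants_boundP c.
have [_ _ _ _ [ldyn lcost _ lx]] := assm.
have [lA lB lw] := ldyn t tT; have [lQ lR] := lcost t tT; have {}lx := lx t (ltnW tT).
have d0 := norm2_ge0 (xi t - xi' t).
split=> /=.
- apply/bounded_mx_opnorm/(le_trans (lA _ _ xit xit')); exact: ler_wpM2r.
- apply/bounded_mx_opnorm/(le_trans (lB _ _ xit xit')); exact: ler_wpM2r.
- apply/bounded_mx_opnorm/(le_trans (lQ _ _ xit xit')); exact: ler_wpM2r.
- apply/bounded_mx_opnorm/(le_trans (lR _ _ xit xit')); exact: ler_wpM2r.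
- apply: nsq_le_sqr (lw _ _ xit xit'); exact: ler_wpM2r.
- apply: nsq_le_sqr (lx _ _ xit xit'); exact: ler_wpM2r.
Qed.

Lemma final_close (xi xi' : 'cV[R]_(p T)) : unc pb T xi -> unc pb T xi' ->
  close_end K (norm2 (xi - xi')) (costP pb xi) (costP pb xi') (xbar pb xi) (xbar pb xi').
Proof.
move=> xit xit'; have [_ [_ [_ [_ HP Hx _]]]] := constants_boundP c.
have [_ _ _ _ [_ _ lP lx]] := assm; have {}lx := lx T (leqnn T).
have d0 := norm2_ge0 (xi - xi').
split=> /=.
- apply/bounded_mx_opnorm/(le_trans (lP _ _ xit xit')); exact: ler_wpM2r.
- apply: nsq_le_sqr (lx _ _ xit xit'); exact: ler_wpM2r.
- by have [] := final_regular xit'.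
Qed.

Lemma final_dual_coercive xi t1 : (t1 < T)%N -> in_unc pb t1 T xi ->
  dual_coercive (c_sigma c) (stages pb xi) t1 T true.
Proof.
move=> tT xiu; have [_ _ [rk _] _ _] := assm.
apply: dual_coercive_N => //; [exact: ltnW | apply: rk => //].
by move=> t /andP[t1t tT']; apply: xiu; rewrite t1t (leq_trans tT' (leq_pred T)).
Qed.

Lemma indicator_dual_coercive xi t1 : (t1 < T - k)%N -> in_unc pb t1 (t1 + k).-1 xi ->
  dual_coercive (c_sigma c) (stages pb xi) t1 (t1 + k) false.
Proof.
by move=> tT xiu; have [_ _ [_ rk] _ _] := assm; apply: dual_coercive_Nhat => //; apply: rk.
Qed.

Lemma variation_feasible xi t1 t2 terminal z y v dy dv e :
  ftocp_feasible pb t1 t2 z xi y v -> variation (stages pb xi) t1 t2 terminal dy dv ->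
  ftocp_feasible pb t1 t2 z xi (fun t => y t + e *: dy t) (fun t => v t + e *: dv t).
Proof.
move=> [yz dyn] [dy0 dyS _]; split; first by rewrite dy0 scaler0 addr0.
move=> t tt; rewrite dyn// dyS// /Defs.dyn /= !mulmxDr -!scalemxAr scalerDr.
by do 4![move: (_ *m _) => ?]; apply/matrixP => i j; rewrite !mxE; ring.
Qed.

Lemma opt_kkt_final xi t1 z y v : (t1 <= T)%N -> in_unc pb t1 T xi ->
  ftocp_opt pb t1 T z xi (FT pb (xi T)) y v ->
  y t1 = z /\ exists eta, kkt (stages pb xi) t1 T y v eta /\
     kkt_end true (costP pb (xi T)) (xbar pb (xi T)) (y T) (eta T).
Proof.
move=> tT xiu [feas _ opt]; have [yz dyn] := feas; split=> //.
have xiT : unc pb T (xi T) by apply: xiu; rewrite tT /=.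
have [sP _ _ _] := final_regular xiT.
apply: multipliers_exist => //; apply: opt_first_variation => //.
  by move=> t /andP[t1t tT']; apply: stages_sym => //; apply: xiu; rewrite t1t ltnW.
move=> dy dv e var; rewrite -lee_fin; exact: opt _ _ (variation_feasible e feas var).
Qed.

Lemma opt_kkt_indicator xi t1 t2 z zeta y v : (t1 <= t2)%N -> (t2 <= T)%N ->
  in_unc pb t1 t2.-1 xi ->
  ftocp_opt pb t1 t2 z xi (indicator_cost zeta) y v ->
  [/\ y t1 = z, y t2 = zeta & exists eta, kkt (stages pb xi) t1 t2 y v eta].
Proof.
move=> t12 t2T xiu [feas fin opt]; have [yz dyn] := feas.
have yzeta : y t2 = zeta.
  by apply/eqP; move: fin; rewrite /ftocp_cost /indicator_cost; case: eqP.
split=> //.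
have costE y' v' : y' t2 = zeta -> ftocp_cost pb t1 t2 xi (indicator_cost zeta) y' v' =
   (real_cost (stages pb xi) t1 t2 false 0 0 y' v')%:E.
  by move=> e; rewrite /ftocp_cost /indicator_cost e eqxx -EFinD.
have [||eta [sol _]] := @multipliers_exist _ _ _ _ _ pb t1 t2 xi false 0 0 y v t12; last by exists eta.
  exact: dyn.
apply: opt_first_variation => //.
  move=> t /andP[t1t tt2]; apply: stages_sym; first exact: leq_trans tt2 t2T.
  by apply: xiu; rewrite t1t -ltnS (ltn_predK tt2).
move=> dy dv e var; have [_ _ /(_ isT) dy2] := var.
rewrite -lee_fin -!costE//; last by rewrite dy2 scaler0 addr0.
exact: opt _ _ (variation_feasible e feas var).
Qed.

End Bridge.

(** * The perturbation constants *)

Section Contraction.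
Context {R : realType}.
Variables (mu sigma K lam C : R).
Hypotheses (K1 : 1 <= K) (lam01 : 0 < lam < 1) (C1 : 1 <= C).
Hypothesis decay : kkt_decays mu sigma K lam C.

Lemma close_stage_refl {n m} (s : lq_stage R n m) : close_stage K 0 s s.
Proof.
by split; rewrite ?subrr ?nsq0 ?sqr_ge0// => v; rewrite mul0mx nsq0 mulr_ge0 ?sqr_ge0 ?nsq_ge0.
Qed.

(** The difference has no residual except its initial state. *)
Lemma kkt_contraction n m (st : nat -> lq_stage R n m) (t1 t2 : nat) P x
    y v eta y' v' eta' j :
  (forall t, (t1 <= t < t2)%N -> regular_stage mu K (st t)) ->
  regular_end mu K true P ->
  ((t1 < t2)%N -> dual_coercive sigma st t1 t2 true) ->
  kkt st t1 t2 y v eta -> kkt st t1 t2 y' v' eta' ->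
  kkt_end true P x (y t2) (eta t2) -> kkt_end true P x (y' t2) (eta' t2) ->
  (t1 <= j <= t2)%N ->
  norm2 (y j - y' j) <= C * lam ^+ (j - t1) * norm2 (y t1 - y' t1) /\
  ((j < t2)%N -> norm2 (v j - v' j) <= C * lam ^+ (j - t1) * norm2 (y t1 - y' t1)).
Proof.
move=> reg regP dual sol sol' fin fin' jt; have /andP[t1j jt2] := jt.
have C0 : 0 <= C by exact: le_trans C1.
have lam0 : 0 <= lam by case/andP: lam01 => /ltW.
have [t12|t21] := ltnP t1 t2; last first.
  have -> : j = t1 by apply/eqP; rewrite eqn_leq t1j (leq_trans jt2).
  rewrite subnn expr0 mulr1 ler_peMl ?norm2_ge0//; split=> // h.
  by have := leq_trans h t21; rewrite ltnn.
have [] := decay (fun t => y t - y' t) (fun t => v t - v' t) (fun t => eta t - eta' t)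
   t12 reg regP (dual t12) jt.
have -> : end_res true P (y t2 - y' t2) (eta t2 - eta' t2) = 0.
  rewrite /end_res; have := fin isT; have := fin' isT.
  rewrite !mulmxBr => /eqP; rewrite addrC addr_eq0 => /eqP -> /eqP.
  rewrite addrC addr_eq0 => /eqP ->.
  by do 3![move: (_ *m _) => ?]; apply/matrixP => r s; rewrite !mxE; ring.
have -> : \sum_(t1 <= t < t2) weight lam j t ^+ 2 * stage_res st (fun t => y t - y' t)
    (fun t => v t - v' t) (fun t => eta t - eta' t) t = 0.
  rewrite big_nat big1// => t tt; apply/eqP; rewrite mulf_eq0; apply/orP; right.
  have [t1t tt2] := andP tt.
  rewrite eq_le; apply/andP; split; last by rewrite /stage_res !addr_ge0 ?nsq_ge0.
  apply: le_trans (perturbed_stage_res (K := K) (mu := mu) (d := 0) _ _ _ _ _) _.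
  - exact: reg.
  - exact: reg.
  - exact: close_stage_refl.
  - exact: kkt_sub sol.
  - exact: kkt_sub sol'.
  by rewrite expr0n /= mulr0 mul0r.
rewrite nsq0 mulr0 !addr0 weight_left//.
set b := C * _.
have bE : b <= (C * lam ^+ (j - t1) * norm2 (y t1 - y' t1)) ^+ 2.
  rewrite /b !exprMn sqr_norm2 -[leRHS]mulrA; apply: ler_wpM2r.
    by rewrite mulr_ge0 ?sqr_ge0 ?nsq_ge0.
  by rewrite expr2 ler_peMl.
have r0 : 0 <= C * lam ^+ (j - t1) * norm2 (y t1 - y' t1).
  by rewrite !mulr_ge0 ?exprn_ge0 ?norm2_ge0.
move=> hy hv; split=> [|/hv {}hv]; rewrite norm2_le//; last exact: le_trans hv bE.
by apply: le_trans bE; apply: le_trans hy; rewrite lerDl nsq_ge0.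
Qed.

End Contraction.

Section PerturbationConstants.
Context {R : realType} {n m : nat} {p : nat -> nat} {T k : nat}.
Variables (pb : ltv R n m p T) (c : problem_constants R).
Hypotheses (mu_gt0 : 0 < c_mu c) (sigma_gt0 : 0 < c_sigma c).
Hypothesis assm : ltv_assumptions pb c k.
Let K := constants_bound c.
Variables (lam C : R).
Hypotheses (lam01 : 0 < lam < 1) (C1 : 1 <= C).
Hypothesis decay : kkt_decays (c_mu c) (c_sigma c) K lam C.
(* the prescribed last states have norm at most 3 K *)
Let H := pert_const K lam C (9 * K ^+ 2).
Variables (xis : forall t, 'cV[R]_(p t)) (xs : nat -> 'cV[R]_n).
Hypothesis xisu : in_unc pb 0 T xis.
Hypothesis xsD : forall t, (t <= T)%N -> norm2 (xs t) <= c_Dxstar c.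

Let K1 : 1 <= K. Proof. by have [] := constants_boundP c. Qed.
Let D0 : 0 <= 9 * K ^+ 2. Proof. by rewrite mulr_ge0 ?sqr_ge0 ?ler0n. Qed.

Lemma in_unc_sub t1 t2 s1 s2 (xi : forall t, 'cV[R]_(p t)) : (t1 <= s1)%N -> (s2 <= t2)%N ->
  in_unc pb t1 t2 xi -> in_unc pb s1 s2 xi.
Proof.
move=> ts st2 h t /andP[s1t ts2]; apply: h.
by rewrite (leq_trans ts s1t) (leq_trans ts2 st2).
Qed.

Lemma pert_boundE t1 t2 d (z : 'cV[R]_n) :
  pert_bound H lam t1 t2 d z =
  H * \sum_(t1 <= t < t2.+1) lam ^+ (t - t1) * d t * (lam ^+ (t - t1) * norm2 z + 1).
Proof.
rewrite /pert_bound mulr_suml -big_split mulr_sumr; apply: eq_bigr => t _ /=.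
by rewrite mulnC exprM; ring.
Qed.

Lemma indicator_perturbation t1 t2 xi xi' y v eta y' v' eta' :
  (t1 < t2 <= T)%N -> in_unc pb t1 t2.-1 xi -> in_unc pb t1 t2.-1 xi' ->
  dual_coercive (c_sigma c) (stages pb xi) t1 t2 false ->
  dual_coercive (c_sigma c) (stages pb xi') t1 t2 false ->
  kkt (stages pb xi) t1 t2 y v eta -> kkt (stages pb xi') t1 t2 y' v' eta' ->
  y t1 = y' t1 -> norm2 (y' t2) <= 3 * K ->
  norm2 (v t1 - v' t1) <= pert_bound H lam t1 t2
    (fun t => if t == t2 then norm2 (y t2 - y' t2) else norm2 (xi t - xi' t)) (y' t1).
Proof.
move=> /andP[t12 t2T] xiu xiu' dual dual' sol sol' y1 y'K; rewrite pert_boundE.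
have unc_t (xi0 : forall t, 'cV[R]_(p t)) t : in_unc pb t1 t2.-1 xi0 -> (t1 <= t < t2)%N ->
    (t < T)%N /\ unc pb t (xi0 t).
  move=> h /andP[t1t tt2]; split; first exact: leq_trans tt2 t2T.
  by apply: h; rewrite t1t -ltnS (ltn_predK tt2).
apply: (kkt_perturbation (P := 0) (P' := 0) (x := 0) (x' := 0) (terminal := false)
   K1 lam01 C1 decay D0 t12 _ _ _ _ _ _ _ _ dual dual' sol sol') => //.
- by move=> t; case: ifP; rewrite norm2_ge0.
- by move=> t /(unc_t _ _ xiu)[]; exact: (stages_regular mu_gt0 assm).
- by move=> t /(unc_t _ _ xiu')[]; exact: (stages_regular mu_gt0 assm).
- move=> t tt; have /andP[_ tt2] := tt; rewrite ltn_eqF//.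
  have [tT h] := unc_t _ _ xiu tt; have [_ h'] := unc_t _ _ xiu' tt.
  exact: (stages_close assm tT h h').
- move=> _; rewrite eqxx sqr_norm2; split=> //.
  by rewrite -sqr_norm2; have := norm2_ge0 (y' t2); nra.
Qed.

Lemma final_perturbation t1 xi xi' y v eta y' v' eta' :
  (t1 < T)%N -> in_unc pb t1 T xi -> in_unc pb t1 T xi' ->
  kkt (stages pb xi) t1 T y v eta -> kkt (stages pb xi') t1 T y' v' eta' ->
  kkt_end true (costP pb (xi T)) (xbar pb (xi T)) (y T) (eta T) ->
  kkt_end true (costP pb (xi' T)) (xbar pb (xi' T)) (y' T) (eta' T) ->
  y t1 = y' t1 ->
  norm2 (v t1 - v' t1) <=
    pert_bound H lam t1 T (fun t => norm2 (xi t - xi' t)) (y' t1).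
Proof.
move=> tT xiu xiu' sol sol' fin fin' y1; rewrite pert_boundE.
have unc_t (xi0 : forall t, 'cV[R]_(p t)) t : in_unc pb t1 T xi0 -> (t1 <= t < T)%N ->
    (t < T)%N /\ unc pb t (xi0 t).
  by move=> h /andP[t1t tt2]; split=> //; apply: h; rewrite t1t ltnW.
have xiT : unc pb T (xi T) by apply: xiu; rewrite ltnW/=.
have xiT' : unc pb T (xi' T) by apply: xiu'; rewrite ltnW/=.
have [_ bP cP _] := final_regular mu_gt0 assm xiT.
have [_ bP' cP' _] := final_regular mu_gt0 assm xiT'.
apply: (kkt_perturbation (terminal := true) K1 lam01 C1 decay D0 tT _ _ _ _ _ _ _ _ _ _ sol sol' fin fin') => //.
- by move=> t; rewrite norm2_ge0.
- by move=> t /(unc_t _ _ xiu)[]; exact: (stages_regular mu_gt0 assm).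
- by move=> t /(unc_t _ _ xiu')[]; exact: (stages_regular mu_gt0 assm).
- move=> t tt.
  have [tT' h] := unc_t _ _ xiu tt; have [_ h'] := unc_t _ _ xiu' tt.
  exact: (stages_close assm tT' h h').
- move=> _; exact: (final_close mu_gt0 assm).
- exact: (final_dual_coercive sigma_gt0 assm tT xiu).
- exact: (final_dual_coercive sigma_gt0 assm tT xiu').
Qed.

Lemma ball_norm2 t (zeta : 'cV[R]_n) : (t <= T)%N ->
  cball (xs t) (radius c) zeta -> norm2 zeta <= 3 * K.
Proof.
move=> tT; rewrite /cball /= /radius => h; have := norm2_le_dist zeta (xs t).
have := xsD tT; have [_ [[_ _ _ _ ?] [[? _ _ _] _]]] := constants_boundP c.
rewrite /K; lra.
Qed.

Lemma pert_const_ge : C <= H.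
Proof.
have := res_const_ge1 K1 lam01 C1 D0; have := C1; rewrite /H /pert_const => ? ?.
by rewrite ler_peMr// (le_trans ler01).
Qed.

Lemma perturbation_constants_hold : (1 <= k <= T)%N ->
  perturbation_constants pb c H lam k xis xs.
Proof.
move=> /andP[k0 kT]; split.
- move=> t1 z xi zeta zeta' y v y' v' t1k zb xiu zetab zetab' opt opt'.
  have t2T : (t1 + k <= T)%N by lia.
  have xisu' : in_unc pb t1 (t1 + k).-1 xis by apply: in_unc_sub xisu => //; lia.
  have [yz yzeta [eta sol]] := opt_kkt_indicator assm (leq_addr _ _) t2T xiu opt.
  have [yz' yzeta' [eta' sol']] := opt_kkt_indicator assm (leq_addr _ _) t2T xisu' opt'.
  rewrite -[in leRHS]yz' -yzeta -yzeta'.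
  apply: indicator_perturbation sol sol' _ _ => //; last by rewrite yzeta'; exact: ball_norm2 zetab'.
  + by rewrite t2T andbT; lia.
  + exact: (indicator_dual_coercive sigma_gt0 assm).
  + exact: (indicator_dual_coercive sigma_gt0 assm).
  + by rewrite yz yz'.
- move=> t1 z xi y v y' v' /andP[_ tT] zb xiu opt opt'.
  have xisu' : in_unc pb t1 T xis by apply: in_unc_sub xisu.
  have [yz [eta [sol fin]]] := opt_kkt_final mu_gt0 assm (ltnW tT) xiu opt.
  have [yz' [eta' [sol' fin']]] := opt_kkt_final mu_gt0 assm (ltnW tT) xisu' opt'.
  by rewrite -[in leRHS]yz'; apply: final_perturbation sol sol' fin fin' _ => //; rewrite yz yz'.
move=> t1 z z' y v y' v' tT zb zb' opt opt'.
have xisu' : in_unc pb t1 T xis by apply: in_unc_sub xisu.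
have [yz [eta [sol fin]]] := opt_kkt_final mu_gt0 assm (ltnW tT) xisu' opt.
have [yz' [eta' [sol' fin']]] := opt_kkt_final mu_gt0 assm (ltnW tT) xisu' opt'.
have xiT : unc pb T (xis T) by apply: xisu; rewrite leqnn.
have [_ bP cP _] := final_regular mu_gt0 assm xiT.
have reg t : (t1 <= t < T)%N -> regular_stage (c_mu c) K (stages pb xis t).
  move=> /andP[t1t tT']; apply: (stages_regular mu_gt0 assm) => //.
  by apply: xisu; rewrite leq0n ltnW.
have contr j := kkt_contraction lam01 C1 decay reg (fun=> conj bP cP)
  (fun h => final_dual_coercive sigma_gt0 assm h xisu') sol sol' fin fin' (j := j).
have HC j : C * lam ^+ (j - t1) * norm2 (y t1 - y' t1) <= H * lam ^+ (j - t1) * norm2 (z - z').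
  have lam0 : 0 <= lam by case/andP: lam01 => /ltW.
  by rewrite yz yz' !ler_wpM2r ?norm2_ge0 ?exprn_ge0 ?pert_const_ge.
split=> j jt; first by have [h _] := contr j jt; exact: le_trans h (HC j).
have /andP[t1j jT] := jt.
have [|_ h] := contr j; first by rewrite t1j ltnW.
exact: le_trans (h jT) (HC j).
Qed.

End PerturbationConstants.

(** * Geometric convolutions *)

Section Leaky.
Context {R : realType}.
Variable lam : R.
Hypothesis lam01 : 0 < lam < 1.
Let g := (1 - lam)^-1.

(** The sum over i < t of [lam^(t - 1 - i) f i]. *)
Fixpoint leaky_sum (f : nat -> R) (t : nat) : R :=
  if t is t'.+1 then lam * leaky_sum f t' + f t' else 0.

Let lam0 : 0 <= lam. Proof. by case/andP: lam01 => /ltW. Qed.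
Let lam1 : 0 < 1 - lam. Proof. by case/andP: lam01; rewrite subr_gt0. Qed.
Let g0 : 0 < g. Proof. by rewrite invr_gt0. Qed.
Let gE : lam * g = g - 1. Proof. by rewrite /g; field; rewrite gt_eqF. Qed.

Lemma leaky_sum_ge0 f t : (forall i, 0 <= f i) -> 0 <= leaky_sum f t.
Proof. by move=> f0; elim: t => //= t IH; rewrite addr_ge0 ?mulr_ge0. Qed.

Lemma leaky_sum_le f t M : 0 <= M -> (forall i, (i < t)%N -> f i <= M) ->
  leaky_sum f t <= g * M.
Proof.
move=> M0; elim: t => [|t IH] fM /=; first by rewrite mulr_ge0// ltW.
have := ler_wpM2l lam0 (IH (fun i it => fM i (ltnW it))).
have := fM t (leqnn _); rewrite mulrA gE; lra.
Qed.

(** Jensen: [lam a + b] is the average of [a] and [g b] with weights [lam] and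
    [1 - lam]. *)
Lemma sqr_leaky_sum f t :
  leaky_sum f t ^+ 2 <= g * leaky_sum (fun i => f i ^+ 2) t.
Proof.
elim: t => [|t IH] /=; first by rewrite expr0n mulr0.
set a := leaky_sum f t; set b := f t; rewrite -/a in IH.
have jensen : (lam * a + b) ^+ 2 <= lam * a ^+ 2 + g * b ^+ 2.
  have : 0 <= lam * (1 - lam) * (a - g * b) ^+ 2.
    exact: mulr_ge0 (mulr_ge0 lam0 (ltW lam1)) (sqr_ge0 _).
  have -> : lam * (1 - lam) * (a - g * b) ^+ 2
    = lam * (1 - lam) * a ^+ 2 - 2 * lam * a * b * ((1 - lam) * g)
      + (lam * g) * b ^+ 2 * ((1 - lam) * g) by ring.
  have -> : (1 - lam) * g = 1 by rewrite /g mulfV// gt_eqF.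
  rewrite gE; lra.
apply: le_trans jensen _; rewrite mulrDr lerD2r [leRHS]mulrCA.
exact: ler_wpM2l.
Qed.

(** Young's convolution inequality in l1: summing the recursion of [leaky_sum] over time. *)
Lemma sum_leaky_sum f n : (forall i, 0 <= f i) ->
  \sum_(0 <= t < n.+1) leaky_sum f t <= g * \sum_(0 <= t < n) f t.
Proof.
move=> f0.
have h : (1 - lam) * \sum_(0 <= t < n.+1) leaky_sum f t + lam * leaky_sum f n
    = \sum_(0 <= t < n) f t.
  elim: n => [|n IH]; first by rewrite big_nat1 big_geq //= !mulr0 addr0.
  by rewrite [in LHS]big_nat_recr//= [RHS]big_nat_recr//= -IH; ring.
rewrite -h mulrDr mulrA [g * _](_ : _ = 1) ?mul1r.
  by rewrite lerDl !mulr_ge0 ?leaky_sum_ge0// ltW.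
by rewrite /g mulVf// gt_eqF.
Qed.

(** Cauchy-Schwarz for the weights [lam^i], whose sum is at most [g]. *)
Lemma sqr_weighted_sum f n :
  (\sum_(0 <= i < n) lam ^+ i * f i) ^+ 2 <= g * \sum_(0 <= i < n) lam ^+ i * f i ^+ 2.
Proof.
set S := \sum_(0 <= i < n) lam ^+ i * f i.
have h : 2 * (S / g) * S <= \sum_(0 <= i < n) lam ^+ i * f i ^+ 2 + (S / g) ^+ 2 * g.
  apply: (@le_trans _ _ (\sum_(0 <= i < n) lam ^+ i * f i ^+ 2
     + (S / g) ^+ 2 * \sum_(0 <= i < n) lam ^+ i)); last first.
    by rewrite lerD2l ler_wpM2l ?sqr_ge0// geometric_sum_le.
  rewrite {2}/S !mulr_sumr -big_split; apply: ler_sum => i _ /=.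
  have := mulr_ge0 (exprn_ge0 i lam0) (sqr_ge0 (f i - S / g)).
  rewrite sqrrB; lra.
have -> : S ^+ 2 = g * (2 * (S / g) * S - (S / g) ^+ 2 * g) by field; rewrite gt_eqF.
by rewrite ler_pM2l//; lra.
Qed.

(** [lam^n] is the smallest of the first terms of the geometric series. *)
Lemma nat_mul_expr_le n : n%:R * lam ^+ n <= g.
Proof.
have lam1' : lam <= 1 by rewrite -subr_ge0 ltW.
apply: le_trans (geometric_sum_le lam01 n).
rewrite mulr_natl -[X in _ *+ X]subn0 -sumr_const_nat; apply: ler_sum_nat => i /andP[_ ni].
by apply: ler_wiXn2l; rewrite // ltnW.
Qed.

End Leaky.

(** * Regret in terms of one-step deviations *)

Section Regret.
Context {R : realType} {n m : nat} {p : nat -> nat} {T k : nat}.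
Variables (pb : ltv R n m p T) (c : problem_constants R).
Hypotheses (mu_gt0 : 0 < c_mu c) (sigma_gt0 : 0 < c_sigma c).
Hypothesis assm : ltv_assumptions pb c k.
Let K := constants_bound c.
Variables (lam C : R).
Hypotheses (lam01 : 0 < lam < 1) (C1 : 1 <= C).
Hypothesis decay : kkt_decays (c_mu c) (c_sigma c) K lam C.
Let H := pert_const K lam C (9 * K ^+ 2).
Variables (xis : forall t, 'cV[R]_(p t)) (xs : nat -> 'cV[R]_n) (us : nat -> 'cV[R]_m).
Hypothesis xisu : in_unc pb 0 T xis.
Hypothesis opt : is_OPT pb xis xs us.

Let g := (1 - lam)^-1.
Let K1 : 1 <= K. Proof. by have [] := constants_boundP c. Qed.
Let K0 : 0 < K. Proof. exact: lt_le_trans K1. Qed.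
Let lam0 : 0 <= lam. Proof. by case/andP: lam01 => /ltW. Qed.
Let lam1 : lam <= 1. Proof. by case/andP: lam01 => _ /ltW. Qed.

Let st := stages pb xis.

Definition true_tail (t1 : nat) (y : nat -> 'cV[R]_n) (v : nat -> 'cV[R]_m) eta : Prop :=
  kkt st t1 T y v eta /\ kkt_end true (costP pb (xis T)) (xbar pb (xis T)) (y T) (eta T).

Lemma true_regular t : (t < T)%N -> regular_stage (c_mu c) K (st t).
Proof. by move=> tT; apply: (stages_regular mu_gt0 assm) => //; apply: xisu; rewrite leq0n ltnW. Qed.

Lemma true_end_regular : regular_end (c_mu c) K true (costP pb (xis T)).
Proof.
have xiT : unc pb T (xis T) by apply: xisu; rewrite leqnn.
by have [_ bP cP _] := final_regular mu_gt0 assm xiT.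
Qed.

Lemma true_dual_coercive t1 : (t1 < T)%N -> dual_coercive (c_sigma c) st t1 T true.
Proof. by move=> tT; apply: (final_dual_coercive sigma_gt0 assm tT); exact: in_unc_sub xisu. Qed.

Lemma true_tail_exists t1 z : (t1 <= T)%N ->
  exists tr : (nat -> 'cV[R]_n) * (nat -> 'cV[R]_m) * (nat -> 'cV[R]_n),
    tr.1.1 t1 = z /\ true_tail t1 tr.1.1 tr.1.2 tr.2.
Proof.
move=> tT; have [_ cP] := true_end_regular isT.
have [|S [s [_ /(_ z) [y [v [eta [yz sol fin _]]]]]]] :=
  kkt_exists (st := st) (K := K) (xbar pb (xis T)) mu_gt0 cP (subnKC tT).
  by move=> t /andP[_]; exact: true_regular.
by exists (y, v, eta).
Qed.

Lemma true_tail_contraction t1 y v eta y' v' eta' j :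
  true_tail t1 y v eta -> true_tail t1 y' v' eta' -> (t1 <= j <= T)%N ->
  norm2 (y j - y' j) <= H * lam ^+ (j - t1) * norm2 (y t1 - y' t1) /\
  ((j < T)%N -> norm2 (v j - v' j) <= H * lam ^+ (j - t1) * norm2 (y t1 - y' t1)).
Proof.
move=> [sol fin] [sol' fin'] jt.
have [h1 h2] := kkt_contraction lam01 C1 decay (t1 := t1) (t2 := T) (st := st)
  (fun t tt => true_regular (proj2 (andP tt))) true_end_regular
  (@true_dual_coercive t1) sol sol' fin fin' jt.
have HC : C * lam ^+ (j - t1) * norm2 (y t1 - y' t1) <= H * lam ^+ (j - t1) * norm2 (y t1 - y' t1).
  by rewrite !ler_wpM2r ?norm2_ge0 ?exprn_ge0 ?(pert_const_ge c lam01 C1).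
by split=> [|/h2 h]; [exact: le_trans h1 HC | exact: le_trans h HC].
Qed.

Lemma opt_true_tail : exists eta, xs 0%N = init pb /\ true_tail 0 xs us eta.
Proof.
have [x0 [eta h]] := opt_kkt_final mu_gt0 assm (leq0n T) xisu opt.
by exists eta.
Qed.

Variables (x : nat -> 'cV[R]_n) (u : nat -> 'cV[R]_m).
Hypothesis x0 : x 0%N = init pb.
Hypothesis xS : forall t, (t < T)%N -> x t.+1 = dyn pb (xis t) (x t) (u t).
(** [Y i] and [V i] are the optimal continuation, under the true parameters, of the
    trajectory [x] from time [i] on. *)
Variables (Y : nat -> nat -> 'cV[R]_n) (V : nat -> nat -> 'cV[R]_m) (Eta : nat -> nat -> 'cV[R]_n).
Hypothesis Yx : forall i, (i <= T)%N -> Y i i = x i.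
Hypothesis tail : forall i, (i <= T)%N -> true_tail i (Y i) (V i) (Eta i).

Definition deviation t := norm2 (u t - V t t).

Lemma deviation_ge0 t : 0 <= deviation t. Proof. exact: norm2_ge0. Qed.

Lemma H_ge1 : 1 <= H.
Proof. exact: le_trans C1 (pert_const_ge c lam01 C1). Qed.

(** Telescoping over the continuations. The one from [i] and the one from [i.+1] start, at
    time [i.+1], from states that differ by [B (u i - V i i)]; from there on the difference
    contracts by [true_tail_contraction]. *)
Lemma tail_drift i : (i <= T)%N -> forall t, (i <= t <= T)%N ->
  norm2 (Y i t - xs t) <= H * K * lam ^+ (t - i) * leaky_sum lam deviation i /\
  ((t < T)%N -> norm2 (V i t - us t) <= H * K * lam ^+ (t - i) * leaky_sum lam deviation i).
Proof.
elim: i => [_ t tt|i IH iT t tt].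
  have [eta [xs0 tl]] := opt_true_tail.
  have := true_tail_contraction (tail (leq0n T)) tl tt.
  by rewrite Yx// x0 xs0 subrr norm2_0 /= !mulr0.
have it : (i <= t)%N by case/andP: tt => /ltnW.
have [|hY hV] := IH (ltnW iT) t; first by rewrite it; case/andP: tt.
have [sol fin] := tail (ltnW iT).
have tl : true_tail i.+1 (Y i) (V i) (Eta i) by split=> //; exact: kkt_sub sol.
have [cY cV] := true_tail_contraction (tail iT) tl tt.
have step : norm2 (Y i.+1 i.+1 - Y i i.+1) <= K * deviation i.
  have -> : Y i.+1 i.+1 - Y i i.+1 = stB (st i) *m (u i - V i i).
    have [|-> _ _] := sol i; first by rewrite leqnn.
    rewrite (Yx iT) (xS iT) (Yx (ltnW iT)) mulmxBr.
    rewrite (_ : dyn _ _ _ _ = stA (st i) *m x i + stB (st i) *m u i + stw (st i))//.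
    by do 3![move: (_ *m _) => ?]; apply/matrixP => r q; rewrite !mxE; ring.
  rewrite norm2_le; last by rewrite mulr_ge0 ?norm2_ge0// ltW.
  by rewrite exprMn sqr_norm2; exact: (reg_B (true_regular iT)).
have lS : lam ^+ (t - i) = lam * lam ^+ (t - i.+1).
  by rewrite -exprS -subnSK//; case/andP: tt.
have q0 : 0 <= H * lam ^+ (t - i.+1).
  by rewrite mulr_ge0 ?exprn_ge0// (le_trans ler01 H_ge1).
have := ler_wpM2l q0 step; rewrite lS in hY hV => hstep.
have E : H * lam ^+ (t - i.+1) * (K * deviation i)
    + H * K * (lam * lam ^+ (t - i.+1)) * leaky_sum lam deviation i
  = H * K * lam ^+ (t - i.+1) * leaky_sum lam deviation i.+1 by rewrite /=; ring.
split=> [|tT].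
  have -> : Y i.+1 t - xs t = (Y i.+1 t - Y i t) + (Y i t - xs t) by rewrite addrA subrK.
  apply: le_trans (norm2D _ _) _; rewrite -E; apply: lerD => //; exact: le_trans cY hstep.
have -> : V i.+1 t - us t = (V i.+1 t - V i t) + (V i t - us t) by rewrite addrA subrK.
apply: le_trans (norm2D _ _) _; rewrite -E; apply: lerD (hV tT); exact: le_trans (cV tT) hstep.
Qed.

Lemma state_drift t : (t <= T)%N ->
  norm2 (x t - xs t) <= H * K * leaky_sum lam deviation t.
Proof.
move=> tT; have [|h _] := tail_drift tT (t := t); first by rewrite leqnn.
by move: h; rewrite Yx// subnn mulr1.
Qed.

Lemma action_drift t : (t < T)%N ->
  norm2 (u t - us t) <= deviation t + H * K * leaky_sum lam deviation t.
Proof.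
move=> tT; have [|_ /(_ tT) h] := tail_drift (ltnW tT) (t := t); first by rewrite leqnn ltnW.
have -> : u t - us t = (u t - V t t) + (V t t - us t) by rewrite addrA subrK.
by apply: le_trans (norm2D _ _) _; rewrite lerD2l; move: h; rewrite subnn mulr1.
Qed.

Lemma bounded_quad {q} (Q : 'M[R]_q) d : bounded_mx K Q -> quad Q d <= K * nsq d.
Proof.
move=> bQ; rewrite quadE; have := young d (Q *m d) K0.
have := ler_wpM2l (ltW (_ : 0 < K^-1)) (bQ d); rewrite invr_gt0 => /(_ K0).
rewrite expr2 !mulrA mulVf ?gt_eqF// mul1r; lra.
Qed.

Definition regret_const : R := K * (3 * (H * K) ^+ 2 * g ^+ 2 + 2).

(** The difference of the two trajectories is a feasible direction, so the first variation
    of the cost at the optimum vanishes along it and only the quadratic term is left. *)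
Lemma regret_le_deviations :
  total_cost pb xis x u - total_cost pb xis xs us
  <= regret_const * \sum_(0 <= t < T) deviation t ^+ 2.
Proof.
have g0 : 0 < g by rewrite invr_gt0 subr_gt0; case/andP: lam01.
have [[xs0 xsS] _ optc] := opt.
have HK0 : 0 <= H * K by apply: mulr_ge0 (ltW K0); exact: le_trans H_ge1.
pose dx t := x t - xs t; pose du t := u t - us t.
have var : variation st 0 T true dx du.
  split=> //; first by rewrite /dx x0 xs0 subrr.
  move=> t /andP[_ tT]; rewrite /dx xS// xsS ?tT//.
  rewrite /dyn /= opprD addrACA subrr addr0 /du !mulmxBr.
  by rewrite opprD addrACA.
have xiT : unc pb T (xis T) by apply: xisu; rewrite leqnn.
have [sP _ _ _] := final_regular mu_gt0 assm xiT.
have sym t : (0 <= t < T)%N -> (stQ (st t))^T = stQ (st t) /\ (stR (st t))^T = stR (st t).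
  by move=> /andP[_ tT]; apply: (stages_sym assm) => //; apply: xisu; rewrite leq0n ltnW.
have fv := opt_first_variation sym (fun=> sP) (y := xs) (v := us) (x := xbar pb (xis T)) _ var.
have cost := real_cost_expand (terminal := true) (xbar pb (xis T)) xs us dx du 1 sym (fun=> sP).
have -> : total_cost pb xis x u = real_cost st 0 T true (costP pb (xis T)) (xbar pb (xis T))
   (fun t => xs t + 1 *: dx t) (fun t => us t + 1 *: du t).
  rewrite /total_cost /real_cost; congr (_ + _).
    by apply: eq_bigr => t _; rewrite !scale1r /dx /du ![_ + (_ - _)]addrC !subrK.
  by rewrite !scale1r /dx ![_ + (_ - _)]addrC !subrK.
rewrite cost fv; last first.
  move=> dy dv e vr; rewrite -lee_fin; exact: optc _ _ (variation_feasible e _ vr).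
rewrite mulr0 addr0 expr1n mul1r addrAC subrr add0r.
set e2 := fun t => deviation t ^+ 2; set L := leaky_sum lam e2.
have dxE t : (t <= T)%N -> nsq (dx t) <= (H * K) ^+ 2 * g * L t.
  move=> tT; rewrite -mulrA; apply: le_trans (_ : _ <= (H * K) ^+ 2 * leaky_sum lam deviation t ^+ 2) _.
    rewrite -exprMn -norm2_le; first exact: state_drift.
    exact: mulr_ge0 HK0 (leaky_sum_ge0 lam01 _ deviation_ge0).
  by rewrite ler_wpM2l ?sqr_ge0// sqr_leaky_sum.
have duE t : (t < T)%N -> nsq (du t) <= 2 * e2 t + 2 * ((H * K) ^+ 2 * g * L t).
  move=> tT; set a := deviation t; set b := H * K * leaky_sum lam deviation t.
  have a0 : 0 <= a by exact: deviation_ge0.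
  have b0 : 0 <= b.
    exact: mulr_ge0 HK0 (leaky_sum_ge0 lam01 _ deviation_ge0).
  have : nsq (du t) <= (a + b) ^+ 2 by rewrite -norm2_le ?addr_ge0// action_drift.
  have : b ^+ 2 <= (H * K) ^+ 2 * g * L t.
    by rewrite /b exprMn -mulrA ler_wpM2l ?sqr_ge0// sqr_leaky_sum.
  have := sqr_ge0 (a - b); rewrite /e2 -/a; nra.
have L0 t : 0 <= L t by apply: leaky_sum_ge0 => // i; exact: sqr_ge0.
have sumL : \sum_(0 <= t < T.+1) L t <= g * \sum_(0 <= t < T) e2 t.
  by apply: sum_leaky_sum => // i; exact: sqr_ge0.
have [bP _] := true_end_regular isT.
have A0 : 0 <= (H * K) ^+ 2 * g by rewrite mulr_ge0 ?sqr_ge0 ?ltW.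
have e1 : \sum_(0 <= t < T) (quad (stQ (st t)) (dx t) + quad (stR (st t)) (du t))
   <= \sum_(0 <= t < T) (K * (3 * ((H * K) ^+ 2 * g)) * L t + K * 2 * e2 t).
  apply: ler_sum_nat => t /andP[_ tT].
  have h1 := bounded_quad (dx t) (reg_Q (true_regular tT)).
  have h2 := bounded_quad (du t) (reg_R (true_regular tT)).
  have := ler_wpM2l (ltW K0) (dxE t (ltnW tT)); have := ler_wpM2l (ltW K0) (duE t tT); lra.
have e3 : quad (costP pb (xis T)) (dx T) <= K * (3 * ((H * K) ^+ 2 * g)) * L T.
  apply: le_trans (bounded_quad _ bP) _; rewrite -mulrA ler_pM2l//.
  apply: le_trans (dxE T (leqnn T)) _; have := mulr_ge0 A0 (L0 T); lra.
apply: le_trans (lerD e1 e3) _.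
rewrite big_split /= -!mulr_sumr addrAC -mulrDr -big_nat_recr//=.
have B0 : 0 <= K * (3 * ((H * K) ^+ 2 * g)) by rewrite mulr_ge0 ?(ltW K0)// mulr_ge0 ?ler0n.
have := ler_wpM2l B0 sumL; rewrite /regret_const -/e2; lra.
Qed.

End Regret.

(** * One step of MPC *)

Section Deviation.
Context {R : realType} {n m : nat} {p : nat -> nat} {T k : nat}.
Variables (pb : ltv R n m p T) (c : problem_constants R).
Hypotheses (mu_gt0 : 0 < c_mu c) (sigma_gt0 : 0 < c_sigma c).
Hypothesis kT : (1 <= k <= T)%N.
Hypothesis assm : ltv_assumptions pb c k.
Let K := constants_bound c.
Variables (lam C : R).
Hypotheses (lam01 : 0 < lam < 1) (C1 : 1 <= C).
Hypothesis decay : kkt_decays (c_mu c) (c_sigma c) K lam C.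
Let H := pert_const K lam C (9 * K ^+ 2).
Variables (xis : forall t, 'cV[R]_(p t)).
Hypothesis xisu : in_unc pb 0 T xis.
Variable pred : nat -> forall t, 'cV[R]_(p t).
Hypothesis valid : valid_predictions pb k pred.

Let K1 : 1 <= K. Proof. by have [] := constants_boundP c. Qed.
Let lam0 : 0 <= lam. Proof. by case/andP: lam01 => /ltW. Qed.
Let lam1 : lam <= 1. Proof. by case/andP: lam01 => _ /ltW. Qed.

Local Notation rho := (pred_err T xis pred).

Lemma pred_err_ge0 t tau : 0 <= rho t tau.
Proof. by rewrite /pred_err; case: ifP; rewrite ?norm2_ge0. Qed.

Lemma pred_err_le1 t tau : (tau <= k)%N -> rho t tau <= 1.
Proof.
move=> tk; rewrite /pred_err; case: ifP => // tT.
have [diam _ _ _ _] := assm; apply: diam => //; last by apply: xisu; rewrite tT.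
have tT' : (t <= T)%N := leq_trans (leq_addr _ _) tT.
by apply: (valid tT'); rewrite leq_addr/= leq_min leq_add2l tk tT.
Qed.

Definition short_error (t : nat) : R := \sum_(0 <= tau < k) lam ^+ tau * rho t tau.
Definition fast_error (t : nat) : R :=
  \sum_(0 <= tau < k.+1) lam ^+ (2 * tau)%N * rho t tau.

Lemma short_error_ge0 t : 0 <= short_error t.
Proof. by apply: sumr_ge0 => i _; rewrite mulr_ge0 ?exprn_ge0 ?pred_err_ge0. Qed.

Lemma short_error_le t : short_error t <= (1 - lam)^-1.
Proof.
apply: le_trans (geometric_sum_le lam01 k); apply: ler_sum_nat => i /andP[_ ik].
by rewrite ler_piMr ?exprn_ge0// pred_err_le1// ltnW.
Qed.

Lemma fast_error_le t : fast_error t <= short_error t + lam ^+ k.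
Proof.
rewrite /fast_error big_nat_recr//=; apply: lerD.
  apply: ler_sum_nat => i _; rewrite ler_wpM2r ?pred_err_ge0//.
  by apply: ler_wiXn2l => //; rewrite leq_pmull.
apply: le_trans (_ : _ <= lam ^+ (2 * k)) _.
  by rewrite ler_piMr ?exprn_ge0 ?pred_err_le1.
by apply: ler_wiXn2l => //; rewrite leq_pmull.
Qed.

(** [sol_const * (D + 1)] bounds the state that the true continuation from a state of norm
    at most [D] reaches [k] steps later, and [K] the target that MPC uses in its place; the
    factor [D + 1] is the one of [pert_bound]. *)
Definition terminal_gain (D : R) : R :=
  (D + 1) * (K + sol_const K lam C (K ^+ 4) * (D + 1)).

Lemma sum_nat_from (f : nat -> R) t L :
  \sum_(t <= s < t + L) f s = \sum_(0 <= tau < L) f (t + tau)%N.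
Proof. by rewrite sum_shift big_mkord. Qed.

Lemma error_term_le D q t tau : 0 <= q <= D ->
  lam ^+ tau * rho t tau * (lam ^+ tau * q + 1)
  <= D * (lam ^+ (2 * tau)%N * rho t tau) + lam ^+ tau * rho t tau.
Proof.
move=> /andP[q0 qD]; rewrite mulrDr mulr1 lerD2r mulnC exprM.
have := mulr_ge0 (sqr_ge0 (lam ^+ tau)) (pred_err_ge0 t tau).
by move=> /(ler_wpM2r)/(_ _ _ qD); lra.
Qed.

(** Far from the end, cut the true continuation at [t + k]: it solves the problem of MPC up
    to the parameters and the prescribed last state. Near the end both solve a
    problem up to [T] and only the parameters differ; the term of the error at [t + k], which
    is at most [lam^k], is absorbed in the one with [terminal_gain]. *)
Lemma mpc_deviation D t y v y' v' eta' :
  (t < T)%N -> 1 <= D ->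
  ftocp_opt pb t (minn (t + k) T) (y' t) (pred t) (mpc_terminal pb k t (pred t)) y v ->
  true_tail pb xis t y' v' eta' -> norm2 (y' t) <= D ->
  norm2 (v t - v' t) <=
    H * (D * fast_error t + short_error t + terminal_gain D * lam ^+ k).
Proof.
move=> tT D1 opt [sol' fin'] zD; have /andP[k0 kT'] := kT.
have D0 : 0 <= D by exact: le_trans D1.
have zD' : 0 <= norm2 (y' t) <= D by rewrite norm2_ge0.
have H0 : 0 <= H by exact: le_trans (H_ge1 c lam01 C1).
have Sc1 : 1 <= sol_const K lam C (K ^+ 4).
  by apply: sol_const_ge1 => //; rewrite exprn_ge0// (le_trans ler01).
have predu := valid (ltnW tT).
have G1 : 1 <= terminal_gain D.
  rewrite /terminal_gain; have : 1 <= K + sol_const K lam C (K ^+ 4) * (D + 1).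
    have := K1; nra.
  nra.
have dE s : norm2 (pred t (t + s) - xis (t + s)) = norm2 (xis (t + s)%N - pred t (t + s)%N).
  exact: norm2_sub.
move: opt; rewrite /mpc_terminal; case: ltnP => tk opt; rewrite norm2_sub.
  have tkT : (t + k < T)%N by rewrite addnC -ltn_subRL.
  rewrite (minn_idPl (ltnW tkT)) in predu opt.
  have predu' : in_unc pb t (t + k).-1 (pred t) by apply: in_unc_sub predu => //; exact: leq_pred.
  have xisu' : in_unc pb t (t + k).-1 xis.
    by apply: in_unc_sub xisu => //; apply: leq_trans (leq_pred _) (ltnW tkT).
  have [yz yzeta [eta sol]] := opt_kkt_indicator assm (leq_addr _ _) (ltnW tkT) predu' opt.
  have xK : norm2 (y (t + k)%N) <= K.
    by rewrite yzeta; apply: (xbar_le assm (ltnW tkT)); apply: predu; rewrite leq_addr leqnn.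
  have xK3 : norm2 (y (t + k)%N) <= 3 * K by have := K1; lra.
  have tt2 : (t < t + k <= T)%N by rewrite (ltnW tkT) andbT -{1}[t]addn0 ltn_add2l.
  have := indicator_perturbation mu_gt0 assm lam01 C1 decay tt2 xisu' predu'
    (indicator_dual_coercive sigma_gt0 assm tk xisu')
    (indicator_dual_coercive sigma_gt0 assm tk predu')
    (kkt_sub (leqnn t) (ltnW tkT) sol') sol (esym yz) xK3.
  rewrite yz => h; apply: le_trans h _.
  rewrite pert_boundE -/H ler_wpM2l// -addnS sum_nat_from big_nat_recr//= addKn eqxx.
  apply: lerD.
    apply: (@le_trans _ _ (\sum_(0 <= tau < k) (D * (lam ^+ (2 * tau)%N * rho t tau)
        + lam ^+ tau * rho t tau))).
      apply: ler_sum_nat => tau /andP[_ tauk]; rewrite addKn eqn_add2l (ltn_eqF tauk).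
      have := @error_term_le D _ t tau zD'; rewrite {1}/pred_err dE ifT//.
      by apply: leq_trans (ltnW tkT); rewrite leq_add2l ltnW.
    rewrite big_split /= -mulr_sumr lerD2r ler_wpM2l// /fast_error [leRHS]big_nat_recr//=.
    by rewrite lerDl mulr_ge0 ?exprn_ge0 ?pred_err_ge0.
  have yb : norm2 (y' (t + k)%N) <= sol_const K lam C (K ^+ 4) * (D + 1).
    rewrite norm2_le; last by rewrite mulr_ge0 ?addr_ge0// (le_trans ler01).
    have xiT : unc pb T (xis T) by apply: xisu; rewrite leqnn.
    have [_ bP cP xTK] := final_regular mu_gt0 assm xiT.
    have K40 : 0 <= K ^+ 4 by rewrite exprn_ge0// (le_trans ler01).
    have [||||h' _] := kkt_bound K1 lam01 C1 decay (D := K ^+ 4) (t1 := t) (t2 := T)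
      (terminal := true) (P := costP pb (xis T)) K40 tT _ (fun=> conj bP cP) _ sol' _ (j := (t + k)%N).
    - by move=> s /andP[_ sT]; exact: (true_regular mu_gt0 assm xisu sT).
    - exact: (true_dual_coercive sigma_gt0 assm xisu tT).
    - rewrite /end_res; have -> : costP pb (xis T) *m y' T + eta' T = costP pb (xis T) *m xbar pb (xis T).
        by have := fin' isT; rewrite mulmxBr => /eqP; rewrite addrAC subr_eq0 => /eqP.
      have := le_trans (bP _) (ler_wpM2l (sqr_ge0 _) xTK); rewrite -/K; lra.
    - by rewrite leq_addr ltnW.
    apply: le_trans (le_trans _ h') _; first by rewrite lerDl nsq_ge0.
    have q1 : (lam ^+ k) ^+ 2 <= 1 by rewrite exprn_ile1 ?exprn_ge0 ?exprn_ile1.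
    have qz : (lam ^+ k) ^+ 2 * nsq (y' t) <= D ^+ 2.
      apply: (@le_trans _ _ (nsq (y' t))); last by rewrite -norm2_le.
      by rewrite ler_piMl ?nsq_ge0.
    have qz1 : (lam ^+ k) ^+ 2 * nsq (y' t) + 1 <= (D + 1) ^+ 2 by nra.
    rewrite addKn; apply: le_trans (ler_wpM2l (le_trans ler01 Sc1) qz1) _.
    by rewrite exprMn ler_wpM2r ?sqr_ge0// expr2 ler_peMl// (le_trans ler01).
  rewrite [leRHS]mulrC -mulrA; apply: ler_wpM2l; first exact: exprn_ge0.
  rewrite /terminal_gain mulrC; apply: ler_pM; rewrite ?norm2_ge0 ?addr_ge0 ?mulr_ge0 ?exprn_ge0 ?norm2_ge0//.
    by rewrite lerD2r; apply: le_trans zD; rewrite ler_piMl ?norm2_ge0 ?exprn_ile1.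
  by apply: le_trans (norm2B _ _) _; rewrite addrC; exact: lerD.
have Ttk : (T <= t + k)%N by rewrite addnC -leq_subLR.
rewrite (minn_idPr Ttk) in predu opt.
have [yz [eta [sol fin]]] := opt_kkt_final mu_gt0 assm (ltnW tT) predu opt.
have xisu' : in_unc pb t T xis by exact: in_unc_sub xisu.
have := final_perturbation mu_gt0 sigma_gt0 assm lam01 C1 decay tT xisu' predu sol' sol fin' fin (esym yz).
move=> h; apply: le_trans h _; rewrite yz pert_boundE -/H ler_wpM2l//.
have -> : T.+1 = (t + (T - t).+1)%N by rewrite addnS subnKC// ltnW.
rewrite sum_nat_from.
apply: (@le_trans _ _ (\sum_(0 <= tau < k.+1) (D * (lam ^+ (2 * tau)%N * rho t tau)
        + lam ^+ tau * rho t tau))).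
  rewrite [leRHS](big_cat_nat (n := (T - t).+1))//=; last by rewrite ltnS leq_subLR.
  rewrite ler_wpDr//.
    apply: sumr_ge0 => i _.
    by rewrite addr_ge0 ?mulr_ge0 ?exprn_ge0 ?pred_err_ge0.
  apply: ler_sum_nat => tau /andP[_ tauk]; rewrite addKn.
  have := @error_term_le D _ t tau zD'; rewrite {1}/pred_err dE ifT//.
  by rewrite -leq_subRL// ltnW.
rewrite big_split /= -mulr_sumr -addrA lerD2l big_nat_recr//= lerD2l.
by rewrite mulrC ler_wpM2r ?exprn_ge0// (le_trans (pred_err_le1 _ _)).
Qed.

End Deviation.

Arguments short_error {R p} T k lam xis pred t.
Arguments fast_error {R p} T k lam xis pred t.

(** * The closed loop *)

Section ClosedLoop.
Context {R : realType} {n m : nat} {p : nat -> nat} {T k : nat}.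
Variables (pb : ltv R n m p T) (c : problem_constants R).
Hypotheses (mu_gt0 : 0 < c_mu c) (sigma_gt0 : 0 < c_sigma c).
Hypothesis kT : (1 <= k <= T)%N.
Hypothesis assm : ltv_assumptions pb c k.
Let K := constants_bound c.
Variables (lam C : R).
Hypotheses (lam01 : 0 < lam < 1) (C1 : 1 <= C).
Hypothesis decay : kkt_decays (c_mu c) (c_sigma c) K lam C.
Let H := pert_const K lam C (9 * K ^+ 2).
Variables (xis : forall t, 'cV[R]_(p t)) (xs : nat -> 'cV[R]_n) (us : nat -> 'cV[R]_m).
Hypothesis xisu : in_unc pb 0 T xis.
Hypothesis opt : is_OPT pb xis xs us.
Hypothesis xsD : forall t, (t <= T)%N -> norm2 (xs t) <= c_Dxstar c.
Variable pred : nat -> forall t, 'cV[R]_(p t).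
Hypothesis valid : valid_predictions pb k pred.
Variables (x : nat -> 'cV[R]_n) (u : nat -> 'cV[R]_m).
Hypothesis mpc : is_MPC pb k xis pred x u.

Let g := (1 - lam)^-1.
Let K1 : 1 <= K. Proof. by have [] := constants_boundP c. Qed.
Let K0 : 0 < K. Proof. exact: lt_le_trans K1. Qed.
Let H1 : 1 <= H. Proof. exact: H_ge1. Qed.
Let H0 : 0 < H. Proof. exact: lt_le_trans H1. Qed.
Let g0 : 0 < g. Proof. by rewrite invr_gt0 subr_gt0; case/andP: lam01. Qed.
Let lam0 : 0 <= lam. Proof. by case/andP: lam01 => /ltW. Qed.
Let lam1 : lam <= 1. Proof. by case/andP: lam01 => _ /ltW. Qed.

(** States bounded by [D] give deviations at most [H (D c1 + g + 1)], and these move the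
    states at most [loop_gain (D c1 + g + 1)] away from the optimal ones. With
    [c1 = 1 / (2 loop_gain)], [state_bound] is the value of [D] that this reproduces. *)
Definition loop_gain : R := H ^+ 2 * K * g.
Definition state_bound : R := 2 * (K + loop_gain * (g + 1)).
Definition deviation_const : R :=
  2 * H ^+ 2 * ((state_bound + 1) ^+ 2 * g
                + (terminal_gain c lam C state_bound + state_bound) ^+ 2).

Let D := state_bound.
Let G := terminal_gain c lam C D.

Lemma loop_gain_gt0 : 0 < loop_gain.
Proof. exact: mulr_gt0 (mulr_gt0 (exprn_gt0 _ H0) K0) g0. Qed.

Lemma state_bound_ge1 : 1 <= state_bound.
Proof.
have := mulr_gt0 loop_gain_gt0 g0; have := loop_gain_gt0; have := K1.
rewrite /state_bound; lra.
Qed.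

Let D0 : 0 <= D. Proof. exact: le_trans state_bound_ge1. Qed.

Lemma terminal_gain_ge0 : 0 <= G.
Proof.
have D10 : 0 <= D + 1 by exact: addr_ge0.
apply: mulr_ge0 => //; apply: addr_ge0 (ltW K0) (mulr_ge0 _ D10).
by apply: le_trans ler01 _; apply: sol_const_ge1 => //; rewrite exprn_ge0 ?ltW.
Qed.

Hypothesis small : forall t, (t < T)%N ->
  fast_error T k lam xis pred t <= (2 * loop_gain)^-1.
Hypothesis long : G * lam ^+ k <= 1.

(** The states stay below [state_bound] by induction on time, which makes [mpc_deviation]
    available at every time; it remains to sum the squares. *)
Lemma mpc_regret :
  total_cost pb xis x u - total_cost pb xis xs us <= regret_const c lam C * deviation_const *
    (\sum_(0 <= tau < k) lam ^+ tau * pred_power T xis pred tau + lam ^+ (2 * k) * T%:R).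
Proof.
have [x0 loop] := mpc.
have /choice[tr trP] : forall i, exists tr : (nat -> 'cV[R]_n) * (nat -> 'cV[R]_m) * (nat -> 'cV[R]_n),
    (i <= T)%N -> tr.1.1 i = x i /\ true_tail pb xis i tr.1.1 tr.1.2 tr.2.
  move=> i; have [iT|iT] := leqP i T; last by exists (fun=> 0, fun=> 0, fun=> 0).
  by have [tr h] := true_tail_exists mu_gt0 assm xisu (x i) iT; exists tr.
pose Y i := (tr i).1.1; pose V i := (tr i).1.2; pose Eta i := (tr i).2.
have Yx i : (i <= T)%N -> Y i i = x i by move=> /trP[].
have tail i : (i <= T)%N -> true_tail pb xis i (Y i) (V i) (Eta i) by move=> /trP[].
have xS t : (t < T)%N -> x t.+1 = dyn pb (xis t) (x t) (u t) by move=> /loop[].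
pose dev := deviation u V.
have devE t : (t < T)%N -> norm2 (x t) <= D -> dev t <=
    H * (D * fast_error T k lam xis pred t + short_error T k lam xis pred t + G * lam ^+ k).
  move=> tT xD; have [[y [v [vopt ut]]] _] := loop t tT.
  rewrite /dev /deviation ut.
  have tail_t := tail t (ltnW tT); rewrite -(Yx t (ltnW tT)) in vopt xD.
  exact: (mpc_deviation mu_gt0 sigma_gt0 kT assm lam01 C1 decay xisu valid tT
    state_bound_ge1 vopt tail_t xD).
have xD t : (t <= T)%N -> norm2 (x t) <= D.
  elim/ltn_ind: t => t IH tT.
  have drift := state_drift mu_gt0 sigma_gt0 assm lam01 C1 decay xisu opt x0 xS Yx tail tT.
  pose e := H * (D * (2 * loop_gain)^-1 + g + 1).
  have e0 : 0 <= e.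
    rewrite mulr_ge0 ?(ltW H0)// !addr_ge0 ?(ltW g0) ?ler01// mulr_ge0//.
    by rewrite invr_ge0 mulr_ge0 ?ler0n// ltW// loop_gain_gt0.
  have dev_le i : (i < t)%N -> dev i <= e.
    move=> it; have iT := leq_trans it tT.
    apply: le_trans (devE i iT (IH i it (ltnW iT))) _; rewrite ler_pM2l//.
    apply: lerD => //; apply: lerD; first by rewrite ler_wpM2l// small.
    exact: (short_error_le assm lam01 xisu valid).
  have := leaky_sum_le lam01 e0 dev_le; rewrite -/g => lk.
  have xsK : norm2 (xs t) <= K.
    have [_ [_ [[? _ _ _] _]]] := constants_boundP c; exact: le_trans (xsD tT) _.
  have HK0 : 0 <= H * K by rewrite mulr_ge0 ?ltW.
  have : H * K * (g * e) = D / 2 + loop_gain * (g + 1).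
    rewrite /e /loop_gain; field.
    by rewrite !gt_eqF.
  have := ler_wpM2l HK0 lk; have := norm2_le_dist (x t) (xs t).
  have : D / 2 = K + loop_gain * (g + 1) by rewrite /D /state_bound; field.
  have := drift; rewrite -/H -/dev -/K; lra.
apply: le_trans (regret_le_deviations mu_gt0 sigma_gt0 assm lam01 C1 decay xisu opt x0 xS Yx tail) _.
have RC0 : 0 <= regret_const c lam C.
  rewrite /regret_const mulr_ge0 ?(ltW K0)// addr_ge0 ?ler0n// mulr_ge0 ?sqr_ge0//.
  by rewrite mulr_ge0 ?sqr_ge0 ?ler0n.
rewrite -mulrA; apply: ler_wpM2l => //.
have D1 : 0 <= deviation_const.
  rewrite /deviation_const mulr_ge0 ?(mulr_ge0 (ler0n _ 2) (sqr_ge0 _))//.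
  by rewrite addr_ge0 ?sqr_ge0// mulr_ge0 ?sqr_ge0// ltW.
pose rho := pred_err T xis pred.
have dev2 t : (t < T)%N ->
    dev t ^+ 2 <= deviation_const * (\sum_(0 <= tau < k) lam ^+ tau * rho t tau ^+ 2 + lam ^+ (2 * k)).
  move=> tT; set S := short_error T k lam xis pred t.
  have S0 : 0 <= S by exact: short_error_ge0.
  have q0 : 0 <= lam ^+ k by exact: exprn_ge0.
  have h : dev t <= H * ((D + 1) * S + (G + D) * lam ^+ k).
    apply: le_trans (devE t tT (xD t (ltnW tT))) _; rewrite ler_pM2l// -/S.
    have := ler_wpM2l D0 (fast_error_le assm lam01 xisu valid t); rewrite -/S; lra.
  have cs : S ^+ 2 <= g * \sum_(0 <= tau < k) lam ^+ tau * rho t tau ^+ 2.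
    exact: sqr_weighted_sum.
  set W := \sum_(0 <= tau < k) _ in cs *.
  have a0 : 0 <= (D + 1) * S by rewrite mulr_ge0 ?addr_ge0.
  have b0 : 0 <= (G + D) * lam ^+ k by rewrite mulr_ge0 ?addr_ge0 ?terminal_gain_ge0.
  have : dev t ^+ 2 <= H ^+ 2 * ((D + 1) * S + (G + D) * lam ^+ k) ^+ 2.
    have n1 : 0 <= dev t by exact: norm2_ge0.
    have n2 := mulr_ge0 (ltW H0) (addr_ge0 a0 b0).
    by rewrite -exprMn ler_pXn2r ?nnegrE.
  move=> /le_trans; apply.
  have : ((D + 1) * S + (G + D) * lam ^+ k) ^+ 2
     <= 2 * ((D + 1) ^+ 2 * (g * W) + (G + D) ^+ 2 * lam ^+ (2 * k)).
    have := ler_wpM2l (sqr_ge0 (D + 1)) cs.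
    have := sqr_ge0 ((D + 1) * S - (G + D) * lam ^+ k).
    rewrite mulnC exprM; lra.
  move=> /(ler_wpM2l (sqr_ge0 H))/le_trans; apply.
  have W0 : 0 <= W.
    by apply: sumr_ge0 => i _; exact: mulr_ge0 (exprn_ge0 _ lam0) (sqr_ge0 _).
  have L0 : 0 <= lam ^+ (2 * k) by exact: exprn_ge0.
  rewrite /deviation_const -/D -/G.
  have HH := sqr_ge0 H.
  have := mulr_ge0 HH (mulr_ge0 (sqr_ge0 (G + D)) W0).
  have := mulr_ge0 HH (mulr_ge0 (mulr_ge0 (sqr_ge0 (D + 1)) (ltW g0)) L0).
  lra.
apply: le_trans (_ : _ <= \sum_(0 <= t < T) deviation_const *
   (\sum_(0 <= tau < k) lam ^+ tau * rho t tau ^+ 2 + lam ^+ (2 * k))) _.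
  by apply: ler_sum_nat => t /andP[_ tT]; exact: dev2.
rewrite -mulr_sumr ler_wpM2l// big_split /= sumr_const_nat subn0 mulr_natr lerD2r.
rewrite exchange_big_nat /=; apply: ler_sum_nat => tau /andP[_ tauk].
rewrite -mulr_sumr ler_wpM2l ?exprn_ge0// /pred_power.
have [tau0|tau0] := posnP tau.
  by rewrite tau0 subn0 [leRHS]big_nat_recr//= lerDl sqr_ge0.
have tauT : (tau <= T)%N by case/andP: kT => _; exact: leq_trans (ltnW tauk).
have le1 : ((T - tau).+1 <= T)%N by rewrite ltn_subLR// -[X in (X < _)%N]add0n ltn_add2r.
rewrite (big_cat_nat (n := (T - tau).+1))//= -[leRHS]addr0 lerD2l big_nat big1//.
move=> t /andP[tt _]; rewrite /rho /pred_err ifF ?expr0n//.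
by apply/negbTE; rewrite -ltnNge addnC -ltn_subLR.
Qed.

End ClosedLoop.

(** Constants are chosen in the order [lam], [H2], [state_bound], [c1], [c0]; the last one
    makes [lam^k] small because [k lam^k <= 1 / (1 - lam)]. *)
Theorem theorem4p2 (R : realType) (c : problem_constants R)
    (mu_gt0 : 0 < c_mu c) (sigma_gt0 : 0 < c_sigma c) :
  exists H2 lambda2 c0 c1 C : R,
    [/\ 1 <= H2, 0 < lambda2 < 1, 0 < c0, 0 < c1 & 0 < C] /\
    forall (n m : nat) (p : nat -> nat) (T k : nat) (pb : ltv R n m p T)
      (xis : forall t, 'cV[R]_(p t))
      (xs : nat -> 'cV[R]_n) (us : nat -> 'cV[R]_m),
      (1 <= k <= T)%N ->
      ltv_assumptions pb c k ->
      in_unc pb 0 T xis ->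
      is_OPT pb xis xs us ->
      (forall t, (t <= T)%N -> norm2 (xs t) <= c_Dxstar c) ->
      dynamics_lipschitz_in_u pb c xis ->
      perturbation_constants pb c H2 lambda2 k xis xs /\
      forall (pred : nat -> forall t, 'cV[R]_(p t))
        (x : nat -> 'cV[R]_n) (u : nat -> 'cV[R]_m),
        valid_predictions pb k pred ->
        c0 <= k%:R ->
        (forall t, (t < T)%N ->
           \sum_(0 <= tau < k.+1) lambda2 ^+ (2 * tau)%N * pred_err T xis pred t tau
             <= c1) ->
        is_MPC pb k xis pred x u ->
        let E := \sum_(0 <= tau < k) lambda2 ^+ tau * pred_power T xis pred tau in
        total_cost pb xis x u - total_cost pb xis xs us
          <= C * (Num.sqrt (T%:R * E + lambda2 ^+ (2 * k)%N * T%:R ^+ 2) + E).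
Proof.
have K1 : 1 <= constants_bound c by have [] := constants_boundP c.
have [lam [C [lam01 C1 decay]]] := kkt_decay mu_gt0 sigma_gt0 (lt_le_trans ltr01 K1).
pose D := state_bound c lam C.
pose G := terminal_gain c lam C D.
pose g := (1 - lam)^-1.
have g0 : 0 < g by rewrite invr_gt0 subr_gt0; case/andP: lam01.
have G0 : 0 <= G by exact: terminal_gain_ge0.
pose Cf := regret_const c lam C * deviation_const c lam C.
have lg0 := loop_gain_gt0 c lam01 C1.
exists (pert_const (constants_bound c) lam C (9 * constants_bound c ^+ 2)), lam,
  (G * g + 1), (2 * loop_gain c lam C)^-1, (`|Cf| + 1); split.
  split=> //; first exact: H_ge1.
  - by rewrite ltr_wpDl// mulr_ge0// ltW.
  - by rewrite invr_gt0 mulr_gt0.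
  - by rewrite ltr_wpDl.
move=> n m p T k pb xis xs us kT assm xisu opt xsD _; split.
  exact: perturbation_constants_hold.
move=> pred x u valid kc0 small mpc /=; set E := \sum_(0 <= tau < k) _.
have lam0 : 0 <= lam by case/andP: lam01 => /ltW.
have lam1 : lam <= 1 by case/andP: lam01 => _ /ltW.
have long : G * lam ^+ k <= 1.
  have k0 : 0 < k%:R :> R by rewrite ltr0n; case/andP: kT.
  rewrite -(ler_pM2l k0) mulr1 mulrCA.
  apply: le_trans (_ : _ <= G * g) _; last by apply: le_trans kc0; rewrite lerDl.
  by rewrite ler_wpM2l// nat_mul_expr_le.
have := mpc_regret mu_gt0 sigma_gt0 kT assm lam01 C1 decay xisu opt xsD valid mpc small long.
rewrite -/E -/Cf => reg; apply: le_trans reg _.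
have E0 : 0 <= E.
  apply: sumr_ge0 => i _; rewrite mulr_ge0 ?exprn_ge0//.
  by apply: sumr_ge0 => t _; rewrite sqr_ge0.
have A0 : 0 <= E + lam ^+ (2 * k) * T%:R by rewrite addr_ge0 ?mulr_ge0 ?exprn_ge0.
apply: (@le_trans _ _ ((`|Cf| + 1) * (E + lam ^+ (2 * k) * T%:R))).
  by rewrite ler_wpM2r//; apply: le_trans (ler_norm _) _; rewrite lerDl.
have Cf1 : 0 < `|Cf| + 1 by rewrite ltr_wpDl.
rewrite ler_pM2l// addrC lerD2r.
(* lam^(2k) <= lam^k, and lam^k T is the square root of the second term under the root *)
apply: le_trans (_ : _ <= lam ^+ k * T%:R) _.
  by rewrite ler_wpM2r//; apply: ler_wiXn2l => //; rewrite leq_pmull.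
rewrite -[leLHS]ger0_norm ?mulr_ge0 ?exprn_ge0// -sqrtr_sqr ler_wsqrtr//.
by rewrite exprMn -exprM mulnC lerDr mulr_ge0.
Qed.
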